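(* Suppose that the standing assumptions (1)-(3) of the context hold, that $\bar a_2,\bar b_2\neq0$, that $\partial_\omega\|U_0\|_{L^2}^2>0$, and that $\lambda_0\in i(-\min\{\omega,s\},\min\{\omega,s\})$ is a simple zero of $\lambda\mapsto E(\lambda,0)$. Then, for $\epsilon>0$ sufficiently small, there exists an eigenvalue of $\mathcal L_\epsilon$ close to $\lambda_0$ on the imaginary axis.
   Context: Setting. Fix real constants $\omega,s>0$ and a function $F:\mathbb R\times\mathbb R\times\mathbb R\to\mathbb R$, $(\zeta_1,\zeta_2,\mu)\mapsto F(\zeta_1,\zeta_2;\mu)$, with real parameter $\mu$; $\partial_jF$ ($j=1,2$) is the derivative in the $j$-th argument. The coupled nonlinear Schrödinger equations are $$i\partial_tu+\partial_x^2u+\partial_1F(|u|^2,|v|^2;\mu)u=0,\quad i\partial_tv+\partial_x^2v+\partial_2F(|u|^2,|v|^2;\mu)v=0.$$ A real-valued solution $(U,V)$, with $U(x),V(x)\to0$ as $x\to\pm\infty$ (a homoclinic solution), of the stationary system $$-U''+\omega U-\partial_1F(U^2,V^2;\mu)U=0,\quad -V''+sV-\partial_2F(U^2,V^2;\mu)V=0$$ gives the solitary wave $(e^{i\omega t}U(x),e^{ist}V(x))$. Standing assumptions. (1) $F$ is $C^3$ and $F(0,0;\mu)=\partial_1F(0,0;\mu)=\partial_2F(0,0;\mu)=0$, $\partial_\mu F(\zeta,0;\mu)=0$ for all $\zeta,\mu\in\mathbb R$. One writes $\partial_1^jF(\zeta,0)$ for $\partial_1^jF(\zeta,0;\mu)$.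 (2) $-U''+\omega U-\partial_1F(U^2,0)U=0$ has a homoclinic solution $U_0\not\equiv0$ with $\lim_{x\to\pm\infty}U_0(x)=0$ and $U_0'(0)=0$; it is taken positive, even, with $U_0'(x)<0$ for $x>0$. It depends on $\omega$, and $\partial_\omega\|U_0\|_{L^2}^2$ is the derivative of $\|U_0\|_{L^2(\mathbb R)}^2$ in $\omega$ along this family. (3) At $\mu=0$ the equation $-\delta V''+s\,\delta V-\partial_2F(U_0(x)^2,0;0)\delta V=0$ has a nonzero bounded solution $V_1(x)$ with $\lim_{x\to\pm\infty}V_1(x)=0$. Bifurcated waves. Let $\phi_{11},\phi_{12}$ solve $-\phi''+\omega\phi-\bigl(2\partial_1^2F(U_0^2,0)U_0^2+\partial_1F(U_0^2,0)\bigr)\phi=0$ with $\phi_{11}(0)=1,\phi_{11}'(0)=0$, $\phi_{12}(0)=0,\phi_{12}'(0)=1$; let $g=\partial_1\partial_2F(U_0^2,0;0)U_0V_1^2$, $U_2(x)=-\phi_{11}(x)\int_x^\infty\phi_{12}g\,dy-\phi_{12}(x)\int_0^x\phi_{11}g\,dy$, and $$\bar a_2=-\int_{\mathbb R}\partial_2\partial_\mu F(U_0^2,0;0)V_1^2\,dx,\quad \bar b_2=-2\int_{\mathbb R}\partial_1\partial_2F(U_0^2,0;0)U_0U_2V_1^2\,dx-\int_{\mathbb R}\partial_2^2F(U_0^2,0;0)V_1^4\,dx.$$ If $\bar a_2,\bar b_2\ne0$, a pitchfork bifurcation of $(U_0,0)$ occurs at $\mu=0$: for small $\epsilon>0$ and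 $\mu=\bar\mu\epsilon^2$, $\bar\mu=-\bar b_2/\bar a_2$, there are homoclinic solutions $(U_\epsilon,V_\epsilon)$ with $U_\epsilon=U_0+\epsilon^2U_2+O(\epsilon^4)$, $V_\epsilon=\pm(\epsilon V_1+O(\epsilon^3))$, giving the bifurcated solitary waves $(e^{i\omega t}U_\epsilon,e^{ist}V_\epsilon)$. Linearized operator. The linearized operator $\mathcal L:H^2(\mathbb R,\mathbb C^4)\subset L^2(\mathbb R,\mathbb C^4)\to L^2(\mathbb R,\mathbb C^4)$ around $(e^{i\omega t}U,e^{ist}V)$ is $$\mathcal L=-i\Sigma_3\left[-\partial_x^2I_4+\begin{pmatrix}\omega I_2&O_2\\O_2&sI_2\end{pmatrix}-\begin{pmatrix}B_{11}&B_{12}\\ B_{21}&B_{22}\end{pmatrix}\right],$$ with $\sigma_1=\begin{pmatrix}0&1\\1&0\end{pmatrix}$, $\sigma_3=\mathrm{diag}(1,-1)$, $\Sigma_3=\mathrm{diag}(\sigma_3,\sigma_3)$, and, all derivatives of $F$ being evaluated at $(U(x)^2,V(x)^2;\mu)$, $B_{11}=\partial_1^2F\,U^2(I_2+\sigma_1)+\partial_1F\,I_2$, $B_{12}=B_{21}=\partial_1\partial_2F\,UV(I_2+\sigma_1)$, $B_{22}=\partial_2^2F\,V^2(I_2+\sigma_1)+\partial_2F\,I_2$. $\mathcal L_\epsilon$ is the linearized operator around the bifurcated wave (with $\mu=\bar\mu\epsilon^2$), and $\mathcal L_0$ the one around the fundamental wave $(e^{i\omega t}U_0,0)$ at $\mu=0$.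 Evans function. Let $\nu_1=\sqrt{\omega-i\lambda}$, $\nu_2=\sqrt{\omega+i\lambda}$, $\nu_3=\sqrt{s-i\lambda}$, $\nu_4=\sqrt{s+i\lambda}$ with $-3\pi/4<\arg\nu_1,\arg\nu_3<\pi/4$ and $-\pi/4<\arg\nu_2,\arg\nu_4<3\pi/4$. Write $\mathcal L_\epsilon\psi=\lambda\psi$ as a first-order system $Y'=A(x,\lambda,\epsilon)Y$ for $Y=(\psi,\psi')^{\mathsf T}\in\mathbb C^8$. With $e_j$ the standard basis of $\mathbb C^4$, let $Y_j^-$ and $Y_{j+4}^+$ ($j=1,\dots,4$) be Jost solutions, i.e. solutions with $e^{-\nu_jx}Y_j^-\to(e_j,\nu_je_j)^{\mathsf T}$ as $x\to-\infty$ and $e^{\nu_jx}Y_{j+4}^+\to(e_j,-\nu_je_j)^{\mathsf T}$ as $x\to+\infty$, chosen analytic in $\lambda$ (here, near the segment $i(-\min\{\omega,s\},\min\{\omega,s\})$). The Evans function is $E(\lambda,\epsilon)=\det(Y_1^-\,Y_2^-\,Y_3^-\,Y_4^-\,Y_5^+\,Y_6^+\,Y_7^+\,Y_8^+)$, which is independent of $x$; its zeros do not depend on the choice of Jost solutions. *)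

(* Defs.v *)
From HB Require Import structures.
From mathcomp Require Import all_boot all_order all_algebra.
From mathcomp Require Import all_classical all_reals all_analysis.
From mathcomp Require Import complex.

Set Implicit Arguments.
Unset Strict Implicit.
Unset Printing Implicit Defensive.

Import Order.TTheory GRing.Theory Num.Theory.
Import numFieldNormedType.Exports.

Local Open Scope ring_scope.
Local Open Scope complex_scope.
Local Open Scope classical_set_scope.

(* Real-valued, unlike the 'Re and 'Im of a numClosedFieldType. *)
Local Notation Re := complex.Re.
Local Notation Im := complex.Im.

Section Nonlinearity.
Context {R : realType}.
Implicit Types F : R -> R -> R -> R.

Definition d1 F : R -> R -> R -> R := fun a b m =>
  derive1 (fun t => F t b m) a.
Definition d2 F : R -> R -> R -> R := fun a b m =>
  derive1 (fun t => F a t m) b.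
Definition dmu F : R -> R -> R -> R := fun a b m =>
  derive1 (fun t => F a b t) m.

Fixpoint Ck (k : nat) F : Prop :=
  continuous (fun z : R * R * R => F z.1.1 z.1.2 z.2) /\
  if k is k'.+1 then
    [/\ forall a b m, derivable (fun t => F t b m) a 1,
        forall a b m, derivable (fun t => F a t m) b 1 &
        forall a b m, derivable (fun t => F a b t) m 1] /\
    [/\ Ck k' (d1 F), Ck k' (d2 F) & Ck k' (dmu F)]
  else True.

Definition nonlinearity F : Prop :=
  [/\ Ck 3 F,
      forall m, [/\ F 0 0 m = 0, d1 F 0 0 m = 0 & d2 F 0 0 m = 0] &
      forall z m, dmu F z 0 m = 0].

End Nonlinearity.

Section Waves.
Context {R : realType}.
Implicit Types (F : R -> R -> R -> R) (f g U V phi : R -> R).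
Local Notation mu := (@lebesgue_measure R).

Definition derivable2 f : Prop :=
  forall x, derivable f x 1 /\ derivable (derive1 f) x 1.

Definition vanishing f : Prop :=
  f x @[x --> +oo] --> (0 : R) /\ f x @[x --> -oo] --> (0 : R).

Definition homoclinic F (omega s m : R) U V : Prop :=
  [/\ derivable2 U, derivable2 V,
      forall x, - derive1 (derive1 U) x + omega * U x
                - d1 F (U x ^+ 2) (V x ^+ 2) m * U x = 0,
      forall x, - derive1 (derive1 V) x + s * V x
                - d2 F (U x ^+ 2) (V x ^+ 2) m * V x = 0 &
      vanishing U /\ vanishing V].

(* The last argument of F is irrelevant here, as dmu F z 0 m = 0. *)
Definition fundamental F (omega : R) U : Prop :=
  [/\ derivable2 U,
      forall x, - derive1 (derive1 U) x + omega * U x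
                - d1 F (U x ^+ 2) 0 0 * U x = 0,
      vanishing U /\ derive1 U 0 = 0,
      (forall x, 0 < U x) /\ (forall x, U (- x) = U x) &
      forall x, 0 < x -> derive1 U x < 0].

Definition sqr_norm2 f : R := fine ('N[mu]_2%:E [EFin \o f])%E ^+ 2.

Definition V_mode F (s : R) U0 V1 : Prop :=
  [/\ derivable2 V1,
      forall x, - derive1 (derive1 V1) x + s * V1 x
                - d2 F (U0 x ^+ 2) 0 0 * V1 x = 0,
      exists x, V1 x <> 0,
      exists M, forall x, `|V1 x| <= M &
      vanishing V1].

Definition U_variation F (omega : R) U0 phi : Prop :=
  derivable2 phi /\
  forall x, - derive1 (derive1 phi) x + omega * phi x
            - (2 * d1 (d1 F) (U0 x ^+ 2) 0 0 * U0 x ^+ 2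
               + d1 F (U0 x ^+ 2) 0 0) * phi x = 0.

(* Integral from a to b, with the usual sign change when b < a. *)
Definition oint (a b : R) f : R :=
  if a <= b then \int[mu]_(y in `[a, b]) f y
  else - \int[mu]_(y in `[b, a]) f y.

Definition U2_source F U0 V1 : R -> R :=
  fun x => d1 (d2 F) (U0 x ^+ 2) 0 0 * U0 x * V1 x ^+ 2.

Definition U2_term F U0 V1 phi11 phi12 : R -> R := fun x =>
  - phi11 x * (\int[mu]_(y in `[x, +oo[) (phi12 y * U2_source F U0 V1 y))
  - phi12 x * oint 0 x (fun y => phi11 y * U2_source F U0 V1 y).

Definition a2_bar F U0 V1 : R :=
  - \int[mu]_x (d2 (dmu F) (U0 x ^+ 2) 0 0 * V1 x ^+ 2).

Definition b2_bar F U0 V1 U2 : R :=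
  - (2 * \int[mu]_x (d1 (d2 F) (U0 x ^+ 2) 0 0 * U0 x * U2 x * V1 x ^+ 2))
  - \int[mu]_x (d2 (d2 F) (U0 x ^+ 2) 0 0 * V1 x ^+ 4).

(* The remainders are uniform in x.  [sgn] selects one of the two branches of
   the pitchfork. *)
Definition bifurcated_waves F (omega s mbar : R) U0 U2 V1 (sgn : bool)
    (Ue Ve : R -> R -> R) : Prop :=
  (\forall e \near (0 : R)^'+,
     homoclinic F omega s (mbar * e ^+ 2) (Ue e) (Ve e)) /\
  exists C : R, \forall e \near (0 : R)^'+, forall x,
    `|Ue e x - (U0 x + e ^+ 2 * U2 x)| <= C * e ^+ 4 /\
    `|Ve e x - (-1) ^+ sgn * (e * V1 x)| <= C * e ^+ 3.

End Waves.

Section LinearizedOperator.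
Context {R : realType}.
Local Notation C := R[i].
Local Notation mu := (@lebesgue_measure R).
Variables (F : R -> R -> R -> R) (omega s m : R) (U V : R -> R).

Definition sigma1 : 'M[C]_2 := block_mx 0 1%:M 1%:M 0 : 'M[C]_(1 + 1).
Definition sigma3 : 'M[C]_2 := block_mx 1%:M 0 0 (- 1%:M) : 'M[C]_(1 + 1).
Definition Sigma3 : 'M[C]_4 := block_mx sigma3 0 0 sigma3 : 'M[C]_(2 + 2).

Definition at_wave (G : R -> R -> R -> R) (x : R) : R :=
  G (U x ^+ 2) (V x ^+ 2) m.

Definition B11 (x : R) : 'M[C]_2 :=
  (at_wave (d1 (d1 F)) x * U x ^+ 2)%:C *: (1%:M + sigma1)
  + (at_wave (d1 F) x)%:C *: 1%:M.
Definition B12 (x : R) : 'M[C]_2 :=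
  (at_wave (d1 (d2 F)) x * U x * V x)%:C *: (1%:M + sigma1).
Definition B22 (x : R) : 'M[C]_2 :=
  (at_wave (d2 (d2 F)) x * V x ^+ 2)%:C *: (1%:M + sigma1)
  + (at_wave (d2 F) x)%:C *: 1%:M.

Definition potential (x : R) : 'M[C]_4 :=
  (block_mx (omega%:C)%:M 0 0 (s%:C)%:M
   - block_mx (B11 x) (B12 x) (B12 x) (B22 x)) : 'M[C]_(2 + 2).

(* The operator applied to psi, where psi2 is its second weak derivative. *)
Definition linearized_op (psi psi2 : R -> 'cV[C]_4) : R -> 'cV[C]_4 := fun x =>
  - 'i%C *: (Sigma3 *m (- psi2 x + potential x *m psi x)).

Definition test_function (f : R -> R) : Prop :=
  (forall n x, derivable (derive1n n f) x 1) /\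
  exists M, forall x, M < `|x| -> f x = 0.

Definition weak_derivative (f g : R -> R) : Prop :=
  forall phi, test_function phi ->
    \int[mu]_x (f x * derive1 phi x) = - \int[mu]_x (g x * phi x).

(* P holds of the real and imaginary parts of the components of psi. *)
Definition real_components (P : (R -> R) -> Prop)
    (psi : R -> 'cV[C]_4) : Prop :=
  forall j, P (fun x => Re (psi x j 0)) /\ P (fun x => Im (psi x j 0)).

Definition L2 (psi : R -> 'cV[C]_4) : Prop :=
  real_components (fun f => f \in Lfun mu 2%:E) psi.

Definition weak_derivative4 (psi chi : R -> 'cV[C]_4) : Prop :=
  forall j,
    weak_derivative (fun x => Re (psi x j 0)) (fun x => Re (chi x j 0)) /\
    weak_derivative (fun x => Im (psi x j 0)) (fun x => Im (chi x j 0)).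

Definition H2 (psi psi1 psi2 : R -> 'cV[C]_4) : Prop :=
  [/\ L2 psi, L2 psi1, L2 psi2,
      weak_derivative4 psi psi1 & weak_derivative4 psi1 psi2].

Definition is_eigenvalue (l : C) : Prop :=
  exists psi psi1 psi2 : R -> 'cV[C]_4,
    [/\ H2 psi psi1 psi2,
        ~ {ae mu, forall x, psi x = 0} &
        {ae mu, forall x, linearized_op psi psi2 x = l *: psi x}].

(* Since Sigma3 squares to the identity, the eigenvalue equation reads
   psi'' = (potential - i l Sigma3) psi. *)
Definition system_matrix (l : C) (x : R) : 'M[C]_8 :=
  block_mx 0 1%:M (potential x - ('i%C * l) *: Sigma3) 0 : 'M[C]_(4 + 4).

Definition solves_system (l : C) (Y : R -> 'cV[C]_8) : Prop :=
  forall x i, let dY := (system_matrix l x *m Y x) i 0 in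
    is_derive x 1 (fun t => Re (Y t i 0)) (Re dY) /\
    is_derive x 1 (fun t => Im (Y t i 0)) (Im dY).

End LinearizedOperator.

Section Evans.
Context {R : realType}.
Local Notation C := R[i].
Variables (F : R -> R -> R -> R) (omega s m : R) (U V : R -> R).

Definition cexp (z : C) : C :=
  (expR (Re z))%:C * (cos (Im z) +i* sin (Im z)).

(* n is the square root of z with argument in (a, b). *)
Definition sqrt_arg (a b : R) (z n : C) : Prop :=
  n ^+ 2 = z /\
  exists r t : R, [/\ 0 < r, a < t < b & n = r%:C * (cos t +i* sin t)].

Definition Jost_exponents (Omega : set C) (nu : 'I_4 -> C -> C) : Prop :=
  forall l, Omega l ->
  [/\ sqrt_arg (- (3 * pi / 4)) (pi / 4) (omega%:C - 'i%C * l) (nu 0 l),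
      sqrt_arg (- (pi / 4)) (3 * pi / 4) (omega%:C + 'i%C * l) (nu 1 l),
      sqrt_arg (- (3 * pi / 4)) (pi / 4) (s%:C - 'i%C * l) (nu 2 l) &
      sqrt_arg (- (pi / 4)) (3 * pi / 4) (s%:C + 'i%C * l) (nu 3 l)].

Definition cvec (j : 'I_4) (c : C) : 'cV[C]_8 :=
  col_mx (delta_mx j 0) (c *: delta_mx j 0) : 'cV[C]_(4 + 4).

Definition analytic_on (Omega : set C) (f : C -> C) : Prop :=
  forall l, Omega l -> derivable (f : C^o -> C^o) l 1.

(* [Ym j] is Y_{j+1}^- and [Yp j] is Y_{j+5}^+. *)
Definition Jost_solutions (Omega : set C) (nu : 'I_4 -> C -> C)
    (Ym Yp : 'I_4 -> C -> R -> 'cV[C]_8) : Prop :=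
  forall j,
  [/\ forall l, Omega l -> solves_system F omega s m U V l (Ym j l) /\
                           solves_system F omega s m U V l (Yp j l),
      forall l i, Omega l ->
        cexp (- nu j l * x%:C) * Ym j l x i 0
          @[x --> -oo] --> (cvec j (nu j l) i 0 : C^o),
      forall l i, Omega l ->
        cexp (nu j l * x%:C) * Yp j l x i 0
          @[x --> +oo] --> (cvec j (- nu j l) i 0 : C^o) &
      forall x i, analytic_on Omega (fun l => Ym j l x i 0) /\
                  analytic_on Omega (fun l => Yp j l x i 0)].

(* Evaluated at x = 0: the determinant does not depend on x because
   [system_matrix] has zero trace. *)
Definition Evans (Ym Yp : 'I_4 -> C -> R -> 'cV[C]_8) (l : C) : C :=
  \det (row_mx (\matrix_(i, j) Ym j l 0 i 0) (\matrix_(i, j) Yp j l 0 i 0)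
        : 'M[C]_(4 + 4)).

Definition simple_zero (f : C -> C) (l : C) : Prop :=
  [/\ f l = 0, derivable (f : C^o -> C^o) l 1 &
      derive1 (f : C^o -> C^o) l <> 0].

Definition gap_segment : set C :=
  [set l | Re l = 0 /\ `|Im l| < Num.min omega s].

End Evans.

(* Main.v *)
(* For l = i t the eigenvalue equation reads psi'' = Q psi with Q real and
   symmetric, and, for |t| < min(omega, s), uniformly positive definite outside a
   compact set.  There |psi|^2 is convex, so solutions bounded at +oo (or -oo)
   form a 4-dimensional space, depending continuously on Q for the uniform norm,
   and they are square integrable together with two derivatives.  The determinant
   D(t, e) of bases of both spaces is therefore real, continuous, and its zeros
   give eigenvalues.  At e = 0 the Evans function is D(t, 0) times a nonvanishing
   continuous factor, so a simple zero is a sign change of D(., 0).  This sign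
   change survives for small e because the bifurcated wave converges uniformly to
   the fundamental one: the term U2 is bounded, since it differs by a bounded
   function from a multiple of U_e - U_0 for one fixed e.  The intermediate value
   theorem concludes. *)
Require Import Defs.
From HB Require Import structures.
From mathcomp Require Import all_boot all_order all_algebra perm.
From mathcomp Require Import all_classical all_reals all_analysis.
From mathcomp Require Import complex ring lra measurable_realfun.

Set Implicit Arguments.
Unset Strict Implicit.
Unset Printing Implicit Defensive.

Import Order.TTheory GRing.Theory Num.Theory.
Import numFieldNormedType.Exports.

Local Open Scope ring_scope.
Local Open Scope complex_scope.
Local Open Scope classical_set_scope.

(** * Linear differential equations *)

(** An Evans function is given only along the fundamental wave, so the bifurcated waves need a
    substitute defined from their coefficients alone: the matching determinant. Its delicate point
    is continuity, since boundedness at infinity is not a condition on a bounded interval. The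
    decaying space is therefore approximated by Dirichlet problems on [[0, 4 ^ k]]. On a bounded
    interval the flow depends continuously on the coefficients, and convexity alone makes the
    truncation error O(2^-k) uniformly in them; no exponential dichotomy enters. Convexity starts
    only outside the core [[- X, X]], so each frame is normalised at [X] or [- X] and carried to 0
    by the flow.

    Jost solutions at an imaginary spectral parameter need not be real, since a column may contain
    complex multiples of faster decaying ones. They are compared with the real frames through their
    real and imaginary parts, and the resulting factor is a complex number; the reality of the
    determinant is what turns a simple zero into a sign change. *)

Section Calculus.
Context {R : realType}.
Implicit Types f g df p : R -> R.
Local Notation mu := (@lebesgue_measure R).

Lemma is_derive_continuous f df : (forall x : R, is_derive x 1 f (df x)) ->
  continuous f.
Proof.
move=> h x; have [d _] := h x.
by apply: differentiable_continuous; exact/derivable1_diffP.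
Qed.

Lemma is_derive_within f df (A : set R) : (forall x : R, is_derive x 1 f (df x)) ->
  {within A, continuous f}.
Proof. by move=> h; apply: continuous_subspaceT; exact: is_derive_continuous h. Qed.

Lemma is_derive_mvt f df a b : (forall x : R, is_derive x 1 f (df x)) -> a <= b ->
  exists2 c, a <= c <= b & f b - f a = df c * (b - a).
Proof.
move=> h ab; have [|c] := @MVT_segment R f df a b ab (fun x _ => h x).
  exact: is_derive_within h.
by rewrite in_itv /= => cab e; exists c.
Qed.

Lemma ge0_is_derive_le f df a b : (forall x : R, is_derive x 1 f (df x)) ->
  a <= b -> (forall x, a <= x <= b -> 0 <= df x) -> f a <= f b.
Proof.
move=> h ab d0; have [c cab e] := is_derive_mvt h ab.
by rewrite -subr_ge0 e mulr_ge0 ?subr_ge0 ?d0.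
Qed.

Lemma is_derive_opp_arg f df (x : R) : is_derive (- x) 1 f (df (- x)) ->
  is_derive x 1 (fun t => f (- t)) (- df (- x)).
Proof.
move=> h; have hN : is_derive x (1 : R) (fun t : R => - t) (- 1).
  exact: is_deriveNid.
have := @is_derive1_comp R f (fun t => - t) x (df (- x)) (- 1) h hN.
by rewrite mulrN1.
Qed.

Lemma is_derive_shift_arg f df (a x : R) : is_derive (a + x) 1 f (df (a + x)) ->
  is_derive x 1 (fun t => f (a + t)) (df (a + x)).
Proof.
move=> h; have hN : is_derive x (1 : R) (fun t : R => a + t) 1.
  by rewrite -[X in is_derive _ _ _ X]add0r; apply: is_deriveD.
have := @is_derive1_comp R f (fun t => a + t) x (df (a + x)) 1 h hN.
by rewrite mulr1.
Qed.

Lemma continuous_primitive f : continuous f ->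
  exists2 P : R -> R, P 0 = 0 & forall x : R, is_derive x 1 P (f x).
Proof.
move=> cf.
have fi (a b : R) : mu.-integrable `[a, b] (EFin \o f).
  apply: continuous_compact_integrable; first exact: segment_compact.
  exact: continuous_subspaceT.
pose G a x := \int[mu]_(t in `[a, x]) f t.
(* The lower end of integration must lie to the left of both 0 and [x], so it moves with [x]. [PE]
   shows that the value does not depend on it, hence that [P] agrees near each point with a
   primitive of fixed lower end. *)
pose P x := G (- (`|x| + 1)) x - G (- (`|x| + 1)) 0.
have split_int (a b x : R) : a <= b -> b <= x ->
    G a x - G a b = \int[mu]_(t in `]b, x]) f t.
  by move=> ab bx; apply: Rintegral_itvB => //; rewrite bnd_simp.
have obnd (b x : R) : \int[mu]_(t in `]b, x]) f t = G b x.
  rewrite Rintegral_itv_obnd_cbnd //; apply: integrableS (fi b x) => //.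
  exact: subset_itv_oc_cc.
have base (a b x : R) : a <= b -> b <= x -> b <= 0 ->
    G a x - G a 0 = G b x - G b 0.
  move=> ab bx b0; have := split_int _ _ _ ab bx; have := split_int _ _ _ ab b0.
  by rewrite !obnd; lra.
have PE a x : a <= x -> a <= 0 -> P x = G a x - G a 0.
  move=> ax a0; rewrite /P.
  have nx : - (`|x| + 1) <= x by have := ler_norm (- x); rewrite normrN; lra.
  have n0 : - (`|x| + 1) <= 0 by have := normr_ge0 x; lra.
  by case: (leP a (- (`|x| + 1))) => [h|/ltW h]; [symmetry|]; apply: base.
exists P => [|x]; first by rewrite /P subrr.
pose a := - (`|x| + 1).
have ax : a < x by have := ler_norm (- x); rewrite normrN /a; lra.
have a0 : a <= 0 by have := normr_ge0 x; rewrite /a; lra.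
have [dG dGE] : derivable (G a) x 1 /\ (G a)^`() x = f x.
  by apply: (@continuous_FTC1_closed R f a x (x + 1)); rewrite ?ltrDl //; exact: cf.
have iG : is_derive x 1 (G a) (f x).
  by rewrite -dGE derive1E; exact: derivableP.
have iGc : is_derive x 1 (fun y => G a y - G a 0) (f x).
  by rewrite -[X in is_derive _ _ _ X]subr0; apply: is_deriveB.
apply: near_eq_is_derive iGc.
near=> y; rewrite (PE a) //; apply: ltW; near: y.
exact: lt_nbhsr.
Unshelve. all: by end_near. Qed.

End Calculus.

Section LinearODE.
Context {R : realType}.

Lemma cvgr_sum (T I : Type) (F : set_system T) {FF : Filter F} (s : seq I)
    (f : I -> T -> R) (l : I -> R) : (forall i, f i x @[x --> F] --> l i) ->
  \sum_(i <- s) f i x @[x --> F] --> \sum_(i <- s) l i.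
Proof.
move=> H; elim: s => [|i s IH].
  by under eq_fun do rewrite big_nil; rewrite big_nil; exact: cvg_cst.
by under eq_fun do rewrite big_cons; rewrite big_cons; exact: cvgD.
Qed.

Lemma cvgr_prod (T I : Type) (F : set_system T) {FF : Filter F} (s : seq I)
    (f : I -> T -> R) (l : I -> R) : (forall i, f i x @[x --> F] --> l i) ->
  \prod_(i <- s) f i x @[x --> F] --> \prod_(i <- s) l i.
Proof.
move=> H; elim: s => [|i s IH].
  by under eq_fun do rewrite big_nil; rewrite big_nil; exact: cvg_cst.
by under eq_fun do rewrite big_cons; rewrite big_cons; exact: cvgM.
Qed.

Lemma is_derive_bigsum (I : Type) (s : seq I) (h : I -> R -> R) (x : R)
    (dh : I -> R) : (forall i, is_derive x 1 (h i) (dh i)) ->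
  is_derive x 1 (fun t => \sum_(i <- s) h i t) (\sum_(i <- s) dh i).
Proof.
move=> H; elim: s => [|i s IH].
  under eq_fun do rewrite big_nil; rewrite big_nil; exact: is_derive_cst.
by under eq_fun do rewrite big_cons; rewrite big_cons; exact: is_deriveD.
Qed.

(** With [e k] the sum of the remaining increments, [a k - e k] increases and [a k + e k] decreases,
    so the supremum of the former lies between both. The limit is returned in a sigma type in order
    to serve as a matrix entry through [sval]. *)
Lemma sup_geometric (a : nat -> R) (M : R) :
  (forall k, `|a k.+1 - a k| <= M / 2 ^+ k) ->
  {l : R | forall k, `|a k - l| <= 2 * M / 2 ^+ k}.
Proof.
move=> H; pose e k : R := 2 * M / 2 ^+ k.
have p2 k : (2 : R) ^+ k != 0 by rewrite expf_neq0 // pnatr_eq0.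
have eS k : e k.+1 = e k - M / 2 ^+ k by rewrite /e exprS; field; rewrite p2.
have e0 k : 0 <= e k.
  have := H k; have : (0 : R) <= 1 by []; rewrite /e.
  have := normr_ge0 (a k.+1 - a k); rewrite -mulrA; lra.
have up k n : (k <= n)%N -> a k - e k <= a n - e n.
  elim: n => [|n IH]; first by rewrite leqn0 => /eqP ->.
  rewrite leq_eqVlt => /predU1P[-> //|/IH/le_trans]; apply.
  have := H n; rewrite eS ler_norml => /andP[]; lra.
have dn k n : (k <= n)%N -> a n + e n <= a k + e k.
  elim: n => [|n IH]; first by rewrite leqn0 => /eqP ->.
  rewrite leq_eqVlt => /predU1P[-> //|/IH h]; apply: le_trans h.
  have := H n; rewrite eS ler_norml => /andP[]; lra.
pose S := [set a k - e k | k in [set: nat]].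
have ubS k : ubound S (a k + e k).
  move=> _ [n _ <-].
  have := up _ _ (leq_maxl n k); have := dn _ _ (leq_maxr n k).
  have := e0 (maxn n k); lra.
have nS : S !=set0 by exists (a 0%N - e 0%N); exists 0%N.
exists (sup S) => k.
have l1 : a k - e k <= sup S.
  by apply: ub_le_sup; [exists (a 0%N + e 0%N); exact: ubS|exists k].
have l2 : sup S <= a k + e k by exact: ge_sup.
by rewrite -/(e k) ler_norml; lra.
Qed.

Lemma eq0_le_geometric (x M : R) : (forall k, `|x| <= M / 2 ^+ k) -> x = 0.
Proof.
move=> H; apply/eqP; rewrite -normr_le0 leNgt; apply/negP => x0.
have c : (fun k : nat => M / 2 ^+ k : R) @ \oo --> (0 : R).
  rewrite -[X in _ --> X](mulr0 M); apply: cvgMr => /=.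
  have -> : (fun k : nat => (2 ^+ k)^-1 : R) = GRing.exp (2^-1 : R).
    by apply/funext => k; rewrite exprVn.
  by apply: cvg_expr; rewrite ger0_norm ?invr_ge0 // invf_lt1 // ltr1n.
have /cvgrPdist_lt /(_ _ x0) [n _ /(_ n (leqnn n)) /=] := c.
by rewrite sub0r normrN => /(le_lt_trans (ler_norm _)); rewrite ltNge H.
Qed.

Lemma ltr_dist3 (a b c d e : R) : `|a - b| < e / 3 -> `|b - c| < e / 3 ->
  `|c - d| < e / 3 -> `|a - d| < e.
Proof. by rewrite !ltr_norml; lra. Qed.

Lemma le_is_derive_exp (c M : R) (F f : R -> R) (x : R) : 0 < c -> 0 <= x ->
  F 0 = 0 -> (forall t : R, is_derive t 1 F (f t)) ->
  (forall t, 0 <= t <= x -> f t <= M * expR (c * t)) ->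
  F x <= M / c * (expR (c * x) - 1).
Proof.
move=> c0 x0 F0 dF fb.
have dE (t : R) : is_derive t 1 (fun t => M / c * expR (c * t) - F t)
    (M * expR (c * t) - f t).
  apply: is_deriveB.
  have -> : M * expR (c * t) = (M / c) *: (c * expR (c * t)).
    by rewrite /GRing.scale /=; field; rewrite gt_eqF.
  apply: is_deriveZ.
  have h : is_derive t (1 : R) (fun t : R => c * t) c.
    by rewrite -[X in is_derive _ _ _ X]mulr1; apply: is_deriveZ.
  by have := is_derive1_comp (is_derive_expR _) h; rewrite mulrC.
have := ge0_is_derive_le dE x0; rewrite F0 mulr0 expR0 => H.
have : M / c * 1 - 0 <= M / c * expR (c * x) - F x.
  by apply: H => t tx; rewrite subr_ge0 fb.
lra.
Qed.

(** In the norm weighted by [expR (c * |t|)] integration from 0 gains a factor [1 / c]. A large [c]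
    thus makes the Picard map a contraction on the whole line at once. *)
Lemma norm_le_is_derive_exp (c M : R) (F f : R -> R) (x : R) : 0 < c ->
  F 0 = 0 -> (forall t : R, is_derive t 1 F (f t)) ->
  (forall t, `|f t| <= M * expR (c * `|t|)) ->
  `|F x| <= M / c * expR (c * `|x|).
Proof.
move=> c0 F0 dF fb.
have M0 : 0 <= M by have := fb 0; rewrite normr0 mulr0 expR0 mulr1; exact: le_trans.
have half (G g : R -> R) (y : R) : 0 <= y -> G 0 = 0 ->
    (forall t : R, is_derive t 1 G (g t)) ->
    (forall t, `|g t| <= M * expR (c * `|t|)) ->
    `|G y| <= M / c * expR (c * y).
  move=> y0 G0 dG gb.
  have Mc : 0 <= M / c by rewrite divr_ge0 // ltW.
  have b1 := @le_is_derive_exp c M G g y c0 y0 G0 dG.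
  have b2 := @le_is_derive_exp c M (fun t => - G t) (fun t => - g t) y c0 y0.
  rewrite ler_norml; apply/andP; split.
    have : - G y <= M / c * (expR (c * y) - 1); last by lra.
    apply: b2; rewrite ?G0 ?oppr0 // => t /andP[t0 _].
    by have := gb t; rewrite (ger0_norm t0) ler_norml => /andP[]; lra.
  have : G y <= M / c * (expR (c * y) - 1); last by lra.
  apply: b1 => t /andP[t0 _].
  by have := gb t; rewrite (ger0_norm t0) ler_norml => /andP[]; lra.
case: (leP 0 x) => x0; first by rewrite (ger0_norm x0); exact: half dF fb.
rewrite (ltr0_norm x0) -[in F x](opprK x).
apply: (half (fun t => F (- t)) (fun t => - f (- t))).
- by rewrite oppr_ge0 ltW.
- by rewrite oppr0.
- by move=> t; exact: is_derive_opp_arg.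
- by move=> t; rewrite normrN -(normrN t).
Qed.

Definition solution N m (A : R -> 'M[R]_N) (Y : R -> 'M[R]_(N, m)) : Prop :=
  forall (x : R) i j, is_derive x 1 (fun t => Y t i j) ((A x *m Y x) i j).

Definition continuous_mx N m (A : R -> 'M[R]_(N, m)) : Prop :=
  forall i j, continuous (fun x => A x i j).

Lemma continuous_mx_mul N m p (A : R -> 'M[R]_(N, m)) (B : R -> 'M[R]_(m, p)) :
  continuous_mx A -> continuous_mx B -> continuous_mx (fun x => A x *m B x).
Proof.
move=> cA cB i j x; under eq_fun do rewrite mxE.
apply: (cvgr_sum _ (f := fun k x => A x i k * B x k j)
  (l := fun k => A x i k * B x k j)); by move=> k; apply: cvgM; [exact: cA|exact: cB].
Qed.

Arguments continuous_mx_mul {N m p A B} _ _ i j x _ _.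

Lemma norm_mulmx_le N m p (A : 'M[R]_(N, m)) (B : 'M[R]_(m, p)) K b i j :
  (forall i j, `|A i j| <= K) -> (forall i j, `|B i j| <= b) ->
  `|(A *m B) i j| <= m%:R * K * b.
Proof.
move=> HA HB; rewrite mxE; apply: le_trans (ler_norm_sum _ _ _) _.
apply: (@le_trans _ _ (\sum_(k < m) K * b)).
  by apply: ler_sum => k _; rewrite normrM ler_pM.
by rewrite sumr_const card_ord -mulrA mulr_natl.
Qed.

Lemma solution_continuous N m (A : R -> 'M[R]_N) (Y : R -> 'M[R]_(N, m)) :
  solution A Y -> continuous_mx Y.
Proof. by move=> h i j; apply: is_derive_continuous => x; exact: h. Qed.

Lemma mx_entry_bound N m (Y : 'M[R]_(N, m)) : exists b, forall i j, `|Y i j| <= b.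
Proof.
exists (\sum_i \sum_j `|Y i j|) => i j.
rewrite (bigD1 i) //= (bigD1 j) //= -addrA lerDl addr_ge0 //; apply: sumr_ge0 => // k _.
exact: sumr_ge0.
Qed.

(** Picard iteration in the weighted norm: as the coefficients are bounded on all of the line, one
    contraction yields the global solution, without gluing local ones. *)
Lemma solution_exists N m (A : R -> 'M[R]_N) (K : R) (Y0 : 'M[R]_(N, m)) :
  continuous_mx A -> (forall x i j, `|A x i j| <= K) ->
  exists2 Y, solution A Y & Y 0 = Y0.
Proof.
move=> cA bA.
(* [Pr] is a total operator whose value at a discontinuous function is arbitrary; this is why
   continuity of the iterates is carried along below. *)
have /choice[Pr PrP] : forall f : R -> R, exists P : R -> R, continuous f ->
    P 0 = 0 /\ forall x : R, is_derive x 1 P (f x).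
  move=> f; have [cf|ncf] := pselect (continuous f); last by exists f.
  by have [P P0 dP] := continuous_primitive cf; exists P.
pose step (Y : R -> 'M[R]_(N, m)) x :=
  \matrix_(i, j) (Y0 i j + Pr (fun t => (A t *m Y t) i j) x).
have [b Hb] := mx_entry_bound Y0.
have [b0 K0] : 0 <= Num.max b 0 /\ 0 <= Num.max K 0 by rewrite !le_max lexx !orbT.
(* The product with [A] costs a factor [N K] and integration gains [1 / c], so this [c] gives the
   contraction factor 1/2. *)
pose c := 2 * (N%:R * Num.max K 0 + 1).
have NK0 : 0 <= N%:R * Num.max K 0 by rewrite mulr_ge0.
have c0 : 0 < c by rewrite /c; lra.
have bA' x i j : `|A x i j| <= Num.max K 0 by rewrite le_max bA.
have cstep Y : continuous_mx Y -> forall i j (x : R),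
    is_derive x 1 (fun t => step Y t i j) ((A x *m Y x) i j).
  move=> cY i j x; under eq_fun do rewrite mxE.
  have [_ d] := PrP _ (continuous_mx_mul cA cY i j).
  by rewrite -[X in is_derive _ _ _ X]add0r; apply: is_deriveD.
have step_cont Y : continuous_mx Y -> continuous_mx (step Y).
  by move=> cY i j; exact: is_derive_continuous (cstep _ cY i j).
have step_bound (Y Z : R -> 'M[R]_(N, m)) M : continuous_mx Y -> continuous_mx Z ->
    (forall x i j, `|Y x i j - Z x i j| <= M * expR (c * `|x|)) ->
    forall x i j, `|step Y x i j - step Z x i j| <= M / 2 * expR (c * `|x|).
  move=> cY cZ H x i j.
  have M0 : 0 <= M.
    by have := H 0 i j; rewrite normr0 mulr0 expR0 mulr1; exact: le_trans.
  have dd (t : R) : is_derive t 1 (fun t => step Y t i j - step Z t i j)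
      ((A t *m Y t) i j - (A t *m Z t) i j).
    by apply: is_deriveB; exact: cstep.
  have := @norm_le_is_derive_exp c (N%:R * Num.max K 0 * M) _ _ x c0 _ dd.
  have s0 W : continuous_mx W -> step W 0 i j = Y0 i j.
    by move=> cW; rewrite mxE (PrP _ (continuous_mx_mul cA cW i j)).1 addr0.
  rewrite !s0 // subrr => /(_ erefl) h; apply: le_trans (h _) _; last first.
    rewrite ler_wpM2r ?expR_ge0 // ler_pdivrMr // /c.
    rewrite [leRHS](_ : _ = N%:R * Num.max K 0 * M + M); first by rewrite lerDl.
    by field.
  move=> t; rewrite -[leRHS]mulrA.
  have -> : (A t *m Y t) i j - (A t *m Z t) i j = (A t *m (Y t - Z t)) i j.
    by rewrite mulmxBr !mxE.
  by apply: norm_mulmx_le => // k l; rewrite !mxE; exact: H.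
pose Yk := fix Yk k := if k is k'.+1 then step (Yk k') else fun=> Y0.
have cYk k : continuous_mx (Yk k).
  by elim: k => [|k IH]; [move=> i j; exact: cst_continuous|exact: step_cont].
have dYk k x i j : `|Yk k.+1 x i j - Yk k x i j|
    <= Num.max b 0 * expR (c * `|x|) / 2 ^+ k.
  suff h : forall x i j, `|Yk k.+1 x i j - Yk k x i j|
      <= Num.max b 0 / 2 ^+ k * expR (c * `|x|) by rewrite mulrAC; exact: h.
  elim: k {x i j} => [|k IH] x i j; last first.
    by rewrite exprSr invfM mulrA; exact: (step_bound (Yk k.+1) (Yk k) _ (cYk _) (cYk _) IH).
  (* The constant iterate [Y0] is itself [step] of the zero function, so the first increment is also
     controlled by the contraction. *)
  have := @step_bound (fun=> Y0) (fun=> 0) (Num.max b 0) (cYk 0%N) _ _ x i j.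
  have -> : step (fun=> 0) x i j = Yk 0%N x i j.
    have cz : continuous_mx (fun=> 0 : 'M[R]_(N, m)).
      by move=> k l; exact: cst_continuous.
    rewrite mxE /=; have [P0 dP] := PrP _ (continuous_mx_mul cA cz i j).
    have Z : forall t : R, is_derive t 1 (Pr (fun t => (A t *m 0) i j)) ((0 : R -> R) t).
      by move=> t; have := dP t; rewrite mulmx0 mxE.
    have zb t : `|(0 : R -> R) t| <= 0 * expR (c * `|t|) by rewrite normr0 mul0r.
    have := @norm_le_is_derive_exp c 0 _ _ x c0 P0 Z zb.
    by rewrite !mul0r normr_le0 => /eqP ->; rewrite addr0.
  move=> h; apply: le_trans (h _ _) _.
  - by move=> k l; exact: cst_continuous.
  - move=> y k l; rewrite mxE subr0 (le_trans (Hb k l)) //.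
    apply: (@le_trans _ _ (Num.max b 0)); first by rewrite le_max lexx.
    by rewrite ler_peMr // -[leLHS]expR0 ler_expR mulr_ge0 // ltW.
  by rewrite expr0 divr1 ler_wpM2r ?expR_ge0 // ler_piMr // invf_le1 // ler1n.
pose Y x : 'M[R]_(N, m) := \matrix_(i, j) sval (sup_geometric (fun k => dYk k x i j)).
have YP k x i j : `|Yk k x i j - Y x i j|
    <= 2 * Num.max b 0 / 2 ^+ k * expR (c * `|x|).
  rewrite mxE; case: sup_geometric => l /= /(_ k); rewrite mulrA => h.
  by rewrite mulrAC.
have cY : continuous_mx Y.
  move=> i j x; apply/cvgrPdist_lt => e e0.
  pose M := 2 * Num.max b 0 * expR (c * (`|x| + 1)).
  have [k hk] : exists k : nat, M / 2 ^+ k < e / 3.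
    apply: contrapT => /forallNP H.
    suff e00 : e = 0 by rewrite e00 ltxx in e0.
    apply: (@eq0_le_geometric _ (3 * M)) => k; rewrite (gtr0_norm e0).
    by have /negP := H k; rewrite -leNgt; lra.
  have bk t : `|t| <= `|x| + 1 -> `|Yk k t i j - Y t i j| < e / 3.
    move=> tx; apply: le_lt_trans (YP k t i j) _; apply: le_lt_trans hk.
    rewrite [leRHS]mulrAC ler_wpM2l //; first by rewrite divr_ge0 // ?mulr_ge0.
    by rewrite ler_expR ler_wpM2l // ltW.
  have /cvgrPdist_lt /(_ (e / 3)) := cYk k i j x.
  rewrite divr_gt0 // => /(_ isT) nk.
  near=> t.
  have tx : `|x - t| < 1 by near: t; exact: cvgr_dist_lt.
  have b1' : `|Yk k x i j - Y x i j| < e / 3 by apply: bk; rewrite lerDl.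
  have b2 : `|Yk k t i j - Y t i j| < e / 3.
    by apply: bk; have := ler_distD 0 x t; have := ler_normD (t - x) x;
       rewrite subrK (distrC t); lra.
  have b3 : `|Yk k x i j - Yk k t i j| < e / 3 by near: t.
  move: b1' b2 b3; rewrite !ltr_norml; lra.
have YE : Y = step Y.
  apply/funext => x; apply/matrixP => i j; apply/eqP; rewrite -subr_eq0; apply/eqP.
  apply: (@eq0_le_geometric _ (3 * (Num.max b 0 * expR (c * `|x|)))) => k.
  have h1 := YP k.+1 x i j; have h2 := step_bound _ _ _ (cYk k) cY (YP k) x i j.
  have e1 : 2 * Num.max b 0 / 2 ^+ k.+1 * expR (c * `|x|) = Num.max b 0 * expR (c * `|x|) / 2 ^+ k.
    by rewrite exprS; field; rewrite expf_neq0 // pnatr_eq0.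
  have e2 : 2 * Num.max b 0 / 2 ^+ k / 2 * expR (c * `|x|) = Num.max b 0 * expR (c * `|x|) / 2 ^+ k.
    by field; rewrite expf_neq0 // pnatr_eq0.
  rewrite -mulrA; move: h1 h2; rewrite e1 e2 /= !ler_norml; lra.
exists Y; first by move=> x i j; rewrite [in X in is_derive _ _ X]YE; exact: cstep.
apply/matrixP => i j; rewrite YE mxE.
by rewrite (PrP _ (continuous_mx_mul cA cY i j)).1 addr0.
Unshelve. all: by end_near. Qed.

End LinearODE.

Section Fundamental.
Context {R : realType}.

Lemma is_derive_mulr (f g : R -> R) (df dg x : R) :
  is_derive x 1 f df -> is_derive x 1 g dg ->
  is_derive x 1 (fun t => f t * g t) (df * g x + f x * dg).
Proof.
move=> hf hg; have := @is_deriveM R R^o f g x 1 df dg hf hg.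
by rewrite addrC; congr is_derive; rewrite /GRing.scale /= (mulrC df).
Qed.

Lemma is_derive_sqr (f : R -> R) (df x : R) :
  is_derive x 1 f df -> is_derive x 1 (fun t => f t ^+ 2) (2 * (f x * df)).
Proof.
move=> hf; have := is_derive_mulr hf hf; under eq_fun do rewrite -expr2.
by congr is_derive; ring.
Qed.

Lemma is_derive_exp_lin (a x : R) :
  is_derive x 1 (fun t => expR (a * t)) (a * expR (a * x)).
Proof.
have h : is_derive x (1 : R) (fun t : R => a * t) a.
  by rewrite -[X in is_derive _ _ _ X]mulr1; apply: is_deriveZ.
by have := is_derive1_comp (is_derive_expR _) h; rewrite mulrC.
Qed.

(** The function [(e t + b) * expR (- a * t)] is nonincreasing. The assumption [1 <= a] gives
    [b <= a * b], which keeps a quotient by [a] out of the bound. *)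
Lemma gronwall (e de : R -> R) (a b T : R) : 1 <= a -> 0 <= b -> 0 <= T ->
  (forall t : R, is_derive t 1 e (de t)) -> e 0 = 0 ->
  (forall t, 0 <= t <= T -> de t <= a * e t + b) -> e T <= b * expR (a * T).
Proof.
move=> a1 b0 T0 he e0 H.
have hd (t : R) : is_derive t 1 (fun t => - ((e t + b) * expR (- a * t)))
    (- (de t * expR (- a * t) + (e t + b) * (- a * expR (- a * t)))).
  apply: is_deriveN; apply: is_derive_mulr; last exact: is_derive_exp_lin.
  by rewrite -[X in is_derive _ _ _ X]addr0; apply: is_deriveD.
have := ge0_is_derive_le hd T0; rewrite e0 add0r mulr0 expR0 mulr1 => h.
have {}h : - b <= - ((e T + b) * expR (- a * T)).
  apply: h => t tT; have Ht := H t tT.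
  have -> : - (de t * expR (- a * t) + (e t + b) * (- a * expR (- a * t))) =
    (a * e t + a * b - de t) * expR (- a * t) by ring.
  rewrite mulr_ge0 ?expR_ge0 // subr_ge0 (le_trans Ht) // lerD2l.
  by rewrite ler_peMl.
have E : expR (- a * T) * expR (a * T) = 1 by rewrite -expRD mulNr addNr expR0.
have E0 := expR_gt0 (a * T).
have : (e T + b) * (expR (- a * T) * expR (a * T)) <= b * expR (a * T).
  by rewrite mulrA ler_wpM2r ?(ltW E0) // -lerN2.
by rewrite E mulr1; lra.
Qed.

(** Gronwall for the sum of the squares of all entries. By [2 |x y| <= x ^ 2 + y ^ 2] the
    coefficients contribute [2 N K] to the growth rate and the forcing term contributes 1, leaving
    [N m rho ^ 2] as source. *)
Lemma solution_gronwall N m (A : R -> 'M[R]_N) (Z r : R -> 'M[R]_(N, m)) (K rho T : R) :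
  0 <= K -> 0 <= rho -> 0 <= T ->
  (forall t i j, `|A t i j| <= K) ->
  (forall t i j, 0 <= t <= T -> `|r t i j| <= rho) ->
  (forall (t : R) i j,
    is_derive t 1 (fun t => Z t i j) ((A t *m Z t + r t) i j)) -> Z 0 = 0 ->
  forall i j,
  Z T i j ^+ 2 <= N%:R * m%:R * rho ^+ 2 * expR ((2 * (N%:R * K) + 1) * T).
Proof.
move=> K0 rho0 T0 bA br dZ Z0 i j.
pose e t := \sum_i \sum_j Z t i j ^+ 2.
pose de t := \sum_i \sum_j 2 * (Z t i j * (A t *m Z t + r t) i j).
have he (t : R) : is_derive t 1 e (de t).
  by apply: is_derive_bigsum => k; apply: is_derive_bigsum => l; exact: is_derive_sqr.
have eb t : 0 <= t <= T ->
    de t <= (2 * (N%:R * K) + 1) * e t + N%:R * m%:R * rho ^+ 2.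
  move=> tT.
  pose bd k l := \sum_(p < N) K * (Z t k l ^+ 2 + Z t p l ^+ 2) + Z t k l ^+ 2 + rho ^+ 2.
  have : de t <= \sum_k \sum_l bd k l.
    apply: ler_sum => k _; apply: ler_sum => l _; rewrite /bd !mxE mulrDr mulrDr.
    rewrite -addrA; apply: lerD.
      rewrite !mulr_sumr; apply: ler_sum => p _.
      have h1 := bA t k p.
      have h2 : 2 * (`|Z t k l| * `|Z t p l|) <= Z t k l ^+ 2 + Z t p l ^+ 2.
        rewrite -(real_normK (num_real (Z t k l))) -(real_normK (num_real (Z t p l))).
        rewrite -subr_ge0.
        rewrite [leRHS](_ : _ = (`|Z t k l| - `|Z t p l|) ^+ 2) ?sqr_ge0 //; ring.
      apply: le_trans (ler_norm _) _; rewrite !normrM ger0_norm //.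
      rewrite [leLHS](_ : _ = `|A t k p| * (2 * (`|Z t k l| * `|Z t p l|))); last by ring.
      by apply: ler_pM => //; rewrite ?mulr_ge0.
    have h1 := br t k l tT.
    have h3 : `|r t k l| ^+ 2 <= rho ^+ 2 by rewrite ler_sqr ?nnegrE.
    rewrite real_normK ?num_real // in h3.
    have : 0 <= (Z t k l - r t k l) ^+ 2 by rewrite sqr_ge0.
    rewrite sqrrB; lra.
  move=> /le_trans; apply; rewrite le_eqVlt; apply/orP; left; apply/eqP.
  rewrite /bd; under eq_bigr => k _ do rewrite !big_split /=.
  rewrite !big_split /= -/(e t).
  have -> : \sum_(k < N) \sum_(l < m) rho ^+ 2 = N%:R * m%:R * rho ^+ 2.
    by rewrite !sumr_const !card_ord -mulr_natl -(mulr_natl (rho ^+ 2)) mulrA; ring.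
  congr (_ + _).
  suff -> : \sum_(k < N) \sum_(l < m) \sum_(p < N) K * (Z t k l ^+ 2 + Z t p l ^+ 2)
      = 2 * (N%:R * K) * e t by ring.
  have -> : 2 * (N%:R * K) * e t = K * (N%:R * e t) + K * (N%:R * e t) by ring.
  under eq_bigr => k _ do under eq_bigr => l _ do rewrite -mulr_sumr big_split /= mulrDr.
  under eq_bigr => k _ do rewrite big_split /=.
  rewrite big_split /=; congr (_ + _).
    rewrite /e mulr_sumr mulr_sumr; apply: eq_bigr => k _; rewrite mulr_sumr mulr_sumr.
    by apply: eq_bigr => l _; rewrite sumr_const card_ord mulr_natl.
  rewrite sumr_const card_ord -[LHS]mulr_natl.
  under eq_bigr => l _ do rewrite mulr_sumr.
  rewrite exchange_big /= /e mulrCA; congr (_ * _).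
  rewrite mulr_sumr; apply: eq_bigr => p _.
  by rewrite mulr_sumr.
have e0 : e 0 = 0 by rewrite /e; apply: big1 => k _; apply: big1 => l _;
  rewrite Z0 mxE expr0n.
have a1 : 1 <= 2 * (N%:R * K) + 1 by rewrite lerDr mulr_ge0 // mulr_ge0.
have b0 : 0 <= N%:R * m%:R * rho ^+ 2 by rewrite !mulr_ge0 // exprn_ge0.
apply: le_trans (gronwall a1 b0 T0 he e0 eb).
rewrite /e (bigD1 i) //= (bigD1 j) //= -addrA lerDl addr_ge0 //;
  apply: sumr_ge0 => k _; rewrite ?sqr_ge0 //.
by apply: sumr_ge0 => l _; rewrite sqr_ge0.
Qed.

Lemma solution_opp_arg N m (A : R -> 'M[R]_N) (Y : R -> 'M[R]_(N, m)) :
  solution A Y -> solution (fun x => - A (- x)) (fun x => Y (- x)).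
Proof.
move=> h x i j; rewrite mulNmx mxE.
exact: (is_derive_opp_arg (df := fun x => (A x *m Y x) i j) (h (- x) i j)).
Qed.

Lemma solution_shift_arg N m (A : R -> 'M[R]_N) (Y : R -> 'M[R]_(N, m)) a :
  solution A Y -> solution (fun x => A (a + x)) (fun x => Y (a + x)).
Proof.
move=> h x i j.
exact: (is_derive_shift_arg (df := fun x => (A x *m Y x) i j) (h (a + x) i j)).
Qed.

Lemma solution_mulmx N m p (A : R -> 'M[R]_N) (Y : R -> 'M[R]_(N, m)) (B : 'M[R]_(m, p)) :
  solution A Y -> solution A (fun x => Y x *m B).
Proof.
move=> h x i j; under eq_fun do rewrite mxE; rewrite mulmxA mxE.
apply: is_derive_bigsum => k.
by have := is_derive_mulr (h x i k) (is_derive_cst (B k j) x 1); rewrite mulr0 addr0.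
Qed.

Lemma solutionB N m (A : R -> 'M[R]_N) (Y Z : R -> 'M[R]_(N, m)) :
  solution A Y -> solution A Z -> solution A (fun x => Y x - Z x).
Proof.
move=> hY hZ x i j; under eq_fun do rewrite 2!mxE.
have -> : (A x *m (Y x - Z x)) i j = (A x *m Y x) i j - (A x *m Z x) i j.
  by rewrite mulmxBr !mxE.
by apply: is_deriveB; [exact: hY|exact: hZ].
Qed.

Definition bounded_mx N m (A : R -> 'M[R]_(N, m)) K := forall x i j, `|A x i j| <= K.

Lemma bounded_mx_ge0 N m (A : R -> 'M[R]_(N, m)) K :
  bounded_mx A K -> bounded_mx A (Num.max K 0).
Proof. by move=> h x i j; rewrite le_max h. Qed.

Lemma solution_eq0 N m (A : R -> 'M[R]_N) (Y : R -> 'M[R]_(N, m)) K :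
  bounded_mx A K -> solution A Y -> Y 0 = 0 -> forall x, Y x = 0.
Proof.
move=> /bounded_mx_ge0; set K' := Num.max K 0 => bA hY Y0.
have K0 : 0 <= K' by rewrite /K' le_max lexx orbT.
have half (B : R -> 'M[R]_N) (Z : R -> 'M[R]_(N, m)) x : bounded_mx B K' ->
    solution B Z -> Z 0 = 0 -> 0 <= x -> Z x = 0.
  move=> bB hZ Z0 x0; apply/matrixP => i j; rewrite [RHS]mxE.
  have dZ : forall (t : R) i j,
      is_derive t 1 (fun t => Z t i j) ((B t *m Z t + 0) i j).
    by move=> t k l; rewrite addr0.
  have := solution_gronwall (r := fun=> 0) K0 (lexx 0) x0 bB _ dZ Z0.
  move=> /(_ _ i j); rewrite expr0n mulr0 mul0r => h.
  apply/eqP; rewrite -sqrf_eq0 eq_le sqr_ge0 andbT; apply: h.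
  by move=> t k l _; rewrite mxE normr0.
move=> x; case: (leP 0 x) => x0; first exact: (half A).
rewrite -(opprK x); apply: (half (fun x => - A (- x)) (fun x => Y (- x))).
- by move=> y i j; rewrite mxE normrN.
- exact: solution_opp_arg.
- by rewrite oppr0.
- by rewrite oppr_ge0 ltW.
Qed.

Definition unif_cvg_mx T N m (F : set_system T) (A : T -> R -> 'M[R]_(N, m))
    (A0 : R -> 'M[R]_(N, m)) :=
  forall e : R, 0 < e ->
    \forall th \near F, forall x i j, `|A th x i j - A0 x i j| <= e.

(** The difference of the two solutions starts at 0 and is forced by the difference of the
    coefficients times the limit solution, which is bounded on the segment from 0 to [x]. Negative
    [x] is reached by reversing the line. *)
Lemma solution_cvg T (F : set_system T) {FF : Filter F} N m
    (A : T -> R -> 'M[R]_N) (A0 : R -> 'M[R]_N)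
    (Y : T -> R -> 'M[R]_(N, m)) (Y0 : R -> 'M[R]_(N, m)) K :
  (\forall th \near F, [/\ solution (A th) (Y th), bounded_mx (A th) K &
    Y th 0 = Y0 0]) ->
  solution A0 Y0 -> unif_cvg_mx F A A0 ->
  forall x i j, Y th x i j @[th --> F] --> Y0 x i j.
Proof.
have half (B : T -> R -> 'M[R]_N) (B0 : R -> 'M[R]_N)
    (Z : T -> R -> 'M[R]_(N, m)) (Z0 : R -> 'M[R]_(N, m)) :
    (\forall th \near F, [/\ solution (B th) (Z th), bounded_mx (B th) K &
      Z th 0 = Z0 0]) -> solution B0 Z0 -> unif_cvg_mx F B B0 ->
    forall x i j, 0 <= x -> Z th x i j @[th --> F] --> Z0 x i j.
  move=> H hZ0 uB x i j x0; apply/cvgrPdist_le => e e0.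
  have [M HM] : exists M, forall t k l, 0 <= t <= x -> `|Z0 t k l| <= M.
    pose f t := \sum_k \sum_l `|Z0 t k l|.
    have cf : continuous f.
      move=> t; apply: (cvgr_sum _ (f := fun k t => \sum_l `|Z0 t k l|)
        (l := fun k => \sum_l `|Z0 t k l|)) => k.
      apply: (cvgr_sum _ (f := fun l t => `|Z0 t k l|) (l := fun l => `|Z0 t k l|)) => l.
      by apply: cvg_norm; exact: (solution_continuous hZ0).
    have [|c _ Hc] := @EVT_max R f 0 x x0; first exact: continuous_subspaceT.
    exists (f c) => t k l tx; apply: le_trans (Hc t _); last by rewrite in_itv.
    rewrite /f (bigD1 k) //= (bigD1 l) //= -addrA lerDl addr_ge0 //;
      apply: sumr_ge0 => // p _.
    exact: sumr_ge0.
  pose K' := Num.max K 0; pose M' := Num.max M 0.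
  have K0 : 0 <= K' by rewrite /K' le_max lexx orbT.
  have M0 : 0 <= M' by rewrite /M' le_max lexx orbT.
  pose E := expR ((2 * (N%:R * K') + 1) * x).
  (* Chosen so that [N m E rho ^ 2 <= e ^ 2]: with [D] the denominator, [N m E <= D <= D ^ 2]. The
     added ones keep [D] at least 1 even for empty matrices. *)
  pose rho := e / ((N%:R + 1) * (m%:R + 1) * (E + 1)).
  have E0 : 0 < E := expR_gt0 _.
  have N1 : (0 : R) < N%:R + 1 by rewrite ltr_wpDl.
  have m1 : (0 : R) < m%:R + 1 by rewrite ltr_wpDl.
  have den0 : 0 < (N%:R + 1) * (m%:R + 1) * (E + 1).
    by rewrite !mulr_gt0 // addr_gt0.
  have rho0 : 0 < rho by rewrite divr_gt0.
  have del0 : 0 < rho / ((N%:R + 1) * (M' + 1)).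
    by rewrite divr_gt0 // mulr_gt0 // ltr_wpDl.
  have ubd := uB _ del0.
  near=> th.
  have [hZ bB ZE] : [/\ solution (B th) (Z th), bounded_mx (B th) K &
      Z th 0 = Z0 0] by near: th.
  have ub : forall x i j, `|B th x i j - B0 x i j| <= rho / ((N%:R + 1) * (M' + 1)).
    by near: th.
  have dZ : forall (t : R) i j, is_derive t 1 (fun t => (Z th t - Z0 t) i j)
      ((B th t *m (Z th t - Z0 t) + (B th t - B0 t) *m Z0 t) i j).
    move=> t k l; under eq_fun do rewrite 2!mxE.
    have -> : (B th t *m (Z th t - Z0 t) + (B th t - B0 t) *m Z0 t) k l =
        (B th t *m Z th t) k l - (B0 t *m Z0 t) k l.
      by rewrite mulmxBr mulmxBl addrA subrK !mxE.
    by apply: is_deriveB; [exact: hZ|exact: hZ0].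
  have := solution_gronwall K0 (ltW rho0) x0 (bounded_mx_ge0 bB) _ dZ.
  rewrite ZE subrr => /(_ _ erefl i j) h.
  have {}h : (Z th x - Z0 x) i j ^+ 2 <= N%:R * m%:R * rho ^+ 2 * E.
    apply: h => t k l tx.
    apply: le_trans (norm_mulmx_le (K := rho / ((N%:R + 1) * (M' + 1))) (b := M') _ _ _ _) _.
    - by move=> p q; rewrite 2!mxE ub.
    - by move=> p q; rewrite le_max HM.
    have {2}-> : rho = (N%:R + 1) * (rho / ((N%:R + 1) * (M' + 1))) * (M' + 1).
      by field; rewrite !gt_eqF // ltr_wpDl.
    have d0 := ltW del0.
    apply: ler_pM => //; first by rewrite mulr_ge0.
      by rewrite ler_wpM2r // lerDl.
    by rewrite lerDl.
  have e0' := ltW e0.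
  rewrite distrC -ler_sqr ?nnegrE // real_normK ?num_real //.
  move: h; rewrite 2!mxE => /le_trans; apply.
  have -> : e = rho * ((N%:R + 1) * (m%:R + 1) * (E + 1)) by rewrite divfK // gt_eqF.
  clearbody rho; rewrite exprMn [leRHS]mulrC.
  rewrite [leLHS](_ : _ = N%:R * m%:R * E * rho ^+ 2); last by ring.
  rewrite ler_wpM2r ?sqr_ge0 //.
  have [a0 c0] : (0 : R) <= N%:R /\ (0 : R) <= m%:R by [].
  have p1 := mulr_ge0 a0 c0; have p2 := mulr_ge0 p1 (ltW E0).
  have p3 := mulr_ge0 a0 (ltW E0); have p4 := mulr_ge0 c0 (ltW E0).
  set D := (N%:R + 1) * (m%:R + 1) * (E + 1).
  have D1 : 1 <= D by rewrite /D !(mulrDl, mulrDr, mul1r, mulr1); lra.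
  apply: (@le_trans _ _ D); first by rewrite /D !(mulrDl, mulrDr, mul1r, mulr1); lra.
  by rewrite expr2 ler_peMr // (le_trans _ D1).
move=> H h0 uA x i j; case: (leP 0 x) => x0; first exact: (half A A0).
rewrite -(opprK x).
apply: (half (fun th x => - A th (- x)) (fun x => - A0 (- x))
  (fun th x => Y th (- x)) (fun x => Y0 (- x))).
- apply: filterS H => th [h b Yt]; rewrite oppr0; split => //.
    exact: solution_opp_arg.
  by move=> y k l; rewrite mxE normrN.
- exact: solution_opp_arg.
- move=> e /uA; apply: filterS => th h y k l.
  by rewrite 2!mxE -opprD normrN.
- by rewrite oppr_ge0 ltW.
Unshelve. all: by end_near. Qed.

(** Chosen by [xget], so that it is a function of the coefficients alone and can be used without a
    proof of existence; the zero default occurs only if there is no such solution. *)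
Definition fundamental_mx N (A : R -> 'M[R]_N) : R -> 'M[R]_N :=
  xget (fun=> 0) [set Y | solution A Y /\ Y 0 = 1%:M].

Lemma fundamental_mxP N (A : R -> 'M[R]_N) K :
  continuous_mx A -> bounded_mx A K ->
  solution A (fundamental_mx A) /\ fundamental_mx A 0 = 1%:M.
Proof.
move=> cA bA; have [Y hY Y0] := solution_exists 1%:M cA bA.
by have := xgetPex (fun=> 0) (ex_intro [set Y | solution A Y /\ Y 0 = 1%:M] Y (conj hY Y0)).
Qed.

Lemma fundamental_cvg T (F : set_system T) {FF : Filter F} N
    (A : T -> R -> 'M[R]_N) (A0 : R -> 'M[R]_N) K :
  (\forall th \near F, continuous_mx (A th) /\ bounded_mx (A th) K) ->
  continuous_mx A0 -> bounded_mx A0 K -> unif_cvg_mx F A A0 ->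
  forall x i j, fundamental_mx (A th) x i j @[th --> F] --> fundamental_mx A0 x i j.
Proof.
move=> H c0 b0 u; have [h0 E0] := fundamental_mxP c0 b0.
apply: solution_cvg u => //.
apply: filterS H => th [c b]; have [h E] := fundamental_mxP c b.
by split => //; rewrite E E0.
Qed.

End Fundamental.

(** * Limits of products, determinants and inverses of matrices *)

Section MatrixLimits.
Context {R : realType} {T : Type} {F : set_system T} {FF : Filter F}.

Definition cvg_mx m n (A : T -> 'M[R]_(m, n)) (A0 : 'M[R]_(m, n)) :=
  forall i j, A th i j @[th --> F] --> A0 i j.

Lemma cvg_mx_near m n (A B : T -> 'M[R]_(m, n)) A0 :
  (\forall th \near F, A th = B th) -> cvg_mx A A0 -> cvg_mx B A0.
Proof.
move=> H c i j; apply: cvg_trans (c i j); apply: near_eq_cvg.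
by apply: filterS H => th /= ->.
Qed.

Lemma cvg_mx_mul m n p (A : T -> 'M[R]_(m, n)) (B : T -> 'M[R]_(n, p)) A0 B0 :
  cvg_mx A A0 -> cvg_mx B B0 -> cvg_mx (fun th => A th *m B th) (A0 *m B0).
Proof.
move=> cA cB i j; under eq_fun do rewrite mxE; rewrite mxE.
apply: (cvgr_sum _ (f := fun k th => A th i k * B th k j)
  (l := fun k => A0 i k * B0 k j)) => k.
by apply: cvgM; [exact: cA|exact: cB].
Qed.

Lemma cvg_det n (A : T -> 'M[R]_n) A0 : cvg_mx A A0 ->
  \det (A th) @[th --> F] --> \det A0.
Proof.
move=> cA; apply: (cvgr_sum _
  (f := fun (s : 'S_n) th => (-1) ^+ s * \prod_i A th i (s i))
  (l := fun s : 'S_n => (-1) ^+ s * \prod_i A0 i (s i))) => s.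
apply: cvgMr; apply: (cvgr_prod _ (f := fun i th => A th i (s i))
  (l := fun i => A0 i (s i))) => i.
exact: cA.
Qed.

Lemma cvg_invmx n (A : T -> 'M[R]_n) A0 : cvg_mx A A0 -> A0 \in unitmx ->
  (\forall th \near F, A th \in unitmx) ->
  cvg_mx (fun th => invmx (A th)) (invmx A0).
Proof.
move=> cA uA0 uA.
have adjE (B : 'M[R]_n) : B \in unitmx -> invmx B = (\det B)^-1 *: \adj B.
  by rewrite /invmx => ->.
rewrite (adjE _ uA0).
apply: (@cvg_mx_near _ _ (fun th => (\det (A th))^-1 *: \adj (A th))).
  by apply: filterS uA => th uA; rewrite adjE.
move=> i j; under eq_fun do rewrite !mxE; rewrite !mxE.
apply: cvgM.
  by apply: cvgV; [rewrite -unitfE -unitmxE|exact: cvg_det].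
rewrite /cofactor; apply: cvgMr; apply: cvg_det => k l.
under eq_fun do rewrite !mxE; rewrite !mxE; exact: cA.
Qed.

End MatrixLimits.

(** * Decaying solutions on a half line *)

Section Tails.
Context {R : realType} (n : nat).
Implicit Types (q : R -> 'M[R]_n).

(** First-order form of [u'' = q u]. Throughout, [usubmx] of a solution is [u] and [dsubmx] is its
    derivative. *)
Definition second_order q : R -> 'M[R]_(n + n) :=
  fun x => block_mx 0 1%:M (q x) 0.

Lemma second_order_bounded q K : bounded_mx q K ->
  bounded_mx (second_order q) (Num.max K 1).
Proof.
move=> bq x i j; rewrite /second_order.
have [m0 m1] : 0 <= Num.max K 1 /\ 1 <= Num.max K 1.
  by rewrite !le_max ler01 lexx !orbT.
case: (split_ordP i) => k ->; case: (split_ordP j) => l ->.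
- by rewrite block_mxEul mxE normr0.
- by rewrite block_mxEur mxE normr_nat; case: eqP.
- by rewrite block_mxEdl le_max bq.
- by rewrite block_mxEdr mxE normr0.
Qed.

Lemma second_order_continuous q : continuous_mx q -> continuous_mx (second_order q).
Proof.
move=> cq i j; rewrite /second_order.
case: (split_ordP i) => k ->; case: (split_ordP j) => l ->.
- by under eq_fun do rewrite block_mxEul; exact: cst_continuous.
- by under eq_fun do rewrite block_mxEur; exact: cst_continuous.
- by under eq_fun do rewrite block_mxEdl; exact: cq.
- by under eq_fun do rewrite block_mxEdr; exact: cst_continuous.
Qed.

Lemma second_order_cvg T (F : set_system T) {FF : Filter F}
    (q : T -> R -> 'M[R]_n) q0 : unif_cvg_mx F q q0 ->
  unif_cvg_mx F (fun th => second_order (q th)) (second_order q0).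
Proof.
move=> h e e0; apply: filterS (h e e0) => th H x i j; rewrite /second_order.
case: (split_ordP i) => k ->; case: (split_ordP j) => l ->.
- by rewrite !block_mxEul subrr normr0 ltW.
- by rewrite !block_mxEur subrr normr0 ltW.
- by rewrite !block_mxEdl.
- by rewrite !block_mxEdr subrr normr0 ltW.
Qed.

Lemma second_orderP m q (Y : R -> 'M[R]_(n + n, m)) : solution (second_order q) Y ->
  forall (x : R) i j,
  is_derive x 1 (fun t => usubmx (Y t) i j) (dsubmx (Y x) i j) /\
  is_derive x 1 (fun t => dsubmx (Y t) i j) ((q x *m usubmx (Y x)) i j).
Proof.
move=> h x i j.
have E : second_order q x *m Y x = col_mx (dsubmx (Y x)) (q x *m usubmx (Y x)).
  by rewrite -{1}(vsubmxK (Y x)) mul_block_col !mul0mx mul1mx add0r addr0.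
split.
- have := h x (lshift n i) j; rewrite E col_mxEu.
  by congr is_derive; apply/funext => t; rewrite mxE.
- have := h x (rshift n i) j; rewrite E col_mxEd.
  by congr is_derive; apply/funext => t; rewrite mxE.
Qed.

Definition pos_tail q := forall x, 0 <= x -> forall w : 'cV[R]_n,
  0 <= \sum_i w i 0 * (q x *m w) i 0.

(** The mean slopes over [[0, x]] and [[x, L]] are values of [p1] at two ordered points, and [p1] is
    nondecreasing there. The inequality is multiplied by [L] to avoid quotients. *)
Lemma convex_chord (p p1 p2 : R -> R) (x L : R) :
  (forall t : R, is_derive t 1 p (p1 t)) ->
  (forall t : R, is_derive t 1 p1 (p2 t)) ->
  (forall t, 0 <= t -> 0 <= p2 t) -> 0 <= x <= L ->
  L * p x <= (L - x) * p 0 + x * p L.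
Proof.
move=> h1 h2 H /andP[x0 xL].
have [c /andP[c0 cx] ec] := is_derive_mvt h1 x0.
have [d /andP[xd dL] ed] := is_derive_mvt h1 xL.
have cd : p1 c <= p1 d.
  apply: (ge0_is_derive_le h2); first exact: le_trans xd.
  by move=> t /andP[ct _]; apply: H; exact: le_trans ct.
have h : 0 <= x * (L - x) * (p1 d - p1 c) by rewrite !mulr_ge0 ?subr_ge0.
rewrite -subr_ge0; apply: le_trans h _; rewrite le_eqVlt; apply/orP; left; apply/eqP.
rewrite [LHS](_ : _ = x * (p1 d * (L - x)) - (L - x) * (p1 c * (x - 0))); last by ring.
by rewrite -ec -ed; ring.
Qed.

Definition sqr_col m (Y : 'M[R]_(n + n, m)) j := \sum_i usubmx Y i j ^+ 2.

Lemma sqr_col_ge m (Y : 'M[R]_(n + n, m)) i j : usubmx Y i j ^+ 2 <= sqr_col Y j.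
Proof.
by rewrite /sqr_col (bigD1 i) //= lerDl sumr_ge0 // => k _; rewrite sqr_ge0.
Qed.

Lemma sqr_col_derive m q (Y : R -> 'M[R]_(n + n, m)) j :
  solution (second_order q) Y -> 
  (forall x : R, is_derive x 1 (fun t => sqr_col (Y t) j)
    (\sum_i 2 * (usubmx (Y x) i j * dsubmx (Y x) i j))) /\
  (forall x : R, is_derive x 1
     (fun x => \sum_i 2 * (usubmx (Y x) i j * dsubmx (Y x) i j))
     (\sum_i 2 * (dsubmx (Y x) i j ^+ 2
                  + usubmx (Y x) i j * (q x *m usubmx (Y x)) i j))).
Proof.
move=> h; split=> x.
  apply: is_derive_bigsum => i.
  by have [d _] := second_orderP h x i j; exact: is_derive_sqr.
apply: is_derive_bigsum => i; have [d1 d2] := second_orderP h x i j.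
by rewrite expr2; apply: is_deriveZ; exact: is_derive_mulr.
Qed.

Lemma sqr_col_convex m q (Y : 'M[R]_(n + n, m)) x j : pos_tail q -> 0 <= x ->
  0 <= \sum_i 2 * (dsubmx Y i j ^+ 2 + usubmx Y i j * (q x *m usubmx Y) i j).
Proof.
move=> pq x0; rewrite -mulr_sumr big_split /= mulr_ge0 // addr_ge0 //.
  by apply: sumr_ge0 => i _; rewrite sqr_ge0.
have := pq x x0 (col j (usubmx Y)).
congr (_ <= _); apply: eq_bigr => i _; rewrite mxE; congr (_ * _).
by rewrite [LHS]mxE [RHS]mxE; apply: eq_bigr => k _; congr (_ * _); rewrite mxE.
Qed.

Lemma solution_chord m q (Y : R -> 'M[R]_(n + n, m)) x L j :
  pos_tail q -> solution (second_order q) Y -> 0 <= x <= L ->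
  L * sqr_col (Y x) j <= (L - x) * sqr_col (Y 0) j + x * sqr_col (Y L) j.
Proof.
move=> pq hY; have [h1 h2] := sqr_col_derive j hY.
apply: (convex_chord h1 h2) => t t0; exact: sqr_col_convex.
Qed.

(** It suffices that the derivative of [u] vanishes at 0 too. The information is one-sided, so the
    argument is by the mean value theorem: a nonzero derivative at 0 would stay nonzero on a short
    segment [[0, h]], whereas [u] takes equal values at its ends. *)
Lemma solution_eq0_segment m q (Y : R -> 'M[R]_(n + n, m)) K L :
  bounded_mx q K -> solution (second_order q) Y -> 0 < L ->
  (forall x, 0 <= x <= L -> usubmx (Y x) = 0) -> forall x, Y x = 0.
Proof.
move=> bq hY L0 H.
apply: (solution_eq0 (second_order_bounded bq) hY).
rewrite -(vsubmxK (Y 0)) H ?lexx ?ltW //.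
suff -> : dsubmx (Y 0) = 0 by rewrite col_mx0.
apply/matrixP => i j; rewrite [RHS]mxE; apply/eqP; rewrite -normr_le0 leNgt.
apply/negP => v0.
have hu (x : R) : is_derive x 1 (fun t => usubmx (Y t) i j) (dsubmx (Y x) i j).
  by have [] := second_orderP hY x i j.
have cv : continuous (fun t => dsubmx (Y t) i j).
  by apply: is_derive_continuous => x; have [_] := second_orderP hY x i j; apply.
have /cvgrPdist_lt /(_ _ v0) [d /= d0 Hd] := cv 0.
pose h := Num.min (d / 2) L.
have h0 : 0 < h by rewrite lt_min divr_gt0.
have [c /andP[c0 ch] ec] := is_derive_mvt hu (ltW h0).
move: ec; rewrite !H ?lexx ?(ltW L0) ?(ltW h0) ?ge_min ?lexx ?orbT //.
rewrite !mxE subrr subr0 => /esym/eqP; rewrite mulf_eq0 (gt_eqF h0) orbF => /eqP vc.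
have := Hd c; rewrite /= sub0r normrN (ger0_norm c0) !mxE in vc * => {}Hd.
suff : c < d by move=> /Hd; rewrite vc subr0 ltxx.
apply: le_lt_trans ch _; rewrite gt_min; apply/orP; left.
by rewrite ltr_pdivrMr // ltr_pMr // ltr1n.
Qed.

(** The matrix sine of [q], with [u = 0] and derivative 1 at the origin; [neumann_mx] is the matrix
    cosine, with [u = 1] and derivative 0. *)
Definition dirichlet_mx q x : 'M[R]_n := ursubmx (fundamental_mx (second_order q) x).
Definition neumann_mx q x : 'M[R]_n := ulsubmx (fundamental_mx (second_order q) x).

Definition admissible q K := [/\ continuous_mx q, bounded_mx q K & pos_tail q].

Lemma admissible_fundamental q K : admissible q K ->
  solution (second_order q) (fundamental_mx (second_order q)) /\
  fundamental_mx (second_order q) 0 = 1%:M.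
Proof.
move=> [c b _].
exact: fundamental_mxP (second_order_continuous c) (second_order_bounded b).
Qed.

(** The solutions with [u = 1] and derivative [- W] at 0. For a constant scalar [q] the decaying one
    has [W] equal to the square root of [q], hence the sign. *)
Definition frame q (W : 'M[R]_n) x : 'M[R]_(n + n, n) :=
  fundamental_mx (second_order q) x *m col_mx 1%:M (- W).

Lemma frame_solution q K W : admissible q K ->
  solution (second_order q) (frame q W).
Proof. by move=> /admissible_fundamental[h _]; exact: solution_mulmx. Qed.

Lemma frame0 q K W : admissible q K -> frame q W 0 = col_mx 1%:M (- W).
Proof. by move=> /admissible_fundamental[_ h]; rewrite /frame h mul1mx. Qed.

Lemma frameE q W x : usubmx (frame q W x) = neumann_mx q x - dirichlet_mx q x *m W.
Proof.
rewrite /frame -[fundamental_mx _ x]submxK mul_block_col.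
by rewrite col_mxKu mulmx1 mulmxN.
Qed.

Lemma sqr_col_1 j (W : 'M[R]_n) : sqr_col (col_mx 1%:M W) j = 1.
Proof.
rewrite /sqr_col col_mxKu (bigD1 j) //= big1 ?addr0; first by rewrite mxE eqxx expr1n.
by move=> i ij; rewrite mxE (negPf ij) expr0n.
Qed.

(** A kernel vector gives a solution that vanishes at 0 and at [L]. Its squared length is convex and
    nonnegative, so it vanishes in between, and with it the solution. *)
Lemma dirichlet_unit q K L : admissible q K -> 0 < L -> dirichlet_mx q L \in unitmx.
Proof.
move=> aq L0; have [hF F0] := admissible_fundamental aq.
have [cq bq pq] := aq.
rewrite unitmxE unitfE -det_tr; apply/det0P => -[v v0 vS].
pose Y x := fundamental_mx (second_order q) x *m col_mx 0 v^T.
have hY : solution (second_order q) Y by exact: solution_mulmx.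
have YE x : usubmx (Y x) = dirichlet_mx q x *m v^T.
  by rewrite /Y -[fundamental_mx _ x]submxK mul_block_col mulmx0 add0r col_mxKu.
have Y0 : Y 0 = col_mx 0 v^T by rewrite /Y F0 mul1mx.
have YL : usubmx (Y L) = 0.
  by rewrite YE; apply: trmx_inj; rewrite trmx_mul trmxK vS trmx0.
have s0 j : sqr_col (Y 0) j = 0.
  by rewrite /sqr_col Y0 col_mxKu big1 // => i _; rewrite mxE expr0n.
have sL j : sqr_col (Y L) j = 0.
  by rewrite /sqr_col YL big1 // => i _; rewrite mxE expr0n.
have Z : forall x, Y x = 0.
  apply: (solution_eq0_segment bq hY L0) => x xL; apply/matrixP => i j.
  rewrite [RHS]mxE; have := solution_chord j pq hY xL; rewrite s0 sL !mulr0 addr0.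
  rewrite pmulr_rle0 // => h; apply/eqP; rewrite -sqrf_eq0 eq_le sqr_ge0 andbT.
  exact: le_trans (sqr_col_ge _ _ _) h.
have := Z 0; rewrite Y0 => /eqP; rewrite col_mx_eq0 => /andP[_ /eqP vT].
by move: v0; rewrite -[v]trmxK vT trmx0 eqxx.
Qed.

(* The frame of this matrix vanishes at 4 ^ k.  These frames converge to the
   decaying one at a rate independent of q, which makes the limit continuous in
   parameters. *)
Definition truncated_mx q k : 'M[R]_n :=
  invmx (dirichlet_mx q (4 ^+ k)) *m neumann_mx q (4 ^+ k).

Lemma pow4_ge1 k : 1 <= 4 ^+ k :> R.
Proof. by rewrite exprn_ege1 // ler1n. Qed.

Lemma pow4_gt0 k : 0 < 4 ^+ k :> R. Proof. exact: exprn_gt0. Qed.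

Lemma truncated_vanish q K k : admissible q K ->
  usubmx (frame q (truncated_mx q k) (4 ^+ k)) = 0.
Proof.
move=> aq; rewrite frameE /truncated_mx mulmxA mulmxV ?mul1mx ?subrr //.
exact: dirichlet_unit aq (pow4_gt0 k).
Qed.

(** Each column has length 1 at 0 and vanishes at [4 ^ k]; convexity bounds it in between. *)
Lemma truncated_bound q K k x j : admissible q K -> 0 <= x <= 4 ^+ k ->
  sqr_col (frame q (truncated_mx q k) x) j <= 1.
Proof.
move=> aq xL; have [_ _ pq] := aq.
have := solution_chord j pq (frame_solution (truncated_mx q k) aq) xL.
have -> : sqr_col (frame q (truncated_mx q k) (4 ^+ k)) j = 0.
  by rewrite /sqr_col (truncated_vanish _ aq) big1 // => i _; rewrite mxE expr0n.
rewrite (frame0 _ aq) sqr_col_1 mulr1 mulr0 addr0 => h.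
rewrite -(ler_pM2l (pow4_gt0 k)) mulr1; apply: le_trans h _.
by rewrite gerBl; case/andP: xL.
Qed.

(* The difference of two frames vanishes at 0 and its first block is bounded at
   4 ^ k by that of the second one, so convexity makes it O(4 ^ - k) at 1. *)
Lemma truncated_close q K k W (B : R) : admissible q K ->
  (forall j, sqr_col (frame q W (4 ^+ k)) j <= B) -> forall i j,
  ((dirichlet_mx q 1 *m truncated_mx q k) i j - (dirichlet_mx q 1 *m W) i j) ^+ 2
    <= B / 4 ^+ k.
Proof.
move=> aq HB i j; have [_ _ pq] := aq.
pose D x := frame q W x - frame q (truncated_mx q k) x.
have hD : solution (second_order q) D by apply: solutionB; exact: frame_solution aq.
have x1 : 0 <= (1 : R) <= 4 ^+ k by rewrite ler01 pow4_ge1.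
have := solution_chord j pq hD x1.
have -> : sqr_col (D 0) j = 0.
  rewrite /sqr_col big1 // => l _.
  by rewrite /D !(frame0 _ aq) linearB /= !col_mxKu subrr mxE expr0n.
have -> : sqr_col (D (4 ^+ k)) j = sqr_col (frame q W (4 ^+ k)) j.
  by rewrite /sqr_col /D linearB /= (truncated_vanish _ aq) subr0.
rewrite mulr0 add0r mul1r => h.
rewrite ler_pdivlMr ?pow4_gt0 // mulrC; apply: le_trans (HB j); apply: le_trans h.
rewrite ler_pM2l ?pow4_gt0 //; apply: le_trans (sqr_col_ge _ i j).
rewrite /D linearB /= !frameE.
move: (dirichlet_mx q 1 *m truncated_mx q k) (dirichlet_mx q 1 *m W) => P Q.
by rewrite !mxE le_eqVlt; apply/orP; left; apply/eqP; ring.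
Qed.

(** The bound 1 is no restriction among bounded frames: the columns have length 1 at 0, and a
    bounded convex function on a half line is nonincreasing. *)
Definition stable_prop q W :=
  forall x, 0 <= x -> forall i j, `|usubmx (frame q W x) i j| <= 1.

Lemma sqr_le1 (a : R) : a ^+ 2 <= 1 -> `|a| <= 1.
Proof. by move=> h; rewrite -(ler_pXn2r (n := 2)) ?nnegrE // real_normK ?num_real // expr1n. Qed.

(** [truncated_close] controls the truncated matrices after multiplication by the sine at 1, so the
    limit is taken of these products and the invertible factor [S1] is removed afterwards. At a
    fixed [x] the limiting frame differs by O(2^-k) from a truncated one, which is bounded by 1 as
    soon as [4 ^ k] exceeds [x]. *)
Lemma stable_exists q K : admissible q K -> exists W, stable_prop q W.
Proof.
move=> aq; pose S1 := dirichlet_mx q 1.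
have uS1 : S1 \in unitmx := dirichlet_unit aq ltr01.
pose Z k := S1 *m truncated_mx q k.
(* Powers of 4 bound the squares, so the entries themselves move by at most [1 / 2 ^ k], the rate
   expected by [sup_geometric]. *)
have cau i j k : `|Z k.+1 i j - Z k i j| <= 1 / 2 ^+ k.
  have h := @truncated_close q K k (truncated_mx q k.+1) 1 aq _ i j.
  rewrite distrC -(ler_pXn2r (n := 2)) ?nnegrE ?divr_ge0 ?exprn_ge0 //.
  rewrite real_normK ?num_real // expr_div_n expr1n -exprM mulnC exprM.
  have -> : (2 : R) ^+ 2 = 4 by rewrite expr2; ring.
  apply: h => l; apply: (truncated_bound _ aq).
  by rewrite exprn_ge0 //= exprS ler_peMl ?exprn_ge0 // ler1n.
pose Z0 := \matrix_(i, j) sval (sup_geometric (cau i j)).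
have HZ0 k i j : `|Z k i j - Z0 i j| <= 2 / 2 ^+ k.
  by rewrite [Z0 i j]mxE; apply: le_trans (svalP (sup_geometric (cau i j)) k) _; rewrite mulr1.
exists (invmx S1 *m Z0) => x x0 i j.
pose W k := truncated_mx q k.
have [b Hb] := mx_entry_bound (dirichlet_mx q x *m invmx S1).
pose M := n%:R * Num.max b 0 * 2.
have close k : x <= 4 ^+ k -> `|usubmx (frame q (invmx S1 *m Z0) x) i j| <= 1 + M / 2 ^+ k.
  move=> xk.
  have h1 : `|usubmx (frame q (W k) x) i j| <= 1.
    apply: sqr_le1; apply: le_trans (sqr_col_ge _ _ _) _.
    by apply: (truncated_bound _ aq); rewrite x0.
  have h2 : usubmx (frame q (invmx S1 *m Z0) x) i j =
      usubmx (frame q (W k) x) i j + ((dirichlet_mx q x *m invmx S1) *m (Z k - Z0)) i j.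
    rewrite !frameE mulmxBr -!mulmxA /Z (mulmxA (invmx S1) S1) mulVmx // mul1mx.
    set P := dirichlet_mx q x *m (invmx S1 *m Z0).
    set Q := dirichlet_mx q x *m W k.
    by clearbody P Q; rewrite !mxE; ring.
  rewrite h2; apply: le_trans (ler_normD _ _) _; apply: lerD => //.
  rewrite /M -!mulrA mulrA; apply: norm_mulmx_le => [k' l|k' l].
    by rewrite le_max Hb.
  by rewrite !mxE; have := HZ0 k k' l; rewrite !mxE.
rewrite leNgt; apply/negP => h.
set y := `|_| in h close.
suff y1 : y - 1 = 0 by lra.
have [k0 Hk0] : exists k0 : nat, x <= 4 ^+ k0.
  have [k0 hk0] : exists k0 : nat, x <= k0%:R.
    by exists (Num.truncn x).+1; rewrite ltW // truncnS_gt.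
  exists k0; apply: le_trans hk0 _; rewrite -natrX ler_nat.
  by apply: ltnW; exact: ltn_expl.
apply: (@eq0_le_geometric _ _ M) => k.
rewrite ger0_norm ?subr_ge0 ?(ltW h) //.
have M0 : 0 <= M by rewrite !mulr_ge0 // le_max lexx orbT.
have hk : x <= 4 ^+ (k + k0).
  by rewrite exprD (le_trans Hk0) // ler_peMl ?exprn_ge0 // pow4_ge1.
have := close _ hk; rewrite -lerBlDl => /le_trans; apply.
rewrite ler_wpM2l // lef_pV2 ?posrE ?exprn_gt0 // exprD ler_peMr ?exprn_ge0 //.
by rewrite exprn_ege1 // ler1n.
Qed.

Definition stable_mx q : 'M[R]_n := xget 0 [set W | stable_prop q W].

Lemma stable_mxP q K : admissible q K -> stable_prop q (stable_mx q).
Proof. by move=> /stable_exists[W hW]; exact: (xgetPex 0 (ex_intro (stable_prop q) W hW)). Qed.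

(** The difference of [Y] and the frame with the same [u] at 0 vanishes in its first block at 0 and
    is bounded far out. The chord from 0 to a distant [L] then forces its squared length to be 0 at
    every [x >= 0]. *)
Lemma stable_unique q K m (Y : R -> 'M[R]_(n + n, m)) (B x0 : R) : admissible q K ->
  solution (second_order q) Y ->
  (forall x i j, x0 <= x -> `|usubmx (Y x) i j| <= B) ->
  forall x, Y x = frame q (stable_mx q) x *m usubmx (Y 0).
Proof.
move=> aq hY HB; have [_ bq pq] := aq; have hW := stable_mxP aq.
pose D x := Y x - frame q (stable_mx q) x *m usubmx (Y 0).
have hD : solution (second_order q) D.
  by apply: solutionB => //; apply: solution_mulmx; exact: frame_solution aq.
have [b Hb] := mx_entry_bound (usubmx (Y 0)).
pose C := n%:R * (B + n%:R * 1 * b) ^+ 2.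
have HC x j : x0 <= x -> 0 <= x -> sqr_col (D x) j <= C.
  move=> xx0 x_0; apply: (@le_trans _ _ (\sum_(i < n) (B + n%:R * 1 * b) ^+ 2)); last first.
    by rewrite sumr_const card_ord /C [leRHS]mulr_natl lexx.
  apply: ler_sum => i _.
  have h : `|usubmx (D x) i j| <= B + n%:R * 1 * b.
    rewrite /D linearB /= -mul_usub_mx mxE (le_trans (ler_normD _ _)) // lerD ?HB //.
    by rewrite mxE normrN; apply: norm_mulmx_le => // k l; exact: hW.
  rewrite -[X in X <= _](real_normK (num_real _)) ler_sqr ?nnegrE //.
  exact: le_trans h.
have D0 j : sqr_col (D 0) j = 0.
  rewrite /sqr_col big1 // => i _; rewrite /D linearB /= -mul_usub_mx (frame0 _ aq).
  by rewrite col_mxKu mul1mx subrr mxE expr0n.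
have Z : forall x, D x = 0.
  apply: (solution_eq0_segment bq hD ltr01) => x /andP[x_0 _].
  apply/matrixP => i j; rewrite [RHS]mxE; apply/eqP.
  rewrite -sqrf_eq0 eq_le sqr_ge0 andbT; apply: le_trans (sqr_col_ge _ _ j) _.
  rewrite leNgt; apply/negP => p0.
  set p := sqr_col _ _ in p0.
  (* The chord gives [L p <= x C], which fails as soon as [L] exceeds [x C / p]; the other two terms
     put [L] beyond [x] and inside the range where [Y] is bounded. *)
  pose L := Num.max (Num.max x x0) (x * C / p + 1).
  have xL : x <= L by rewrite !le_max lexx.
  have x0L : x0 <= L by rewrite !le_max lexx orbT.
  have cL : x * C / p + 1 <= L by rewrite !le_max lexx !orbT.
  have := solution_chord (x := x) (L := L) j pq hD; rewrite x_0 xL => /(_ isT).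
  rewrite D0 mulr0 add0r -/p => h.
  have : L * p <= x * C.
    by apply: le_trans h _; rewrite ler_wpM2l // HC // (le_trans x_0).
  rewrite -ler_pdivlMr //; lra.
by move=> x; have /eqP := Z x; rewrite subr_eq0 => /eqP.
Qed.

(** An exchange of limits. For fixed [k] the truncated matrix involves the flow only at [4 ^ k] and
    is continuous in the parameter; its distance to the stable matrix, measured through the sine at
    1, is O(2^-k) uniformly in the parameter. *)
Lemma stable_cvg T (F : set_system T) {FF : Filter F}
    (q : T -> R -> 'M[R]_n) q0 K :
  (\forall th \near F, admissible (q th) K) -> admissible q0 K ->
  unif_cvg_mx F q q0 ->
  forall x, cvg_mx (F := F) (fun th => frame (q th) (stable_mx (q th)) x)
    (frame q0 (stable_mx q0) x).
Proof.
move=> H a0 u.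
have cF x : cvg_mx (F := F) (fun th => fundamental_mx (second_order (q th)) x)
    (fundamental_mx (second_order q0) x).
  move=> i j; apply: (fundamental_cvg (K := Num.max K 1)).
  - apply: filterS H => th [c b _].
    by split; [exact: second_order_continuous|exact: second_order_bounded].
  - by apply: second_order_continuous; case: a0.
  - by apply: second_order_bounded; case: a0.
  - exact: second_order_cvg.
have cD x : cvg_mx (F := F) (fun th => dirichlet_mx (q th) x) (dirichlet_mx q0 x).
  by move=> i j; under eq_fun do rewrite !mxE; rewrite !mxE; exact: cF.
have cN x : cvg_mx (F := F) (fun th => neumann_mx (q th) x) (neumann_mx q0 x).
  by move=> i j; under eq_fun do rewrite !mxE; rewrite !mxE; exact: cF.
have uD L : 0 < L -> \forall th \near F, dirichlet_mx (q th) L \in unitmx.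
  by move=> L0; apply: filterS H => th a; exact: dirichlet_unit a L0.
have cZ k : cvg_mx (F := F) (fun th => dirichlet_mx (q th) 1 *m truncated_mx (q th) k)
    (dirichlet_mx q0 1 *m truncated_mx q0 k).
  apply: cvg_mx_mul => //; apply: cvg_mx_mul => //; apply: cvg_invmx => //.
    exact: dirichlet_unit a0 (pow4_gt0 k).
  exact: uD (pow4_gt0 k).
(* The entries of the stable frame are at most 1, so its columns have squared length at most [n],
   and [n <= (n + 1) ^ 2] gives a constant without a root. *)
have close qq k i j : admissible qq K ->
    `|(dirichlet_mx qq 1 *m truncated_mx qq k) i j -
      (dirichlet_mx qq 1 *m stable_mx qq) i j| <= (n%:R + 1) / 2 ^+ k.
  move=> aq; have n0 : (0 : R) <= n%:R by [].
  have h := @truncated_close qq K k (stable_mx qq) n%:R aq _ i j.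
  rewrite -(ler_pXn2r (n := 2)) ?nnegrE ?divr_ge0 ?exprn_ge0 ?addr_ge0 //.
  rewrite real_normK ?num_real // expr_div_n -exprM mulnC exprM.
  have -> : (2 : R) ^+ 2 = 4 by rewrite expr2; ring.
  apply: le_trans (h _) _; last first.
    rewrite ler_wpM2r ?invr_ge0 ?exprn_ge0 // sqrrD1; have := sqr_ge0 (n%:R : R); lra.
  move=> l; apply: (@le_trans _ _ (\sum_(p < n) 1)); last by rewrite sumr_const card_ord.
  apply: ler_sum => p _; rewrite -(real_normK (num_real _)) expr_le1 //.
  by apply: (stable_mxP aq); exact: exprn_ge0.
have cS : cvg_mx (F := F) (fun th => dirichlet_mx (q th) 1 *m stable_mx (q th))
    (dirichlet_mx q0 1 *m stable_mx q0).
  move=> i j; apply/cvgrPdist_lt => e e0.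
  have [k hk] : exists k : nat, (n%:R + 1) / 2 ^+ k < e / 3.
    apply: contrapT => /forallNP Hk; suff e00 : e = 0 by rewrite e00 ltxx in e0.
    apply: (@eq0_le_geometric _ _ (3 * (n%:R + 1))) => k; rewrite (gtr0_norm e0).
    by have /negP := Hk k; rewrite -leNgt; lra.
  have /cvgrPdist_lt /(_ (e / 3)) := cZ k i j.
  rewrite divr_gt0 // => /(_ isT); apply: filterS2 H => th aq.
  move=> hk3; apply: (ltr_dist3 _ hk3); last exact: le_lt_trans (close _ k i j aq) hk.
  by rewrite distrC; exact: le_lt_trans (close _ k i j a0) hk.
have cW : cvg_mx (F := F) (fun th => stable_mx (q th)) (stable_mx q0).
  have -> : stable_mx q0 = invmx (dirichlet_mx q0 1) *m (dirichlet_mx q0 1 *m stable_mx q0).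
    by rewrite mulmxA mulVmx ?mul1mx //; exact: dirichlet_unit a0 ltr01.
  apply: (cvg_mx_near (A := fun th => invmx (dirichlet_mx (q th) 1) *m
      (dirichlet_mx (q th) 1 *m stable_mx (q th)))).
    by apply: filterS (uD 1 ltr01) => th uq; rewrite mulmxA mulVmx ?mul1mx.
  apply: cvg_mx_mul => //; apply: cvg_invmx => //; last exact: uD ltr01.
  exact: dirichlet_unit a0 ltr01.
move=> x; apply: cvg_mx_mul => // i j.
case: (split_ordP i) => k ->.
  by under eq_fun do rewrite col_mxEu; rewrite col_mxEu; exact: cvg_cst.
by under eq_fun do rewrite col_mxEd mxE; rewrite col_mxEd mxE; apply: cvgN; exact: cW.
Qed.

End Tails.

(** * Eigenfunctions from matched decaying solutions *)

Section SquareIntegrable.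
Context {R : realType}.
Implicit Types f g p : R -> R.
Local Notation mu := (@lebesgue_measure R).

Lemma integral_half_line_lty g G (B : R) : continuous g -> (forall x, 0 <= g x) ->
  (forall x : R, is_derive x 1 G (g x)) -> (forall x, 0 <= x -> G x <= B) ->
  (\int[mu]_(x in `[0%R, +oo[) (g x)%:E < +oo)%E.
Proof.
move=> cg g0 dG GB.
have nG : nondecreasing_fun G.
  by move=> x y xy; exact: (ge0_is_derive_le dG).
have uG : has_ubound (range G).
  exists (Num.max B (G 0)) => _ [x _ <-]; rewrite le_max.
  by case: (leP 0 x) => [/GB -> //|/ltW/nG ->]; rewrite orbT.
have cG := nondecreasing_cvgr nG uG.
rewrite (@ge0_continuous_FTC2y R g G 0 _ _ _ cG).
- by rewrite -EFinB ltry.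
- by move=> x _; exact: g0.
- exact: continuous_subspaceT.
- by move=> x _; have [] := dG x.
- by apply: cvg_at_right_filter; exact: (is_derive_continuous dG).
- by move=> x _; rewrite derive1E; have [_] := dG x.
Qed.

Lemma Lfun2_primitive f G (B : R) : continuous f ->
  (forall x : R, is_derive x 1 G (f x ^+ 2)) -> (forall x, `|G x| <= B) ->
  f \in Lfun mu 2%:E.
Proof.
move=> cf dG GB.
have cf2 : continuous (fun x => f x ^+ 2).
  by move=> x; apply: (continuous_comp (f := f) (g := fun y => y ^+ 2)); [exact: cf|exact: exprn_continuous].
have mf : measurable_fun setT f by exact: continuous_measurable_fun.
have mf2 : measurable_fun setT (fun x => (f x ^+ 2)%:E).
  by apply/measurable_EFinP; exact: continuous_measurable_fun.
have fin : (\int[mu]_x (f x ^+ 2)%:E < +oo)%E.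
  have -> : [set: R] = `]-oo, 0%R] `|` `]0%R, +oo[.
    by rewrite -setCitvl setUCr.
  rewrite ge0_integral_setU //=; last 3 first.
  - exact: measurable_funTS.
  - by move=> x _; rewrite lee_fin sqr_ge0.
  - by rewrite -setCitvl; rewrite disj_set2E setICr.
  apply: lte_add_pinfty.
    rewrite -[0%R in X in (X < _)%E]oppr0 ge0_integration_by_substitutionNy.
    - apply: (@integral_half_line_lty _ (fun x => - G (- x)) B).
      + move=> x; apply: (continuous_comp (f := fun x => - x) (g := fun y => f y ^+ 2)).
          exact: opp_continuous.
        exact: cf2.
      + by move=> x; exact: sqr_ge0.
      + move=> x; have := is_deriveN (is_derive_opp_arg (df := fun x => f x ^+ 2) (dG (- x))).
        by rewrite opprK.
      + by move=> x _; have := GB (- x); rewrite ler_norml => /andP[]; lra.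
    - exact: continuous_subspaceT.
    - by move=> x _; exact: sqr_ge0.
  rewrite integral_itv_obnd_cbnd //; last exact: measurable_funTS.
  apply: (integral_half_line_lty cf2 _ dG) => [x|x _]; first exact: sqr_ge0.
  exact: le_trans (ler_norm _) (GB x).
rewrite inE; apply/andP; split; first by rewrite inE.
rewrite inE /= /finite_norm unlock /Lnorm; apply: poweR_lty.
apply: le_lt_trans fin; rewrite le_eqVlt; apply/orP; left; apply/eqP.
apply: eq_integral => x _ /=.
by rewrite powR_mulrn // real_normK ?num_real.
Qed.

(** On the tails [p] is convex and bounded, so its derivative is bounded above, and integrating
    [k f ^ 2 <= p2] bounds the integral of [f ^ 2]. The left tail is the right one of the reflected
    functions. *)
Lemma Lfun2_convex f p p1 p2 (k X B : R) : continuous f ->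
  (forall x : R, is_derive x 1 p (p1 x)) -> (forall x : R, is_derive x 1 p1 (p2 x)) ->
  0 < k -> 0 <= X -> (forall x, X <= `|x| -> k * f x ^+ 2 <= p2 x) ->
  (forall x, X <= `|x| -> 0 <= p x <= B) -> f \in Lfun mu 2%:E.
Proof.
move=> cf d1 d2 k0 X0 fp pB.
have cf2 : continuous (fun x => f x ^+ 2).
  by move=> x; apply: (continuous_comp (f := f) (g := fun y => y ^+ 2)); [exact: cf|exact: exprn_continuous].
have [G G0 dG] := continuous_primitive cf2.
have half (h q q1 q2 H : R -> R) : (forall x : R, is_derive x 1 q (q1 x)) ->
    (forall x : R, is_derive x 1 q1 (q2 x)) ->
    (forall x : R, is_derive x 1 H (h x)) ->
    (forall x, X <= x -> 0 <= k * h x <= q2 x) ->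
    (forall x, X <= x -> 0 <= q x <= B) ->
    exists M, forall x, X <= x -> H x <= M.
  move=> e1 e2 eH hq qB; exists ((k * H X + B - q1 X) / k) => x Xx.
  rewrite ler_pdivlMr // mulrC.
  (* The increment of [q] over [[x, x + 1]] is at most [B] and equals a later value of the
     nondecreasing [q1]. *)
  have q1B : q1 x <= B.
    have xx1 : x <= x + 1 by rewrite lerDl.
    have [c /andP[xc _]] := is_derive_mvt e1 xx1; rewrite addrAC subrr add0r mulr1.
    have /andP[_ qB1] := qB _ (le_trans Xx xx1); have /andP[q0 _] := qB _ Xx.
    have : q1 x <= q1 c; last by lra.
    apply: (ge0_is_derive_le e2 xc) => t /andP[xt _].
    by have /andP[/le_trans h0 /h0] := hq _ (le_trans Xx xt).
  have dE (t : R) : is_derive t 1 (fun t => q1 t - k * H t) (q2 t - k * h t).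
    by apply: is_deriveB; apply: is_deriveZ.
  have := ge0_is_derive_le dE Xx; move=> /(_ _) E.
  have : q1 X - k * H X <= q1 x - k * H x; last by lra.
  by apply: E => t /andP[Xt _]; rewrite subr_ge0; have /andP[] := hq _ Xt.
have [M1 HM1] : exists M, forall x, X <= x -> G x <= M.
  apply: (half (fun x => f x ^+ 2) p p1 p2) => // x Xx.
    by rewrite mulr_ge0 ?sqr_ge0 ?(ltW k0) // fp // ger0_norm // (le_trans X0).
  by apply: pB; rewrite ger0_norm // (le_trans X0).
have [M2 HM2] : exists M, forall x, X <= x -> - G (- x) <= M.
  apply: (half (fun x => f (- x) ^+ 2) (fun x => p (- x)) (fun x => - p1 (- x))
     (fun x => p2 (- x))) => [x|x|x|x Xx|x Xx].
  - exact: (is_derive_opp_arg (df := p1)).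
  - have := is_deriveN (is_derive_opp_arg (df := p2) (d2 (- x))).
    by rewrite opprK.
  - have := is_deriveN (is_derive_opp_arg (df := fun x => f x ^+ 2) (dG (- x))).
    by rewrite opprK.
  - by rewrite mulr_ge0 ?sqr_ge0 ?(ltW k0) // fp // normrN ger0_norm // (le_trans X0).
  - by apply: pB; rewrite normrN ger0_norm // (le_trans X0).
have nG x y : x <= y -> G x <= G y.
  by move=> xy; apply: (ge0_is_derive_le dG xy) => t _; exact: sqr_ge0.
apply: (Lfun2_primitive (B := Num.max M1 M2) cf dG) => x; rewrite ler_norml.
apply/andP; split.
  rewrite lerNl le_max; apply/orP; right.
  case: (leP x (- X)) => [xX|/ltW/nG h].
    by have := HM2 (- x); rewrite opprK; apply; rewrite lerNr.
  by apply: le_trans (HM2 X (lexx X)); rewrite lerN2.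
rewrite le_max; apply/orP; left.
case: (leP X x) => [/HM1//|/ltW/nG h].
exact: le_trans h (HM1 _ (lexx X)).
Qed.

End SquareIntegrable.

Section WeakDerivative.
Context {R : realType}.
Implicit Types f g phi : R -> R.
Local Notation mu := (@lebesgue_measure R).

Lemma Rintegral_support (h : R -> R) (M : R) :
  (forall x, M < `|x| -> h x = 0) ->
  \int[mu]_x h x = \int[mu]_(x in `[- M, M]) h x.
Proof.
move=> hM; rewrite [RHS]Rintegral_mkcond; apply: eq_Rintegral => x _.
rewrite patchE; case: ifPn => //; rewrite notin_setE /= in_itv /= => /negP nx.
by apply: hM; rewrite ltNge ler_norml.
Qed.

Lemma weak_derivativeW f g : (forall x : R, is_derive x 1 f (g x)) ->
  continuous g -> weak_derivative f g.
Proof.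
move=> df cg phi [dphi [M phiM]].
have d0 (x : R) : is_derive x 1 phi (derive1 phi x).
  by rewrite derive1E; apply: derivableP; exact: (dphi 0%N).
have c1 : continuous (derive1 phi).
  move=> x; apply: differentiable_continuous; apply/derivable1_diffP.
  exact: (dphi 1%N).
have c0 := is_derive_continuous d0.
have cf := is_derive_continuous df.
(* [N] must be positive and exceed [M], which may be negative; the boundary terms at [N] and [- N]
   then vanish. *)
pose N := `|M| + 1.
have MN x : N <= `|x| -> M < `|x|.
  by move=> h; have := ler_norm M; rewrite /N in h; lra.
have N0 : - N < N by have := normr_ge0 M; rewrite /N; lra.
have dphiM x : M < `|x| -> derive1 phi x = 0.
  move=> Mx; suff [_] : is_derive x (1 : R) phi 0 by rewrite derive1E.
  have hz : is_derive x (1 : R) (cst (0 : R)) (0 : R) by exact: is_derive_cst.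
  apply: near_eq_is_derive hz.
  have : \forall y \near x, M < `|y|.
    exact: (cvgr_gt _ (@norm_continuous R R x) _ Mx).
  by apply: filterS => y /phiM.
rewrite (@Rintegral_support _ N); last first.
  by move=> x /ltW/MN/dphiM ->; rewrite mulr0.
rewrite (@Rintegral_support (fun x => g x * phi x) N); last first.
  by move=> x /ltW/MN/phiM ->; rewrite mulr0.
have LR h (dh : R -> R) : (forall x : R, is_derive x 1 h (dh x)) ->
    derivable_oo_LRcontinuous h (- N) N.
  move=> dd; have ch := is_derive_continuous dd; split.
  - by move=> x _; have [] := dd x.
  - by apply: cvg_at_right_filter; exact: ch.
  - by apply: cvg_at_left_filter; exact: ch.
have [bN1 bN2] : phi N = 0 /\ phi (- N) = 0.
  by split; apply: phiM; apply: MN; rewrite ?normrN ler_norm.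
rewrite (Rintegration_by_parts N0 (f := g) (G := phi)).
- by rewrite bN1 bN2 !mulr0 subrr sub0r.
- exact: continuous_subspaceT.
- exact: LR df.
- by move=> x _; rewrite derive1E; have [_] := df x.
- exact: continuous_subspaceT.
- exact: LR d0.
- by [].
Qed.

End WeakDerivative.

Section Matching.
Context {R : realType} (n : nat).
Implicit Types (q : R -> 'M[R]_n).

Definition elliptic_tails q (X c : R) := forall x, X <= `|x| ->
  forall w : 'cV[R]_n, c * (\sum_i w i 0 ^+ 2) <= \sum_i w i 0 * (q x *m w) i 0.

(** The constants are arguments because continuity in a parameter needs them common to a whole
    family of coefficients. *)
Definition well_behaved q (X c K : R) :=
  [/\ continuous_mx q, bounded_mx q K & elliptic_tails q X c].

(** Moves the origin to [X], so that positivity holds on the whole half line; [left_half] also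
    reverses the line. *)
Definition right_half q (X : R) := fun x => q (X + x).
Definition left_half q (X : R) := fun x => q (- (X + x)).

(** The action of the reversal of the line on the pair of [u] and its derivative. *)
Definition flip m (Y : 'M[R]_(n + n, m)) := col_mx (usubmx Y) (- dsubmx Y).

Lemma flipK m : involutive (@flip m).
Proof. by move=> Y; rewrite /flip col_mxKu col_mxKd opprK vsubmxK. Qed.

Lemma usubmx_flip m (Y : 'M[R]_(n + n, m)) : usubmx (flip Y) = usubmx Y.
Proof. exact: col_mxKu. Qed.

Lemma flip_mulmx m p (Y : 'M[R]_(n + n, m)) (B : 'M[R]_(m, p)) :
  flip (Y *m B) = flip Y *m B.
Proof. by rewrite /flip mul_col_mx mulNmx mul_usub_mx mul_dsub_mx. Qed.

Lemma flip_solution m q (Y : R -> 'M[R]_(n + n, m)) : solution (second_order q) Y ->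
  solution (second_order (fun x => q (- x))) (fun x => flip (Y (- x))).
Proof.
move=> h x i j.
have E : second_order (fun x => q (- x)) x *m flip (Y (- x)) =
    col_mx (- dsubmx (Y (- x))) (q (- x) *m usubmx (Y (- x))).
  by rewrite mul_block_col !mul0mx mul1mx add0r addr0.
rewrite E; case: (split_ordP i) => k ->; rewrite /flip.
  under eq_fun do rewrite col_mxEu; rewrite col_mxEu mxE.
  have [d _] := second_orderP h (- x) k j.
  exact: (is_derive_opp_arg (df := fun x => dsubmx (Y x) k j)).
under eq_fun do rewrite col_mxEd mxE; rewrite col_mxEd.
have [_ d] := second_orderP h (- x) k j.
have := is_deriveN (is_derive_opp_arg (df := fun x => (q x *m usubmx (Y x)) k j) d).
by rewrite opprK.
Qed.

Lemma right_half_admissible q X c K : 0 <= X -> 0 <= c -> well_behaved q X c K ->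
  admissible (right_half q X) K.
Proof.
move=> X0 c0 [cq bq eq]; split.
- move=> i j x; apply: (continuous_comp (f := fun x => X + x) (g := fun y => q y i j)).
    by apply: cvgD; [exact: cvg_cst|exact: cvg_id].
  exact: cq.
- by move=> x i j; exact: bq.
- move=> x x0 w; apply: le_trans (eq (X + x) _ w).
    by rewrite mulr_ge0 // sumr_ge0 // => i _; rewrite sqr_ge0.
  by rewrite ger0_norm ?addr_ge0 // lerDl.
Qed.

Lemma well_behaved_opp q X c K : well_behaved q X c K ->
  well_behaved (fun x => q (- x)) X c K.
Proof.
move=> [cq bq eq]; split.
- move=> i j x; apply: (continuous_comp (f := fun x => - x) (g := fun y => q y i j)).
    exact: opp_continuous.
  exact: cq.
- by move=> x i j; exact: bq.
- by move=> x x0 w; apply: eq; rewrite normrN.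
Qed.

Lemma left_half_admissible q X c K : 0 <= X -> 0 <= c -> well_behaved q X c K ->
  admissible (left_half q X) K.
Proof. by move=> X0 c0 /well_behaved_opp; exact: right_half_admissible. Qed.

(** In the shifted variable [- X] is the original 0: the stable frame, normalised at [X], is carried
    back across the core, where [q] has no sign. *)
Definition right_frame q X : 'M[R]_(n + n, n) :=
  frame (right_half q X) (stable_mx (right_half q X)) (- X).
Definition left_frame q X : 'M[R]_(n + n, n) :=
  flip (frame (left_half q X) (stable_mx (left_half q X)) (- X)).

Lemma right_frameP q X c K m (Y : R -> 'M[R]_(n + n, m)) (B x0 : R) :
  0 <= X -> 0 <= c -> well_behaved q X c K -> solution (second_order q) Y ->
  (forall x i j, x0 <= x -> `|usubmx (Y x) i j| <= B) ->
  Y 0 = right_frame q X *m usubmx (Y X).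
Proof.
move=> X0 c0 wq hY HB; have aq := right_half_admissible X0 c0 wq.
have := stable_unique (Y := fun x => Y (X + x)) (B := B) (x0 := x0) aq
  (solution_shift_arg X hY).
move=> /(_ _ (- X)); rewrite subrr addr0; apply.
by move=> x i j xx; apply: HB; rewrite ler_wpDl.
Qed.

Definition matching_mx q X : 'M[R]_(n + n) := row_mx (left_frame q X) (right_frame q X).

Lemma matching_cvg T (F : set_system T) {FF : Filter F}
    (q : T -> R -> 'M[R]_n) q0 X c K : 0 <= X -> 0 <= c ->
  (\forall th \near F, well_behaved (q th) X c K) -> well_behaved q0 X c K ->
  unif_cvg_mx F q q0 ->
  \det (matching_mx (q th) X) @[th --> F] --> \det (matching_mx q0 X).
Proof.
move=> X0 c0 H w0 u; apply: cvg_det => i j.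
have cr := stable_cvg (F := F) (q := fun th => right_half (q th) X)
  (q0 := right_half q0 X) (K := K).
have cl := stable_cvg (F := F) (q := fun th => left_half (q th) X)
  (q0 := left_half q0 X) (K := K).
rewrite /matching_mx; case: (split_ordP j) => k ->.
  under eq_fun do rewrite row_mxEl; rewrite row_mxEl.
  rewrite /left_frame /flip.
  have {}cl : cvg_mx (F := F) (fun th => frame (left_half (q th) X)
      (stable_mx (left_half (q th) X)) (- X))
      (frame (left_half q0 X) (stable_mx (left_half q0 X)) (- X)).
    apply: cl.
    - by apply: filterS H => th; exact: left_half_admissible.
    - exact: left_half_admissible w0.
    - by move=> e e0; apply: filterS (u e e0) => th h x k' l; exact: h.
  case: (split_ordP i) => l ->.
    under eq_fun do rewrite col_mxEu mxE; rewrite col_mxEu mxE; exact: cl.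
  under eq_fun do rewrite col_mxEd 2!mxE; rewrite col_mxEd 2!mxE.
  by apply: cvgN; exact: cl.
under eq_fun do rewrite row_mxEr; rewrite row_mxEr.
apply: cr.
- by apply: filterS H => th; exact: right_half_admissible.
- exact: right_half_admissible w0.
- by move=> e e0; apply: filterS (u e e0) => th h x k' l; exact: h.
Qed.

(** A kernel vector combines the left and right decaying solutions so that they agree at 0, hence
    everywhere. The result is not zero, since its first blocks at [X] and [- X] are, up to sign, the
    two halves of that vector. *)
Lemma matching_kernel q X c K : 0 <= X -> 0 <= c -> well_behaved q X c K ->
  \det (matching_mx q X) = 0 ->
  exists Y : R -> 'cV[R]_(n + n), [/\ solution (second_order q) Y,
    exists x, usubmx (Y x) != 0 &
    exists B, forall x i, X <= `|x| -> `|usubmx (Y x) i 0| <= B].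
Proof.
move=> X0 c0 wq; have [cq bq _] := wq.
have aR := right_half_admissible X0 c0 wq; have aL := left_half_admissible X0 c0 wq.
rewrite -det_tr => /eqP/det0P[v v0 vM].
pose a : 'cV[R]_n := usubmx (v^T : 'cV_(n + n)).
pose b : 'cV[R]_n := dsubmx (v^T : 'cV_(n + n)).
have vE : v^T = col_mx a b by rewrite vsubmxK.
have {}vM : left_frame q X *m a + right_frame q X *m b = 0.
  by rewrite -mul_row_col -vE; apply: trmx_inj; rewrite trmx_mul trmxK vM trmx0.
pose Yr x := frame (right_half q X) (stable_mx (right_half q X)) (- X + x) *m b.
(* The sign in [- a] turns the vanishing of the sum of the two combinations into equality of [Yl]
   and [Yr] at 0. *)
pose Yl x := flip (frame (left_half q X) (stable_mx (left_half q X)) (- X + - x) *m - a).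
have hr : solution (second_order q) Yr.
  have := solution_shift_arg (- X) (frame_solution (stable_mx (right_half q X)) aR).
  move=> /(solution_mulmx b) h x i j.
  by have := h x i j; rewrite /second_order /right_half addrA subrr add0r.
have hl : solution (second_order q) Yl.
  have := solution_shift_arg (- X) (frame_solution (stable_mx (left_half q X)) aL).
  move=> /(solution_mulmx (- a))/flip_solution h x i j.
  have := h x i j; rewrite /second_order /left_half.
  by rewrite addrA subrr add0r opprK.
have lr0 : Yl 0 = Yr 0.
  rewrite /Yl /Yr oppr0 !addr0 flip_mulmx mulmxN; apply/eqP.
  by rewrite eq_sym -subr_eq0 opprK addrC; apply/eqP.
have lr x : Yl x = Yr x.
  apply/eqP; rewrite -subr_eq0; apply/eqP; move: x.
  apply: (solution_eq0 (second_order_bounded bq)); first exact: solutionB.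
  by rewrite lr0 subrr.
have frame_bound (A : 'M[R]_(n + n, n)) (w : 'cV[R]_n) i :
    (forall k l, `|usubmx A k l| <= 1) ->
    `|usubmx (A *m w) i 0| <= n%:R * 1 * \sum_k `|w k 0|.
  move=> HA; rewrite -mul_usub_mx; apply: norm_mulmx_le => // k l.
  by rewrite ord1 (bigD1 k) //= lerDl sumr_ge0.
exists Yr; split => //.
- apply: contrapT => /forallNP H.
  have {}H x : usubmx (Yr x) = 0 by apply/eqP/negPn/negP; exact: H.
  have b0 : b = 0.
    have := H X; rewrite /Yr addrC subrr -mul_usub_mx (frame0 _ aR) col_mxKu.
    by rewrite mul1mx.
  have a0 : a = 0.
    have := H (- X); rewrite -lr /Yl opprK addrC subrr usubmx_flip -mul_usub_mx.
    by rewrite (frame0 _ aL) col_mxKu mul1mx => /eqP; rewrite oppr_eq0 => /eqP.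
  by move: v0; rewrite -[v]trmxK vE a0 b0 col_mx0 trmx0 eqxx.
- exists (n%:R * 1 * \sum_k `|b k 0| + n%:R * 1 * \sum_k `|(- a) k 0|) => x i.
  have s0 (w : 'cV[R]_n) : 0 <= n%:R * 1 * \sum_k `|w k 0|.
    by rewrite mulr1 mulr_ge0 // sumr_ge0.
  case: (leP 0 x) => x0 Xx.
    apply: (@le_trans _ _ (n%:R * 1 * \sum_k `|b k 0|)); last by rewrite lerDl.
    apply: frame_bound => k l; apply: (stable_mxP aR).
    by rewrite addrC subr_ge0; rewrite ger0_norm in Xx.
  apply: (@le_trans _ _ (n%:R * 1 * \sum_k `|(- a) k 0|)); last by rewrite lerDr.
  rewrite -lr /Yl usubmx_flip; apply: frame_bound => k l; apply: (stable_mxP aL).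
  by rewrite addrC subr_ge0; rewrite ltr0_norm in Xx.
Qed.

(* Convexity of the squared length gives integrability: its second derivative
   dominates the squares of all components on the tails. *)
Lemma bounded_solution_Lfun q X c K (Y : R -> 'cV[R]_(n + n)) B :
  0 <= X -> 0 < c -> well_behaved q X c K -> solution (second_order q) Y ->
  (forall x i, X <= `|x| -> `|usubmx (Y x) i 0| <= B) -> forall i,
  [/\ (fun x => usubmx (Y x) i 0) \in Lfun (@lebesgue_measure R) 2%:E,
      (fun x => dsubmx (Y x) i 0) \in Lfun (@lebesgue_measure R) 2%:E &
      (fun x => (q x *m usubmx (Y x)) i 0) \in Lfun (@lebesgue_measure R) 2%:E].
Proof.
move=> X0 c0 wq hY HB i; have [cq bq eq] := wq.
have [h1 h2] := sqr_col_derive 0 hY.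
have cu : continuous_mx (fun x => usubmx (Y x)).
  by move=> k l; apply: is_derive_continuous => x; have [] := second_orderP hY x k l.
have cv : continuous_mx (fun x => dsubmx (Y x)).
  by move=> k l; apply: is_derive_continuous => x; have [_] := second_orderP hY x k l; apply.
pose U x := \sum_k usubmx (Y x) k 0 ^+ 2; pose V x := \sum_k dsubmx (Y x) k 0 ^+ 2.
have U0 x : 0 <= U x by apply: sumr_ge0 => k _; exact: sqr_ge0.
have V0 x : 0 <= V x by apply: sumr_ge0 => k _; exact: sqr_ge0.
have lower x : X <= `|x| -> 2 * V x + 2 * (c * U x) <=
    \sum_i 2 * (dsubmx (Y x) i 0 ^+ 2 + usubmx (Y x) i 0 * (q x *m usubmx (Y x)) i 0).
  move=> Xx; rewrite -mulr_sumr big_split /= mulrDr lerD2l ler_pM2l //.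
  exact: eq.
have pB x : X <= `|x| -> 0 <= sqr_col (Y x) 0 <= n%:R * B ^+ 2.
  move=> Xx; rewrite sumr_ge0 /=; last by move=> k _; rewrite sqr_ge0.
  rewrite /sqr_col; apply: (@le_trans _ _ (\sum_(k < n) B ^+ 2)); last first.
    by rewrite sumr_const card_ord [leRHS]mulr_natl lexx.
  apply: ler_sum => k _; have h := HB x k Xx.
  by rewrite -[X in X <= _](real_normK (num_real _)) ler_sqr ?nnegrE // (le_trans _ h).
have L (f : R -> R) k : continuous f -> 0 < k ->
    (forall x, k * f x ^+ 2 <= 2 * V x + 2 * (c * U x)) -> f \in Lfun (@lebesgue_measure R) 2%:E.
  move=> cf k0 fk; apply: (Lfun2_convex cf h1 h2 k0 X0 _ pB) => x Xx.
  exact: le_trans (fk x) (lower x Xx).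
have cU x : 0 <= c * U x by rewrite mulr_ge0 // ltW.
have comp (w : 'cV[R]_n) k : w k 0 ^+ 2 <= \sum_l w l 0 ^+ 2.
  by rewrite (bigD1 k) //= lerDl sumr_ge0 // => l _; rewrite sqr_ge0.
split.
- apply: (L _ c) => // x; have h1' := comp (usubmx (Y x)) i.
  have : c * usubmx (Y x) i 0 ^+ 2 <= c * U x by rewrite ler_pM2l.
  have := cU x; have := V0 x; lra.
- by apply: (L _ 1) => // x; have := comp (dsubmx (Y x)) i; have := cU x; have := V0 x; rewrite -/(V x); lra.
pose K' := Num.max K 0.
have K0 : 0 <= K' by rewrite le_max lexx orbT.
(* A component of [q u] has square at most [n ^ 2 K' ^ 2] times the squared length of [u]; the added
   1 makes [C] positive. *)
pose C := n%:R * (n%:R * K' ^+ 2) + 1.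
have nK : 0 <= n%:R * (n%:R * K' ^+ 2) by rewrite !mulr_ge0 ?sqr_ge0.
have C0 : 0 < C by rewrite /C; lra.
apply: (L _ (c / C)); first exact: continuous_mx_mul cq cu i 0.
  by rewrite divr_gt0.
move=> x; apply: (@le_trans _ _ (c * U x)); last by have := cU x; have := V0 x; lra.
rewrite -mulrA ler_pM2l // ler_pdivrMl //.
have ub k : `|usubmx (Y x) k 0| <= Num.sqrt (U x).
  by rewrite -sqrtr_sqr ler_sqrt.
have h : `|(q x *m usubmx (Y x)) i 0| <= n%:R * K' * Num.sqrt (U x).
  apply: norm_mulmx_le => k l; first by rewrite le_max bq.
  by rewrite ord1.
rewrite -(real_normK (num_real ((q x *m usubmx (Y x)) i 0))).
apply: (@le_trans _ _ ((n%:R * K' * Num.sqrt (U x)) ^+ 2)).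
  by rewrite ler_sqr ?nnegrE // ?mulr_ge0 // ?sqrtr_ge0.
rewrite exprMn sqr_sqrtr // ler_wpM2r // /C.
rewrite [leLHS](_ : _ = n%:R * (n%:R * K' ^+ 2)); last by ring.
by rewrite lerDl.
Qed.

End Matching.

(** * The real second-order system on the imaginary axis *)

Section RealSystem.
Context {R : realType}.
Local Notation C := R[i].
Local Notation mu := (@lebesgue_measure R).
Local Notation rc := (real_complex R).
Variables (F : R -> R -> R -> R) (omega s m : R) (U V : R -> R).

Definition real_sigma1 : 'M[R]_2 := block_mx 0 1%:M 1%:M 0 : 'M[R]_(1 + 1).
Definition real_sigma3 : 'M[R]_2 := block_mx 1%:M 0 0 (- 1%:M) : 'M[R]_(1 + 1).
Definition real_Sigma3 : 'M[R]_4 := block_mx real_sigma3 0 0 real_sigma3 : 'M[R]_(2 + 2).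

Definition real_B11 (x : R) : 'M[R]_2 :=
  (at_wave m U V (d1 (d1 F)) x * U x ^+ 2) *: (1%:M + real_sigma1)
  + at_wave m U V (d1 F) x *: 1%:M.
Definition real_B12 (x : R) : 'M[R]_2 :=
  (at_wave m U V (d1 (d2 F)) x * U x * V x) *: (1%:M + real_sigma1).
Definition real_B22 (x : R) : 'M[R]_2 :=
  (at_wave m U V (d2 (d2 F)) x * V x ^+ 2) *: (1%:M + real_sigma1)
  + at_wave m U V (d2 F) x *: 1%:M.

Definition real_coupling (x : R) : 'M[R]_4 :=
  block_mx (real_B11 x) (real_B12 x) (real_B12 x) (real_B22 x) : 'M[R]_(2 + 2).

Definition mass_mx (t : R) : 'M[R]_4 :=
  (block_mx omega%:M 0 0 s%:M : 'M[R]_(2 + 2)) + t *: real_Sigma3.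

(* On the imaginary axis the eigenvalue equation is a real second-order system,
   with this matrix at l = i t. *)
Definition axis_mx (t : R) (x : R) : 'M[R]_4 := mass_mx t - real_coupling x.

Lemma map_sigma1 : map_mx rc real_sigma1 = sigma1.
Proof.
apply: etrans (@map_block_mx _ _ rc 1 1 1 1 _ _ _ _) _.
by rewrite !map_mx0 !map_mx1.
Qed.

Lemma map_sigma3 : map_mx rc real_sigma3 = sigma3.
Proof.
apply: etrans (@map_block_mx _ _ rc 1 1 1 1 _ _ _ _) _.
by rewrite map_mxN !map_mx0 !map_mx1.
Qed.

Lemma map_Sigma3 : map_mx rc real_Sigma3 = Sigma3.
Proof.
apply: etrans (@map_block_mx _ _ rc 2 2 2 2 _ _ _ _) _.
by rewrite !map_mx0 map_sigma3.
Qed.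

Lemma real_Sigma3_sqr : real_Sigma3 *m real_Sigma3 = 1%:M.
Proof.
have s3 : real_sigma3 *m real_sigma3 = 1%:M.
  apply: etrans (@mulmx_block _ 1 1 1 1 1 1 _ _ _ _ _ _ _ _) _.
  rewrite !(mul0mx, mulmx0, addr0, add0r, mul1mx, mulmx1, mulNmx, mulmxN, opprK).
  exact: (esym (@scalar_mx_block _ 1 1 1)).
apply: etrans (@mulmx_block _ 2 2 2 2 2 2 _ _ _ _ _ _ _ _) _.
rewrite !(mul0mx, mulmx0, addr0, add0r) s3.
exact: (esym (@scalar_mx_block _ 2 2 1)).
Qed.

Lemma map_axis_mx t x :
  map_mx rc (axis_mx t x) = potential F omega s m U V x + t%:C *: Sigma3.
Proof.
rewrite /axis_mx /mass_mx map_mxB map_mxD map_mxZ map_Sigma3 addrAC; congr (_ + _).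
rewrite /potential; congr (_ - _).
  apply: etrans (@map_block_mx _ _ rc 2 2 2 2 _ _ _ _) _.
  by rewrite !map_scalar_mx !map_mx0.
apply: etrans (@map_block_mx _ _ rc 2 2 2 2 _ _ _ _) _.
rewrite /real_B11 /real_B12 /real_B22 !map_mxD !map_mxZ !map_mxD !map_mx1 !map_sigma1.
by [].
Qed.

Lemma system_matrix_axis t x : system_matrix F omega s m U V (0 +i* t) x =
  map_mx rc (second_order (axis_mx t) x).
Proof.
apply/esym; apply: etrans (@map_block_mx _ _ rc 4 4 4 4 _ _ _ _) _; apply/esym.
rewrite /system_matrix !map_mx0 map_mx1 map_axis_mx.
congr block_mx; congr (_ + _); rewrite -scaleNr; congr (_ *: _).
by rewrite /GRing.mul /=; simpc.
Qed.

(** The bounded real solution given by [matching_kernel] is square integrable with two derivatives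
    and, read as a complex function, is the eigenfunction; its classical derivatives serve as weak
    ones. *)
Lemma axis_eigenvalue (t X c K : R) : 0 <= X -> 0 < c ->
  well_behaved (axis_mx t) X c K -> \det (matching_mx (axis_mx t) X) = 0 ->
  is_eigenvalue F omega s m U V (0 +i* t).
Proof.
move=> X0 c0 wq detq; have [cq bq _] := wq.
have [Y [hY [x0 Yx0] [B HB]]] := matching_kernel X0 (ltW c0) wq detq.
have L := bounded_solution_Lfun X0 c0 wq hY HB.
pose u x := usubmx (Y x); pose v x := dsubmx (Y x).
pose w x := axis_mx t x *m u x.
have du i (x : R) : is_derive x 1 (fun t => u t i 0) (v x i 0).
  by have [] := second_orderP hY x i 0.
have dv i (x : R) : is_derive x 1 (fun t => v t i 0) (w x i 0).
  by have [] := second_orderP hY x i 0.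
have cu i : continuous (fun t => u t i 0) := is_derive_continuous (du i).
have cv i : continuous (fun t => v t i 0) := is_derive_continuous (dv i).
have cw i : continuous (fun t => w t i 0).
  by apply: (continuous_mx_mul cq (B := u)) => k l; rewrite ord1; exact: cu.
pose lift (f : R -> 'cV[R]_4) x := map_mx rc (f x).
have Lz : (fun=> 0 : R) \in Lfun mu 2%:E.
  apply: (@Lfun2_primitive _ _ (fun=> 0) 0) => [|x|x]; first exact: cst_continuous.
    by rewrite expr0n; exact: is_derive_cst.
  by rewrite normr0.
have liftRe f j : (fun x => complex.Re (lift f x j 0)) = (fun x => f x j 0).
  by apply/funext => x; rewrite mxE.
have liftIm f j : (fun x => complex.Im (lift f x j 0)) = (fun=> 0).
  by apply/funext => x; rewrite mxE.
have L2_lift (f : R -> 'cV[R]_4) : (forall i, (fun x => f x i 0) \in Lfun mu 2%:E) -> L2 (lift f).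
  by move=> Hf j; rewrite liftRe liftIm; split.
have wd_lift (f g : R -> 'cV[R]_4) : (forall i, weak_derivative (fun x => f x i 0) (fun x => g x i 0)) ->
    weak_derivative4 (lift f) (lift g).
  move=> Hf j; rewrite !liftRe !liftIm; split; first exact: Hf.
  by apply: weak_derivativeW; exact: cst_continuous.
exists (lift u), (lift v), (lift w); split.
- split.
  + by apply: L2_lift => i; have [] := L i.
  + by apply: L2_lift => i; have [] := L i.
  + by apply: L2_lift => i; have [] := L i.
  + by apply: wd_lift => i; apply: weak_derivativeW.
  + by apply: wd_lift => i; apply: weak_derivativeW.
(* By continuity some component is nonzero on a ball around [x0], which would have to lie in a null
   set. *)
- move=> [A [mA A0 sA]].
  have [i ui] : exists i, u x0 i 0 != 0.
    apply: contrapT => /forallNP H; move/negP: Yx0; apply; apply/eqP/matrixP => i j.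
    by rewrite [RHS]mxE ord1; apply/eqP/negPn/negP; exact: H.
  have : \forall x \near x0, u x i 0 != 0 by exact: (cvgr_neq0 _ (cu i x0)).
  move=> [d /= d0 Hd].
  have sub : ball x0 d `<=` A.
    move=> x /Hd ux; apply: sA => /= lu; move: ux.
    have : lift u x i 0 = 0 by rewrite lu mxE.
    by rewrite mxE => -[->]; rewrite eqxx.
  have : (mu (ball x0 d) <= mu A)%E.
    by apply: le_measure; rewrite ?inE //; exact: measurable_ball.
  by rewrite A0 lebesgue_measure_ball ?(ltW d0) // lee_fin leNgt pmulrn_lgt0 // d0.
(* The potential cancels and [- t Sigma3 psi] is left inside; a second [Sigma3] squares to 1, and
   [- i] times [- t] is the eigenvalue. *)
- apply: aeW => x; rewrite /linearized_op /lift.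
  have -> : map_mx rc (w x) = potential F omega s m U V x *m map_mx rc (u x) +
      t%:C *: (Sigma3 *m map_mx rc (u x)).
    by rewrite /w map_mxM map_axis_mx mulmxDl scalemxAl.
  rewrite opprD addrAC addNr add0r mulmxN -scalemxAr mulmxA -map_Sigma3 -map_mxM.
  rewrite real_Sigma3_sqr map_mx1 mul1mx scalerN scaleNr opprK scalerA.
  by congr (_ *: _); rewrite /GRing.mul /=; simpc.
Qed.

End RealSystem.

(** * Uniformity along the bifurcation branch *)

Section Uniformity.
Context {R : realType}.
Implicit Types (f U V : R -> R) (H : R -> R -> R -> R).

Definition continuous3 H := continuous (fun z : R * R * R => H z.1.1 z.1.2 z.2).

Lemma derivable2_continuous f : derivable2 f -> continuous f.
Proof.
move=> df x; apply: differentiable_continuous; apply/derivable1_diffP.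
by have [] := df x.
Qed.

Lemma vanishing_small f (e : R) : vanishing f -> 0 < e ->
  exists2 X, 0 <= X & forall x, X <= `|x| -> `|f x| <= e.
Proof.
move=> [/cvgrPdist_le fy /cvgrPdist_le fNy] e0.
have [A [_ HA]] := fy e e0; have [B [_ HB]] := fNy e e0.
exists (Num.max (Num.max (A + 1) (- B + 1)) 0) => [|x]; first by rewrite le_max lexx orbT.
rewrite !ge_max => /andP[/andP[xA xB] _].
case: (leP 0 x) => x0.
  rewrite ger0_norm // in xA; have /HA : A < x by lra.
  by rewrite sub0r normrN.
rewrite ltr0_norm // in xB; have /HB : x < B by lra.
by rewrite sub0r normrN.
Qed.

Lemma vanishing_bounded f : continuous f -> vanishing f ->
  exists2 B, 0 <= B & forall x, `|f x| <= B.
Proof.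
move=> cf vf; have [X X0 HX] := vanishing_small vf ltr01.
have cnf : continuous (fun x => `|f x|).
  by move=> x; apply: cvg_norm; exact: cf.
have XX : - X <= X by lra.
have [|c _ Hc] := @EVT_max R (fun x => `|f x|) (- X) X XX.
  exact: continuous_subspaceT.
exists (`|f c| + 1) => [|x]; first by rewrite addr_ge0.
case: (leP X `|x|) => [/HX h|/ltW xX].
  by apply: le_trans h _; rewrite lerDr.
apply: (@le_trans _ _ `|f c|); last by rewrite lerDl.
by apply: Hc; rewrite in_itv /= -ler_norml.
Qed.

Lemma continuous3_at H (u e : R) : continuous3 H -> 0 < e ->
  exists2 r, 0 < r & forall u' v m, `|u - u'| < r -> `|v| < r -> `|m| < r ->
    `|H u 0 0 - H u' v m| < e.
Proof.
move=> cH e0; have /cvgrPdist_lt /(_ e e0) := cH (u, 0, 0).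
move=> [[P Q] /= [[[P1 P2] /= [n1 n2] sP] nQ] HPQ].
have /nbhs_ballP[r1 /= r10 B1] := n1.
have /nbhs_ballP[r2 /= r20 B2] := n2.
have /nbhs_ballP[r3 /= r30 B3] := nQ.
exists (Num.min (Num.min r1 r2) r3) => [|u' v m]; first by rewrite !lt_min r10 r20.
rewrite !lt_min => /andP[/andP[h1 _] _] /andP[/andP[_ h2] _] /andP[_ h3].
apply: (HPQ (u', v, m)); split => /=; last by apply: B3; rewrite /ball /= sub0r normrN.
apply: (sP (u', v)); split => /=; first exact: B1.
by apply: B2; rewrite /ball /= sub0r normrN.
Qed.

(** Compactness of [[- B, B]] makes continuity at the points [(u, 0, 0)] uniform in [u]. This is the
    form needed: the fundamental wave is bounded, while its second component and the parameter are
    0. *)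
Lemma continuous3_uniform H (B e : R) : continuous3 H -> 0 < e ->
  exists2 d, 0 < d & forall u u' v m, `|u| <= B ->
    `|u - u'| < d -> `|v| < d -> `|m| < d -> `|H u' v m - H u 0 0| <= e.
Proof.
move=> cH e0.
pose P (d u : R) := forall u' v m, `|u - u'| < d -> `|v| < d -> `|m| < d ->
  `|H u' v m - H u 0 0| <= e.
have cov := (compact_near_coveringP `[- B, B]%classic).1 (@segment_compact R (- B) B).
have near_P (u : R) : \forall x \near u & d \near (0 : R)^'+, P d x.
  have e20 : 0 < e / 2 by rewrite divr_gt0.
  have [r r0 Hr] := continuous3_at u cH e20.
  have r20 : 0 < r / 2 by rewrite divr_gt0.
  exists (ball u (r / 2), [set d | d < r / 2]) => /=.
    by split; [exact: nbhsx_ballx|exact: nbhs_right_lt].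
  move=> [x d] /= [bx dr] u' v m h1 h2 h3.
  have hx : `|H u 0 0 - H x 0 0| < e / 2.
    by apply: Hr; rewrite ?normr0 //; move: bx; rewrite /ball /=; lra.
  have hu : `|H u 0 0 - H u' v m| < e / 2.
    have tri := ler_distD x u u'.
    by apply: Hr; move: bx; rewrite /ball /=; lra.
  by move: hx hu; rewrite !ltr_norml ler_norml; lra.
have near_d : \forall d \near (0 : R)^'+, `[- B, B]%classic `<=` P d.
  by apply: cov => u _; exact: near_P.
have [d [d0 Hd]] : exists d : R, 0 < d /\ `[- B, B]%classic `<=` P d.
  near (0 : R)^'+ => d; exists d; split; near: d => //; exact: nbhs_right_gt.
exists d => // u u' v m uB; apply: Hd.
by rewrite /= in_itv /= -ler_norml.
Unshelve. all: by end_near. Qed.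

End Uniformity.

(** * Ellipticity and uniform convergence of the axis matrix *)

Section AxisMatrix.
Context {R : realType}.
Implicit Types (U V : R -> R) (F H : R -> R -> R -> R).

Definition ones2 : 'M[R]_2 := 1%:M + real_sigma1.

Lemma ones2_le i j : `|ones2 i j| <= 2.
Proof.
rewrite mxE (le_trans (ler_normD _ _)) // (_ : 2 = 1 + 1) //; apply: lerD.
  by rewrite mxE normr_nat; case: eqP.
rewrite /real_sigma1.
case: (@split_ordP 1 1 i) => k ->; case: (@split_ordP 1 1 j) => l ->.
- by rewrite (@block_mxEul _ 1 1 1 1) mxE normr0.
- by rewrite (@block_mxEur _ 1 1 1 1) mxE normr_nat; case: eqP.
- by rewrite (@block_mxEdl _ 1 1 1 1) mxE normr_nat; case: eqP.
- by rewrite (@block_mxEdr _ 1 1 1 1) mxE normr0.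
Qed.

Lemma block4_le (A B C D : 'M[R]_2) (b : R) :
  (forall i j, [/\ `|A i j| <= b, `|B i j| <= b, `|C i j| <= b & `|D i j| <= b]) ->
  forall i j, `|(block_mx A B C D : 'M[R]_(2 + 2)) i j| <= b.
Proof.
move=> h i j; case: (@split_ordP 2 2 i) => k ->; case: (@split_ordP 2 2 j) => l ->.
- by rewrite block_mxEul; have [] := h k l.
- by rewrite block_mxEur; have [] := h k l.
- by rewrite block_mxEdl; have [] := h k l.
- by rewrite block_mxEdr; have [] := h k l.
Qed.

(** The coupling matrix is a combination of these five constant matrices, with scalar coefficients
    that are continuous functions of the two wave components and the parameter. All estimates on it
    thereby become scalar ones. *)
Definition coupling_shape (k : 'I_5) : 'M[R]_4 :=
  [:: block_mx ones2 0 0 0 : 'M[R]_(2 + 2);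
      block_mx 1%:M 0 0 0 : 'M[R]_(2 + 2);
      block_mx 0 ones2 ones2 0 : 'M[R]_(2 + 2);
      block_mx 0 0 0 ones2 : 'M[R]_(2 + 2);
      block_mx 0 0 0 1%:M : 'M[R]_(2 + 2)]`_k.

Definition coupling_coef F (k : 'I_5) (u v m : R) : R :=
  [:: d1 (d1 F) (u ^+ 2) (v ^+ 2) m * u ^+ 2;
      d1 F (u ^+ 2) (v ^+ 2) m;
      d1 (d2 F) (u ^+ 2) (v ^+ 2) m * u * v;
      d2 (d2 F) (u ^+ 2) (v ^+ 2) m * v ^+ 2;
      d2 F (u ^+ 2) (v ^+ 2) m]`_k.

Lemma coupling_shape_le k i j : `|coupling_shape k i j| <= 2.
Proof.
have z2 (p q : 'I_2) : `|(0 : 'M[R]_2) p q| <= 2 by rewrite mxE normr0.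
have o2 (p q : 'I_2) : `|(1%:M : 'M[R]_2) p q| <= 2.
  by rewrite mxE normr_nat; case: eqP => // _; rewrite ler1n.
rewrite /coupling_shape; case: k => -[|[|[|[|[|//]]]]] ? /=;
  apply: block4_le => p q; split; by [exact: z2|exact: o2|exact: ones2_le].
Qed.

Lemma coupling_blockE (a : 'I_5 -> R) (i j : 'I_4) :
  (block_mx (a 0 *: ones2 + a 1 *: 1%:M) (a 2 *: ones2) (a 2 *: ones2)
    (a 3 *: ones2 + a 4 *: 1%:M) : 'M[R]_(2 + 2)) i j =
  \sum_k a k * coupling_shape k i j.
Proof.
rewrite 5!big_ord_recr big_ord0 /= add0r /coupling_shape /=.
rewrite [a (widen_ord _ _)](_ : _ = a 0); last by congr a; exact: val_inj.
rewrite [a (widen_ord _ _)](_ : _ = a 1); last by congr a; exact: val_inj.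
rewrite [a (widen_ord _ _)](_ : _ = a 2); last by congr a; exact: val_inj.
rewrite [a (widen_ord _ _)](_ : _ = a 3); last by congr a; exact: val_inj.
rewrite [a ord_max](_ : _ = a 4); last by congr a; exact: val_inj.
move: (a 0) (a 1) (a 2) (a 3) (a 4) => {a} a b g d e.
have z2 k l : (0 : 'M[R]_2) k l = 0 by rewrite mxE.
have lin k l (x y : R) : (x *: ones2 + y *: 1%:M) k l = x * ones2 k l + y * (1%:M : 'M[R]_2) k l.
  by rewrite mxE [X in X + _]mxE [X in _ + X]mxE.
have lin1 k l (x : R) : (x *: ones2) k l = x * ones2 k l by rewrite mxE.
move: ones2 (1%:M : 'M[R]_2) (0 : 'M[R]_2) lin lin1 z2 => J I Z lin lin1 z2.
case: (@split_ordP 2 2 i) => k ->; case: (@split_ordP 2 2 j) => l ->.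
- by rewrite !(@block_mxEul _ 2 2 2 2) lin !z2; ring.
- by rewrite !(@block_mxEur _ 2 2 2 2) lin1 !z2; ring.
- by rewrite !(@block_mxEdl _ 2 2 2 2) lin1 !z2; ring.
- by rewrite !(@block_mxEdr _ 2 2 2 2) lin !z2; ring.
Qed.

Lemma real_couplingE F m U V x i j : real_coupling F m U V x i j =
  \sum_k coupling_coef F k (U x) (V x) m * coupling_shape k i j.
Proof. by rewrite -(coupling_blockE (fun k => coupling_coef F k (U x) (V x) m)). Qed.

(** Each product [w_i B_ij w_j] is at most [b / 2] times the sum of the two squares; summing over
    all pairs costs [n b]. *)
Lemma coercive_perturb n (D B : 'M[R]_n) (c b : R) (w : 'cV[R]_n) :
  (forall i j, i != j -> D i j = 0) -> (forall i, c <= D i i) ->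
  (forall i j, `|B i j| <= b) ->
  (c - n%:R * b) * (\sum_i w i 0 ^+ 2) <= \sum_i w i 0 * ((D - B) *m w) i 0.
Proof.
move=> D0 Dc Bb.
have -> : \sum_i w i 0 * ((D - B) *m w) i 0 =
    \sum_i D i i * w i 0 ^+ 2 - \sum_i \sum_j w i 0 * (B i j * w j 0).
  rewrite -sumrB; apply: eq_bigr => i _; rewrite mulmxBl !mxE mulrDr mulrN mulr_sumr.
  congr (_ - _); rewrite mulr_sumr (bigD1 i) //= big1 ?addr0; first by ring.
  by move=> j ji; rewrite D0 ?mul0r ?mulr0 // eq_sym.
rewrite mulrBl; apply: lerB.
  by rewrite mulr_sumr; apply: ler_sum => i _; rewrite ler_wpM2r ?sqr_ge0.
apply: (@le_trans _ _ (\sum_i \sum_j b / 2 * (w i 0 ^+ 2 + w j 0 ^+ 2))).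
  apply: ler_sum => i _; apply: ler_sum => j _.
  have h2 : 2 * (`|w i 0| * `|w j 0|) <= w i 0 ^+ 2 + w j 0 ^+ 2.
    rewrite -(real_normK (num_real (w i 0))) -(real_normK (num_real (w j 0))).
    have := sqr_ge0 (`|w i 0| - `|w j 0|); rewrite sqrrB; lra.
  apply: le_trans (ler_norm _) _; rewrite !normrM.
  rewrite [leLHS](_ : _ = `|B i j| / 2 * (2 * (`|w i 0| * `|w j 0|))); last by field.
  by apply: ler_pM; rewrite ?mulr_ge0 ?divr_ge0 // ler_wpM2r.
rewrite le_eqVlt; apply/orP; left; apply/eqP.
have e1 : \sum_(i < n) \sum_(j < n) w i 0 ^+ 2 = n%:R * \sum_i w i 0 ^+ 2.
  by rewrite mulr_sumr; apply: eq_bigr => i _; rewrite sumr_const card_ord mulr_natl.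
have e2 : \sum_(i < n) \sum_(j < n) w j 0 ^+ 2 = n%:R * \sum_i w i 0 ^+ 2.
  by rewrite sumr_const card_ord mulr_natl.
under eq_bigr => i _ do rewrite -mulr_sumr big_split /=.
by rewrite -mulr_sumr big_split /= e1 e2; field.
Qed.

Lemma mass_mxE omega s (t : R) i j : mass_mx omega s t i j =
  (block_mx omega%:M 0 0 s%:M : 'M[R]_(2 + 2)) i j + t * real_Sigma3 i j.
Proof. by rewrite mxE [X in _ + X = _]mxE. Qed.

Lemma mass_mx_offdiag omega s (t : R) i j : i != j -> mass_mx omega s t i j = 0.
Proof.
have s3 (p q : 'I_2) : p != q -> real_sigma3 p q = 0 :> R.
  rewrite /real_sigma3.
  case: (@split_ordP 1 1 p) => k ->; case: (@split_ordP 1 1 q) => l ->.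
  - by rewrite !ord1 eqxx.
  - by rewrite (@block_mxEur _ 1 1 1 1) mxE.
  - by rewrite (@block_mxEdl _ 1 1 1 1) mxE.
  - by rewrite !ord1 eqxx.
have sc (p q : 'I_2) (a : R) : p != q -> (a%:M : 'M[R]_2) p q = 0.
  by move=> /negPf pq; rewrite mxE pq.
have z2 (p q : 'I_2) : (0 : 'M[R]_2) p q = 0 by rewrite mxE.
rewrite mass_mxE /real_Sigma3.
case: (@split_ordP 2 2 i) => k ->; case: (@split_ordP 2 2 j) => l ->.
- rewrite (inj_eq (@lshift_inj 2 2)) => kl.
  by rewrite !(@block_mxEul _ 2 2 2 2) sc // s3 // mulr0 addr0.
- by rewrite !(@block_mxEur _ 2 2 2 2) !z2 mulr0 addr0.
- by rewrite !(@block_mxEdl _ 2 2 2 2) !z2 mulr0 addr0.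
- rewrite (inj_eq (@rshift_inj 2 2)) => kl.
  by rewrite !(@block_mxEdr _ 2 2 2 2) sc // s3 // mulr0 addr0.
Qed.

(** The diagonal entries are [omega] and [s], each plus or minus [t]. *)
Lemma mass_mx_diag omega s (t r : R) i : `|t| <= r ->
  Num.min omega s - r <= mass_mx omega s t i i.
Proof.
move=> tr; have s3 (p : 'I_2) : `|t * real_sigma3 p p| <= r.
  apply: le_trans tr; rewrite normrM ler_piMr // /real_sigma3.
  case: (@split_ordP 1 1 p) => k ->.
    by rewrite (@block_mxEul _ 1 1 1 1) mxE normr_nat; case: eqP.
  by rewrite (@block_mxEdr _ 1 1 1 1) !mxE normrN normr_nat; case: eqP.
have sc (p : 'I_2) (a : R) : (a%:M : 'M[R]_2) p p = a by rewrite mxE eqxx.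
rewrite mass_mxE /real_Sigma3.
have [mo ms] : Num.min omega s <= omega /\ Num.min omega s <= s.
  by rewrite !ge_min !lexx orbT.
case: (@split_ordP 2 2 i) => k ->.
  rewrite !(@block_mxEul _ 2 2 2 2) sc.
  by have := s3 k; rewrite ler_norml => /andP[]; lra.
rewrite !(@block_mxEdr _ 2 2 2 2) sc.
by have := s3 k; rewrite ler_norml => /andP[]; lra.
Qed.

Lemma real_coupling_le F m U V x (b : R) :
  (forall k, `|coupling_coef F k (U x) (V x) m| <= b) ->
  forall i j, `|real_coupling F m U V x i j| <= 10 * b.
Proof.
move=> h i j; rewrite real_couplingE; apply: le_trans (ler_norm_sum _ _ _) _.
apply: (@le_trans _ _ (\sum_(k < 5) b * 2)).
  apply: ler_sum => k _; rewrite normrM; apply: ler_pM => //.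
  exact: coupling_shape_le.
by rewrite sumr_const card_ord -mulr_natl le_eqVlt; apply/orP; left; apply/eqP; ring.
Qed.

Lemma mass_mx_bound omega s (r : R) :
  exists b, forall t i j, `|t| <= r -> `|mass_mx omega s t i j| <= b.
Proof.
have [b1 h1] := mx_entry_bound (block_mx omega%:M 0 0 s%:M : 'M[R]_(2 + 2)).
have [b2 h2] := mx_entry_bound (@real_Sigma3 R).
exists (b1 + r * b2) => t i j tr; rewrite mass_mxE.
apply: le_trans (ler_normD _ _) _; apply: lerD; first exact: h1.
by rewrite normrM; apply: ler_pM.
Qed.

(** Five shapes with entries at most 2 make the coupling at most [10 b] on the tails, and a 4 by 4
    perturbation of that size costs [40 b]. The factor 80 lets this use half of the gap and leave
    the other half as ellipticity constant. Likewise [11 Ka] is [Ka] for the mass and [10 Ka] for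
    the coupling. *)
Lemma axis_well_behaved F omega s m U V (r X Ka b : R) :
  (forall k, continuous (fun x => coupling_coef F k (U x) (V x) m)) ->
  (forall k x, `|coupling_coef F k (U x) (V x) m| <= Ka) ->
  (forall k x, X <= `|x| -> `|coupling_coef F k (U x) (V x) m| <= b) ->
  (forall t i j, `|t| <= r -> `|mass_mx omega s t i j| <= Ka) ->
  80 * b <= Num.min omega s - r ->
  forall t, `|t| <= r ->
  well_behaved (axis_mx F omega s m U V t) X ((Num.min omega s - r) / 2) (11 * Ka).
Proof.
move=> cc cb cX mb br t tr; split.
- move=> i j x; rewrite /axis_mx.
  have -> : (fun x => (mass_mx omega s t - real_coupling F m U V x) i j) =
     (fun x => mass_mx omega s t i j -
        \sum_k coupling_coef F k (U x) (V x) m * coupling_shape k i j).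
    by apply/funext => y; rewrite mxE [X in _ + X]mxE real_couplingE.
  apply: cvgB; first exact: cvg_cst.
  apply: (cvgr_sum _ (f := fun k x => coupling_coef F k (U x) (V x) m * coupling_shape k i j)
    (l := fun k => coupling_coef F k (U x) (V x) m * coupling_shape k i j)) => k.
  by apply: cvgMl; exact: cc.
- move=> x i j; rewrite /axis_mx mxE [X in _ + X]mxE (le_trans (ler_normD _ _)) //.
  rewrite normrN; have h1 := mb t i j tr.
  have h2 := real_coupling_le (fun k => cb k x) i j; lra.
- move=> x Xx w.
  have := @coercive_perturb 4 (mass_mx omega s t) (real_coupling F m U V x)
    (Num.min omega s - r) (10 * b) w.
  move=> /(_ (@mass_mx_offdiag omega s t) (fun i => mass_mx_diag omega s i tr)).
  move=> /(_ (real_coupling_le (fun k => cX k x Xx))); apply: le_trans.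
  apply: ler_wpM2r; last by lra.
  by apply: sumr_ge0 => i _; exact: sqr_ge0.
Qed.

Lemma continuous3_comp (T : Type) (F : set_system T) {FF : Filter F} H
    (a b c : T -> R) (a0 b0 c0 : R) : continuous3 H ->
  a @ F --> a0 -> b @ F --> b0 -> c @ F --> c0 ->
  H (a t) (b t) (c t) @[t --> F] --> H a0 b0 c0.
Proof.
move=> cH ca cb cc.
exact: (cvg_comp (fun t => (a t, b t, c t)) (fun z => H z.1.1 z.1.2 z.2)
  (cvg_pair (cvg_pair ca cb) cc) (cH (a0, b0, c0))).
Qed.

Lemma continuous3_coef F : nonlinearity F -> forall k, continuous3 (coupling_coef F k).
Proof.
move=> [[_ [_ [C1 C2 _]]] _ _] k.
have c1 : continuous3 (d1 F) by case: C1.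
have c2 : continuous3 (d2 F) by case: C2.
have c11 : continuous3 (d1 (d1 F)) by case: C1 => _ [_ [[]]].
have c12 : continuous3 (d1 (d2 F)) by case: C2 => _ [_ [[]]].
have c22 : continuous3 (d2 (d2 F)) by case: C2 => _ [_ [_ []]].
have cu : continuous (fun z : R * R * R => z.1.1).
  by move=> z; apply: (cvg_comp _ _ cvg_fst); exact: cvg_fst.
have cv : continuous (fun z : R * R * R => z.1.2).
  by move=> z; apply: (cvg_comp _ _ cvg_fst); exact: cvg_snd.
have c_sqr (f : R * R * R -> R) : continuous f -> continuous (fun z => f z ^+ 2).
  by move=> cf z; exact: (cvg_comp f (fun y => y ^+ 2) (cf z) (@exprn_continuous R 2 (f z))).
have sq (G : R -> R -> R -> R) : continuous3 G -> continuous3 (fun u v m => G (u ^+ 2) (v ^+ 2) m).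
  move=> cG z; have cm : (fun z : R * R * R => z.2) @ z --> z.2 by exact: cvg_snd.
  exact: (continuous3_comp cG (c_sqr _ cu z) (c_sqr _ cv z) cm).
rewrite /continuous3 /coupling_coef; case: k => -[|[|[|[|[|//]]]]] ? z /=.
- by apply: cvgM; [exact: (sq _ c11)|exact: c_sqr].
- exact: (sq _ c1).
- by apply: cvgM; [apply: cvgM; [exact: (sq _ c12)|exact: cu]|exact: cv].
- by apply: cvgM; [exact: (sq _ c22)|exact: c_sqr].
- exact: (sq _ c2).
Qed.

Arguments continuous3_coef {F} _ _ _ _ _.

Lemma coupling_coef0 F k : nonlinearity F -> coupling_coef F k 0 0 0 = 0.
Proof.
move=> [_ /(_ 0)[_ e1 e2] _].
have sq0 : (0 : R) ^+ 2 = 0 by rewrite expr0n.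
rewrite /coupling_coef; case: k => -[|[|[|[|[|//]]]]] ? /=; rewrite sq0 ?mulr0 //.
Qed.

(** One triple of constants has to serve the fundamental and the bifurcated waves. The coefficients
    of the fundamental wave are at most [b / 2] beyond [X], and those of the bifurcated wave differ
    from them by at most [b / 2] at every [x], so the same [X] works with the bound [b]. *)
Lemma axis_uniform F omega s (U0 : R -> R) (Ue Ve : R -> R -> R) (me : R -> R) (r : R) :
  nonlinearity F -> continuous U0 -> vanishing U0 ->
  (\forall e \near (0 : R)^'+, continuous (Ue e) /\ continuous (Ve e)) ->
  (forall d, 0 < d -> \forall e \near (0 : R)^'+, `|me e| < d /\
    forall x, `|U0 x - Ue e x| < d /\ `|Ve e x| < d) ->
  r < Num.min omega s ->
  exists X K c, [/\ 0 <= X, 0 < c,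
    forall t, `|t| <= r -> well_behaved (axis_mx F omega s 0 U0 (fun=> 0) t) X c K,
    \forall e \near (0 : R)^'+, forall t, `|t| <= r ->
      well_behaved (axis_mx F omega s (me e) (Ue e) (Ve e) t) X c K &
    forall t, unif_cvg_mx (0 : R)^'+
      (fun e => axis_mx F omega s (me e) (Ue e) (Ve e) t)
      (axis_mx F omega s 0 U0 (fun=> 0) t)].
Proof.
move=> nF cU0 vU0 cUV close rm.
have [B B0 HB] := vanishing_bounded cU0 vU0.
pose a0 k x := coupling_coef F k (U0 x) 0 0.
have ca0 k : continuous (a0 k).
  move=> x; apply: (continuous3_comp (b := fun=> 0) (c := fun=> 0)
    (continuous3_coef nF k) (cU0 x)); exact: cvg_cst.
pose c2 := Num.min omega s - r.
have c20 : 0 < c2 by rewrite subr_gt0.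
pose b := c2 / 80.
have b0 : 0 < b by rewrite divr_gt0.
have unif (d : R) : 0 < d -> exists2 dd, 0 < dd & forall k u u' v m, `|u| <= B ->
    `|u - u'| < dd -> `|v| < dd -> `|m| < dd ->
    `|coupling_coef F k u' v m - coupling_coef F k u 0 0| <= d.
  move=> d0.
  have /choice[dd Hdd] : forall k : 'I_5, exists dk, 0 < dk /\
      forall u u' v m, `|u| <= B -> `|u - u'| < dk -> `|v| < dk -> `|m| < dk ->
      `|coupling_coef F k u' v m - coupling_coef F k u 0 0| <= d.
    move=> k; have [dk dk0 h] := continuous3_uniform B (continuous3_coef nF k) d0.
    by exists dk.
  exists (\big[Num.min/1]_k dd k).
    elim/big_ind: _ => // [x y x0 y0|k _]; first by rewrite lt_min x0.
    by have [] := Hdd k.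
  move=> k u u' v m uB h1 h2 h3; have [_] := Hdd k.
  have hk : \big[Num.min/1]_k dd k <= dd k by rewrite (bigD1 k) //= ge_min lexx.
  by apply => //; [exact: lt_le_trans h1 hk|exact: lt_le_trans h2 hk|exact: lt_le_trans h3 hk].
have [A A0 HA] : exists2 A, 0 <= A & forall k x, `|a0 k x| <= A.
  have /choice[A HA] : forall k : 'I_5, exists A : R, forall u, `|u| <= B ->
      `|coupling_coef F k u 0 0| <= A.
    move=> k; have BB : - B <= B by lra.
    have [|c _ Hc] := @EVT_max R (fun u => `|coupling_coef F k u 0 0|) (- B) B BB.
      apply: continuous_subspaceT => u; apply: cvg_norm.
      apply: (continuous3_comp (a := id) (b := fun=> 0) (c := fun=> 0)
        (continuous3_coef nF k)); by [exact: cvg_id|exact: cvg_cst].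
    by exists `|coupling_coef F k c 0 0| => u uB; apply: Hc; rewrite in_itv /= -ler_norml.
  exists (\sum_k `|A k|) => [|k x]; first exact: sumr_ge0.
  apply: le_trans (HA k _ (HB x)) _; apply: le_trans (ler_norm _) _.
  by rewrite (bigD1 k) //= lerDl sumr_ge0.
have b20 : 0 < b / 2 by rewrite divr_gt0.
have [dd dd0 Hdd] := unif _ b20.
have dd20 : 0 < dd / 2 by rewrite divr_gt0.
(* All coefficients vanish at the origin, by the normalisation of [F]. Half of [dd] gives the strict
   inequality required by [Hdd]. *)
have [X X0 HX] := vanishing_small vU0 dd20.
have [bm Hbm] := mass_mx_bound omega s r.
pose Ka := A + b + `|bm|.
have bm0 := normr_ge0 bm; have bmn := ler_norm bm.
have a0X k x : X <= `|x| -> `|a0 k x| <= b / 2.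
  move=> /HX h; rewrite -[a0 k x]subr0 -(coupling_coef0 k nF).
  by apply: Hdd; rewrite ?normr0 // sub0r normrN; lra.
have Hmass t i j : `|t| <= r -> `|mass_mx omega s t i j| <= Ka.
  by move=> /(Hbm t i j) h; apply: le_trans h _; rewrite /Ka; lra.
have c80 : 80 * b <= Num.min omega s - r by rewrite /b -/c2; lra.
exists X, (11 * Ka), (c2 / 2); split => //.
- by rewrite divr_gt0.
- apply: (axis_well_behaved (b := b)) => //.
  + by move=> k x; apply: le_trans (HA k x) _; rewrite /Ka; lra.
  + by move=> k x Xx; apply: le_trans (a0X k x Xx) _; lra.
- apply: filterS2 cUV (close dd dd0) => e [cU cV] [me0 He].
  have near_a0 k x : `|coupling_coef F k (Ue e x) (Ve e x) (me e) - a0 k x| <= b / 2.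
    by have [h1 h2] := He x; exact: Hdd.
  apply: (axis_well_behaved (b := b)) => //.
  + move=> k x.
    apply: (continuous3_comp (c := fun=> me e) (continuous3_coef nF k) (cU x) (cV x)).
    exact: cvg_cst.
  + move=> k x; have := near_a0 k x; have := HA k x.
    by rewrite !ler_norml /Ka; lra.
  + move=> k x Xx; have := near_a0 k x; have := a0X k x Xx.
    by rewrite !ler_norml; lra.
- move=> t d d0; have d10 : 0 < d / 10 by rewrite divr_gt0.
  have [dk dk0 Hdk] := unif _ d10.
  apply: filterS (close dk dk0) => e [me0 He] x i j.
  rewrite /axis_mx; set M := mass_mx _ _ _.
  have sub (P Q : 'M[R]_4) : (M - P) i j - (M - Q) i j = - P i j + Q i j.
    by rewrite !mxE; ring.
  rewrite sub !real_couplingE -sumrN -big_split /=.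
  apply: le_trans (ler_norm_sum _ _ _) _.
  apply: (@le_trans _ _ (\sum_(k < 5) d / 10 * 2)); last first.
    by rewrite sumr_const card_ord -mulr_natl le_eqVlt; apply/orP; left; apply/eqP; field.
  apply: ler_sum => k _; rewrite -mulNr -mulrDl addrC -opprB.
  rewrite normrM normrN; apply: ler_pM => //; last exact: coupling_shape_le.
  by have [h1 h2] := He x; exact: Hdk.
Qed.

Lemma axis_cvg F omega s m U V (t0 : R) :
  unif_cvg_mx (nbhs t0) (fun t => axis_mx F omega s m U V t) (axis_mx F omega s m U V t0).
Proof.
move=> d d0; have [b Hb] := mx_entry_bound (@real_Sigma3 R).
have b0 : 0 <= b := le_trans (normr_ge0 _) (Hb 0 0).
have d1 : 0 < d / (b + 1) by rewrite divr_gt0 // ltr_wpDl.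
have : \forall t \near t0, `|t0 - t| < d / (b + 1) by exists (d / (b + 1)).
apply: filterS => t ht x i j; rewrite /axis_mx /mass_mx.
have -> (A B D : 'M[R]_4) : (A + t *: B - D) i j - (A + t0 *: B - D) i j = (t - t0) * B i j.
  by rewrite !mxE; ring.
rewrite normrM distrC.
apply: (@le_trans _ _ (d / (b + 1) * (b + 1))); last by rewrite divfK // gt_eqF // ltr_wpDl.
by apply: ler_pM => //; [exact: ltW|apply: le_trans (Hb i j) _; rewrite lerDl].
Qed.

End AxisMatrix.

Section WavesClose.
Context {R : realType}.
Implicit Types (U V : R -> R) (F : R -> R -> R -> R).

Lemma bifurcated_close F omega s mbar (U0 U2 V1 : R -> R) sgn (Ue Ve : R -> R -> R)
    (M : R) :
  continuous U0 -> vanishing U0 -> (forall x, `|V1 x| <= M) ->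
  bifurcated_waves F omega s mbar U0 U2 V1 sgn Ue Ve ->
  forall d, 0 < d -> \forall e \near (0 : R)^'+, `|mbar * e ^+ 2| < d /\
    forall x, `|U0 x - Ue e x| < d /\ `|Ve e x| < d.
Proof.
move=> cU0 vU0 HM [hom [C HC]] d d0.
have [B0 B00 HB0] := vanishing_bounded cU0 vU0.
pose C' := Num.max C 0.
have C0 : 0 <= C' by rewrite le_max lexx orbT.
have M0 : 0 <= M by apply: le_trans (HM 0).
have bnd e x : 0 < e -> `|Ue e x - (U0 x + e ^+ 2 * U2 x)| <= C * e ^+ 4 ->
    `|Ue e x - (U0 x + e ^+ 2 * U2 x)| <= C' * e ^+ 4.
  by move=> e0 /le_trans; apply; rewrite ler_wpM2r ?exprn_ge0 ?(ltW e0) // /C' le_max lexx.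
have [B2 B20 HB2] : exists2 B2, 0 <= B2 & forall x, `|U2 x| <= B2.
  have [e [e0 [hom_e HCe]]] : exists e : R, 0 < e /\
     (homoclinic F omega s (mbar * e ^+ 2) (Ue e) (Ve e) /\
      forall x, `|Ue e x - (U0 x + e ^+ 2 * U2 x)| <= C * e ^+ 4 /\
        `|Ve e x - (-1) ^+ sgn * (e * V1 x)| <= C * e ^+ 3).
    near (0 : R)^'+ => e; exists e; split; first by near: e; exact: nbhs_right_gt.
    by split; near: e.
  have [/derivable2_continuous cU _ _ _ [vU _]] := hom_e.
  have [B1 B10 HB1] := vanishing_bounded cU vU.
  have e20 : 0 < e ^+ 2 by rewrite exprn_gt0.
  exists ((B1 + B0 + C' * e ^+ 4) / e ^+ 2) => [|x].
    by rewrite divr_ge0 ?(ltW e20) // addr_ge0 ?addr_ge0 // mulr_ge0 // exprn_ge0 // ltW.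
  have E : `|e ^+ 2 * U2 x| = `|U2 x| * e ^+ 2.
    by rewrite normrM (gtr0_norm e20) mulrC.
  rewrite ler_pdivlMr // -E.
  have [/(bnd _ _ e0) h _] := HCe x; have h1 := HB1 x; have h0 := HB0 x.
  by move: h h1 h0; rewrite !ler_norml; lra.
(* For [e < 1] all powers of [e] that occur are at most [e], so every error is bounded by part of
   [S * e]; the final 1 makes [S] positive and the bounds strict. *)
pose S := B2 + C' + M + `|mbar| + 1.
have mb0 := normr_ge0 mbar.
have S0 : 0 < S by rewrite /S; lra.
near=> e.
have e0 : 0 < e by near: e; exact: nbhs_right_gt.
have e1 : e < 1 by near: e; exact: nbhs_right_lt.
have eS : e < d / S by near: e; apply: nbhs_right_lt; rewrite divr_gt0.
have HCe : forall x, `|Ue e x - (U0 x + e ^+ 2 * U2 x)| <= C * e ^+ 4 /\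
        `|Ve e x - (-1) ^+ sgn * (e * V1 x)| <= C * e ^+ 3 by near: e.
have {}eS : S * e < d by rewrite mulrC -ltr_pdivlMr.
have pw k : e ^+ k.+1 <= e.
  by rewrite exprS ler_piMr ?(ltW e0) // exprn_ile1 ?(ltW e0) ?(ltW e1).
have SE : S * e = B2 * e + C' * e + M * e + `|mbar| * e + e by rewrite /S; ring.
have [B2e Ce Me me] : [/\ 0 <= B2 * e, 0 <= C' * e, 0 <= M * e & 0 <= `|mbar| * e].
  by rewrite !mulr_ge0 // ltW.
split=> [|x].
  rewrite normrM (ger0_norm (exprn_ge0 _ (ltW e0))).
  have : `|mbar| * e ^+ 2 <= `|mbar| * e by rewrite ler_wpM2l.
  lra.
have [/(bnd _ _ e0) h1 h2] := HCe x.
have p2 : `|e ^+ 2 * U2 x| <= B2 * e.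
  rewrite normrM (ger0_norm (exprn_ge0 _ (ltW e0))) mulrC.
  by apply: ler_pM => //; rewrite exprn_ge0 // ltW.
have p4 : C' * e ^+ 4 <= C' * e by rewrite ler_wpM2l.
have p3 : C * e ^+ 3 <= C' * e.
  apply: (@le_trans _ _ (C' * e ^+ 3)); last by rewrite ler_wpM2l.
  by rewrite ler_wpM2r ?exprn_ge0 ?(ltW e0) // /C' le_max lexx.
have pV : `|(-1) ^+ sgn * (e * V1 x)| <= M * e.
  rewrite normrM normrX normrN1 expr1n mul1r normrM (gtr0_norm e0) mulrC.
  by rewrite ler_wpM2r // ltW.
by split; move: h1 h2 p2 pV; rewrite !ler_norml !ltr_norml; lra.
Unshelve. all: by end_near. Qed.

End WavesClose.

Section ComplexLimits.
Context {R : realType}.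
Local Notation C := R[i].
Local Notation Re := complex.Re.
Local Notation Im := complex.Im.

Lemma normc_lt_Re_Im (z : C) (r : R) : `|z| < r%:C -> `|Re z| < r /\ `|Im z| < r.
Proof.
case: z => a b; rewrite normc_def /= ltcR => h.
have sb0 : 0 <= a ^+ 2 + b ^+ 2 by rewrite addr_ge0 ?sqr_ge0.
split; apply: le_lt_trans h; rewrite -sqrtr_sqr ler_sqrt //.
  by rewrite lerDl sqr_ge0.
by rewrite lerDr sqr_ge0.
Qed.

Section Filter.
Context {T : Type} {F : set_system T} {FF : Filter F}.

(** Componentwise convergence, so that the limit rules over the reals apply to the real and
    imaginary parts. *)
Definition cvgC (f : T -> C) (l : C) :=
  (fun x => Re (f x)) @ F --> Re l /\ (fun x => Im (f x)) @ F --> Im l.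

Lemma cvgC_of_cvg (f : T -> C) (l : C) : f x @[x --> F] --> (l : C^o) -> cvgC f l.
Proof.
move=> cf; have h := (@cvgrPdist_lt C C^o T F FF f l).1 cf.
have key (e : R) : 0 < e -> \forall x \near F, `|Re (l - f x)| < e /\ `|Im (l - f x)| < e.
  move=> e0; have ec : 0 < e%:C by rewrite ltcR.
  by apply: filterS (h _ ec) => x; exact: normc_lt_Re_Im.
split; apply/cvgrPdist_lt => e /key; apply: filterS => x; rewrite !raddfB /=.
  by case.
by case.
Qed.

Lemma cvgC_cst (l : C) : cvgC (fun=> l) l.
Proof. by split; exact: cvg_cst. Qed.

Lemma cvgC_D (f g : T -> C) k l : cvgC f k -> cvgC g l ->
  cvgC (fun x => f x + g x) (k + l).
Proof.
move=> [f1 f2] [g1 g2]; split.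
  by under eq_fun do rewrite raddfD /=; rewrite raddfD; exact: cvgD.
by under eq_fun do rewrite raddfD /=; rewrite raddfD; exact: cvgD.
Qed.

Lemma ReM (z w : C) : Re (z * w) = Re z * Re w - Im z * Im w.
Proof. by case: z w => [a b] [c d]. Qed.

Lemma ImM (z w : C) : Im (z * w) = Re z * Im w + Im z * Re w.
Proof. by case: z w => [a b] [c d]. Qed.

Lemma cvgC_M (f g : T -> C) k l : cvgC f k -> cvgC g l ->
  cvgC (fun x => f x * g x) (k * l).
Proof.
move=> [f1 f2] [g1 g2]; split.
  by under eq_fun do rewrite ReM; rewrite ReM; apply: cvgB; apply: cvgM.
by under eq_fun do rewrite ImM; rewrite ImM; apply: cvgD; apply: cvgM.
Qed.

Lemma cvgC_det n (A : T -> 'M[C]_n) (A0 : 'M[C]_n) : (forall i j, cvgC (fun x => A x i j) (A0 i j)) ->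
  cvgC (fun x => \det (A x)) (\det A0).
Proof.
move=> cA; rewrite /determinant.
have sum_cvg (I : Type) (r : seq I) (f : I -> T -> C) (l : I -> C) :
    (forall i, cvgC (f i) (l i)) ->
    cvgC (fun x => \sum_(i <- r) f i x) (\sum_(i <- r) l i).
  move=> h; elim: r => [|i r IH].
    by under eq_fun do rewrite big_nil; rewrite big_nil; exact: cvgC_cst.
  by under eq_fun do rewrite big_cons; rewrite big_cons; exact: cvgC_D.
have prod_cvg (I : Type) (r : seq I) (f : I -> T -> C) (l : I -> C) :
    (forall i, cvgC (f i) (l i)) ->
    cvgC (fun x => \prod_(i <- r) f i x) (\prod_(i <- r) l i).
  move=> h; elim: r => [|i r IH].
    by under eq_fun do rewrite big_nil; rewrite big_nil; exact: cvgC_cst.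
  by under eq_fun do rewrite big_cons; rewrite big_cons; exact: cvgC_M.
apply: (sum_cvg _ _ (fun (s : {perm 'I_n}) x => (-1) ^+ s * \prod_i A x i (s i))) => s.
by apply: cvgC_M; [exact: cvgC_cst|apply: prod_cvg => i; exact: cA].
Qed.

End Filter.

Lemma axis_near (P : C -> Prop) (t0 : R) :
  (\forall l \near ((0 +i* t0) : C^o), P l) -> \forall t \near t0, P (0 +i* t).
Proof.
move=> /nbhs_normP[e /= e0 He].
(* The radius is an element of [R[i]], and a positive element there is a positive real number. *)
have [im0 r0] : Im e = 0 /\ 0 < Re e.
  by move: e0; rewrite ltcE /= => /andP[/eqP im re].
have ee : e = (Re e)%:C by case: e im0 {r0 e0 He} => a b /= ->.
have : \forall t \near t0, `|t0 - t| < Re e by exists (Re e).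
apply: filterS => t ht; apply: He => /=; rewrite ee.
have -> : (0 +i* t0 - 0 +i* t) = 0 +i* (t0 - t) :> C by simpc.
by rewrite normc_def /= expr0n add0r sqrtr_sqr ltcR.
Qed.

End ComplexLimits.

(** * Jost solutions and the Evans function *)

Section JostFrames.
Context {R : realType} (n : nat).
Local Notation C := R[i].
Local Notation rc := (real_complex R).
Implicit Types (q : R -> 'M[R]_n) (nu : 'I_n -> R).

Lemma exp_weight_bounded (f : 'I_n -> 'I_n -> R -> R) (l : 'I_n -> 'I_n -> R) nu :
  (forall j, 0 <= nu j) ->
  (forall k j, expR (nu j * x) * f k j x @[x --> +oo] --> l k j) ->
  exists M x0, forall x k j, x0 <= x -> `|f k j x| <= M.
Proof.
move=> nu0 H.
have /choice[x0 Hx0] : forall p : 'I_n * 'I_n, exists x0 : R,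
    forall x, x0 <= x -> `|f p.1 p.2 x| <= `|l p.1 p.2| + 1.
  move=> [k j] /=; have /cvgrPdist_lt /(_ 1 ltr01) [A [_ HA]] := H k j.
  exists (Num.max (A + 1) 0) => x; rewrite ge_max => /andP[xA x0].
  have Ax : A < x by lra.
  have h := HA x Ax; rewrite /= in h.
  have e1 : 1 <= expR (nu j * x) by rewrite -[leLHS]expR0 ler_expR mulr_ge0.
  apply: (@le_trans _ _ `|expR (nu j * x) * f k j x|).
    by rewrite normrM (ger0_norm (expR_ge0 _)) ler_peMl.
  have := ler_distD (l k j) 0 (expR (nu j * x) * f k j x).
  by rewrite !sub0r !normrN; lra.
exists (\sum_p (`|l p.1 p.2| + 1)), (\sum_p `|x0 p|) => x k j xx.
apply: le_trans (Hx0 (k, j) x _) _.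
  apply: le_trans xx; apply: le_trans (ler_norm _) _.
  by rewrite (bigD1 (k, j)) //= lerDl sumr_ge0.
by rewrite (bigD1 (k, j)) //= lerDl sumr_ge0 // => p _; rewrite addr_ge0.
Qed.

(** Asymptotics of the first block of Jost columns with real exponents: [e = 1] for their real parts
    and [e = 0] for their imaginary parts, as the normalising vector is real. *)
Definition exp_limit (A : R -> 'M[R]_(n + n, n)) nu (e : R) :=
  forall k j, expR (nu j * x) * usubmx (A x) k j @[x --> +oo] --> e * (k == j)%:R.

(* Among the columns with a nonzero coefficient take one of slowest decay: after
   rescaling, only its own coefficient survives in the limit. *)
Lemma exp_limit_free (A B : R -> 'M[R]_(n + n, n)) nu (a b : 'cV[R]_n) :
  exp_limit A nu 1 -> exp_limit B nu 0 ->
  (forall x, usubmx (A x) *m a - usubmx (B x) *m b = 0) ->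
  (forall x, usubmx (A x) *m b + usubmx (B x) *m a = 0) -> a = 0 /\ b = 0.
Proof.
move=> lA lB h1 h2.
have [[j1 j1P]|none] := pselect (exists j, (a j 0 != 0) || (b j 0 != 0)); last first.
  split; apply/matrixP => i j; rewrite ord1 [RHS]mxE; apply/eqP/negPn/negP => ne;
    apply: none; exists i; by rewrite ne ?orbT.
exfalso.
have [j0 j0P jmin] := arg_minP nu (P := fun j => (a j 0 != 0) || (b j 0 != 0)) j1P.
pose w j (x : R) := expR ((nu j0 - nu j) * x).
have weight (f : R -> 'M[R]_(n + n, n)) (e : R) (c : 'cV[R]_n) : exp_limit f nu e ->
    (forall j, c j 0 != 0 -> nu j0 <= nu j) ->
    expR (nu j0 * x) * (usubmx (f x) *m c) j0 0 @[x --> +oo] --> e * c j0 0.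
  move=> lf cmin.
  have -> : (fun x => expR (nu j0 * x) * (usubmx (f x) *m c) j0 0) =
      (fun x => \sum_j w j x * (expR (nu j * x) * usubmx (f x) j0 j) * c j 0).
    apply/funext => x; rewrite mxE mulr_sumr; apply: eq_bigr => j _.
    rewrite !mulrA; congr (_ * _ * _); rewrite /w -expRD; congr expR; ring.
  have -> : e * c j0 0 = \sum_j (e * (j0 == j)%:R * c j 0).
    rewrite (bigD1 j0) //= eqxx mulr1 big1 ?addr0 // => j jj.
    by rewrite eq_sym (negPf jj) mulr0 mul0r.
  apply: (cvgr_sum _ (f := fun j x => w j x * (expR (nu j * x) * usubmx (f x) j0 j) * c j 0)
    (l := fun j => e * (j0 == j)%:R * c j 0)) => j.
  (* Columns with zero coefficient are dropped first, since their weight [w j] may grow. For the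
     others [nu j0 <= nu j], so the weight is at most 1 for [x >= 0]. *)
  have [->|cj] := eqVneq (c j 0) 0.
    by under eq_fun do rewrite mulr0; rewrite mulr0; exact: cvg_cst.
  apply: cvgMl; have [jj|jj] := eqVneq j0 j.
    subst j; rewrite /w subrr; under eq_fun do rewrite mul0r expR0 mul1r.
    by have := lf j0 j0; rewrite eqxx.
  rewrite mulr0; apply/cvgrPdist_lt => d d0.
  have /cvgrPdist_lt /(_ d d0) [M [Mr HM]] := lf j0 j.
  exists (Num.max M 0); split; first by rewrite num_real.
  move=> x; rewrite gt_max => /andP[Mx x0].
  have := HM x Mx; rewrite /= (negPf jj) mulr0 !sub0r !normrN => h.
  apply: le_lt_trans h; rewrite normrM ler_piMl // /w ger0_norm ?expR_ge0 //.
  by rewrite -[leRHS]expR0 ler_expR mulr_le0_ge0 ?(ltW x0) // subr_le0 cmin.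
have mina j : a j 0 != 0 -> nu j0 <= nu j by move=> ne; apply: jmin; rewrite ne.
have minb j : b j 0 != 0 -> nu j0 <= nu j by move=> ne; apply: jmin; rewrite ne orbT.
have zero (l : R) (f g : R -> 'cV[R]_n) : (forall x, f x + g x = 0) ->
    expR (nu j0 * x) * f x j0 0 @[x --> +oo] --> l ->
    expR (nu j0 * x) * g x j0 0 @[x --> +oo] --> (0 : R) -> l = 0.
  move=> fg cf cg.
  have s0 : (fun x => expR (nu j0 * x) * f x j0 0 + expR (nu j0 * x) * g x j0 0) = (fun=> 0).
    apply/funext => x; rewrite -mulrDr; have := congr1 (fun M : 'cV[R]_n => M j0 0) (fg x).
    by rewrite !mxE => ->; rewrite mulr0.
  have c1 : (fun x => expR (nu j0 * x) * f x j0 0 + expR (nu j0 * x) * g x j0 0)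
      @ +oo --> l by rewrite -[l]addr0; exact: cvgD.
  have c2 : (fun=> 0 : R) @ (+oo : set_system R) --> (0 : R) by exact: cvg_cst.
  rewrite s0 in c1; exact: (cvg_unique (@Rhausdorff R) c1 c2).
have a0 : a j0 0 = 0.
  apply: (zero _ (fun x => usubmx (A x) *m a) (fun x => - (usubmx (B x) *m b)) h1).
    by have := weight A 1 a lA mina; rewrite mul1r.
  have := weight B 0 b lB minb; rewrite mul0r => /cvgN; rewrite oppr0.
  by apply: cvg_trans; apply: near_eq_cvg; apply: nearW => x /=; rewrite [in RHS]mxE mulrN.
have b0 : b j0 0 = 0.
  apply: (zero _ (fun x => usubmx (A x) *m b) (fun x => usubmx (B x) *m a) h2).
    by have := weight A 1 b lA minb; rewrite mul1r.
  by have := weight B 0 a lB mina; rewrite mul0r.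
by move: j0P; rewrite a0 b0 eqxx.
Qed.

(** Injectivity of the complex matrix [H1 + i H2] on vectors [a + i b], written out in real and
    imaginary parts. *)
Definition jointly_free (H1 H2 : 'M[R]_n) := forall a b : 'cV[R]_n,
  H1 *m a - H2 *m b = 0 -> H1 *m b + H2 *m a = 0 -> a = 0 /\ b = 0.

(** The exponents are nonnegative, so both parts are bounded at infinity and are multiples of the
    stable frame. A linear relation between their first blocks at [X] then propagates to every [x],
    where [exp_limit_free] excludes it. *)
Lemma right_jost q X c K (A B : R -> 'M[R]_(n + n, n)) nu :
  0 <= X -> 0 <= c -> well_behaved q X c K -> (forall j, 0 <= nu j) ->
  solution (second_order q) A -> solution (second_order q) B ->
  exp_limit A nu 1 -> exp_limit B nu 0 ->
  [/\ A 0 = right_frame q X *m usubmx (A X), B 0 = right_frame q X *m usubmx (B X) &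
      jointly_free (usubmx (A X)) (usubmx (B X))].
Proof.
move=> X0 c0 wq nu0 hA hB lA lB; have aq := right_half_admissible X0 c0 wq.
have [MA [xA HA]] := exp_weight_bounded nu0 lA.
have [MB [xB HB]] := exp_weight_bounded nu0 lB.
split; [exact: (right_frameP X0 c0 wq hA HA)|exact: (right_frameP X0 c0 wq hB HB)|].
have AE x : A x = frame (right_half q X) (stable_mx (right_half q X)) (x - X) *m usubmx (A X).
  have := stable_unique (Y := fun x => A (X + x)) (B := MA) (x0 := xA) aq
    (solution_shift_arg X hA).
  move=> /(_ _ (x - X)); rewrite addr0 addrC subrK; apply.
  by move=> y i j xy; apply: HA; rewrite ler_wpDl.
have BE x : B x = frame (right_half q X) (stable_mx (right_half q X)) (x - X) *m usubmx (B X).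
  have := stable_unique (Y := fun x => B (X + x)) (B := MB) (x0 := xB) aq
    (solution_shift_arg X hB).
  move=> /(_ _ (x - X)); rewrite addr0 addrC subrK; apply.
  by move=> y i j xy; apply: HB; rewrite ler_wpDl.
have top x (Z : 'M[R]_n) : usubmx (frame (right_half q X) (stable_mx (right_half q X)) x *m Z)
    = usubmx (frame (right_half q X) (stable_mx (right_half q X)) x) *m Z.
  by rewrite mul_usub_mx.
move=> a b h1 h2; apply: (exp_limit_free lA lB) => x.
  by rewrite AE BE !top -!mulmxA -mulmxBr h1 mulmx0.
by rewrite AE BE !top -!mulmxA -mulmxDr h2 mulmx0.
Qed.

Lemma left_jost q X c K (A B : R -> 'M[R]_(n + n, n)) nu :
  0 <= X -> 0 <= c -> well_behaved q X c K -> (forall j, 0 <= nu j) ->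
  solution (second_order q) A -> solution (second_order q) B ->
  exp_limit (fun x => A (- x)) nu 1 -> exp_limit (fun x => B (- x)) nu 0 ->
  [/\ A 0 = left_frame q X *m usubmx (A (- X)),
      B 0 = left_frame q X *m usubmx (B (- X)) &
      jointly_free (usubmx (A (- X))) (usubmx (B (- X)))].
Proof.
move=> X0 c0 wq nu0 hA hB lA lB.
have lim (Y : R -> 'M[R]_(n + n, n)) e : exp_limit Y nu e -> exp_limit (fun x => flip (Y x)) nu e.
  by move=> h k j; under eq_fun do rewrite usubmx_flip; exact: h.
have [h1 h2 h3] := right_jost X0 c0 (well_behaved_opp wq) nu0 (flip_solution hA)
  (flip_solution hB) (lim _ _ lA) (lim _ _ lB).
rewrite !usubmx_flip !oppr0 in h1 h2 h3; split => //.
  by rewrite -[A 0]flipK h1 flip_mulmx.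
by rewrite -[B 0]flipK h2 flip_mulmx.
Qed.

Definition complexify m p (A B : 'M[R]_(m, p)) : 'M[C]_(m, p) :=
  \matrix_(i, j) (A i j +i* B i j).

Lemma complexify_mul m p k (M : 'M[R]_(m, p)) (A B : 'M[R]_(p, k)) :
  complexify (M *m A) (M *m B) = map_mx rc M *m complexify A B.
Proof.
apply/matrixP => i j; rewrite !mxE.
apply/eqP; rewrite eq_complex /= raddf_sum raddf_sum /=; apply/andP; split; apply/eqP;
  apply: eq_bigr => l _; rewrite !mxE /=.
  by rewrite mul0r subr0.
by rewrite mul0r addr0.
Qed.

Lemma complexify_unit (H1 H2 : 'M[R]_n) : jointly_free H1 H2 ->
  complexify H1 H2 \in unitmx.
Proof.
move=> free; rewrite unitmxE unitfE -det_tr; apply/det0P => -[v v0 vH].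
pose a : 'cV[R]_n := \col_i complex.Re (v 0 i).
pose b : 'cV[R]_n := \col_i complex.Im (v 0 i).
have e i : \sum_j v 0 j * (H1 i j +i* H2 i j) = 0.
  have := congr1 (fun M : 'rV[C]_n => M 0 i) vH; rewrite !mxE => h.
  by rewrite -[RHS]h; apply: eq_bigr => j _; rewrite !mxE.
have [a0 b0] : a = 0 /\ b = 0.
  apply: free; apply/matrixP => i j; rewrite ord1.
    have := congr1 (@complex.Re R) (e i); rewrite raddf_sum /= => h.
    rewrite !mxE -[RHS]h -sumrB; apply: eq_bigr => l _; rewrite !mxE ReM /=; ring.
  have := congr1 (@complex.Im R) (e i); rewrite raddf_sum /= => h.
  rewrite !mxE -[RHS]h -big_split /=; apply: eq_bigr => l _; rewrite !mxE ImM /=; ring.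
move/negP: v0; apply; apply/eqP/matrixP => i j; rewrite ord1 [RHS]mxE.
apply/eqP; rewrite eq_complex /=.
have := congr1 (fun M : 'cV[R]_n => M j 0) a0; rewrite !mxE => ->.
by have := congr1 (fun M : 'cV[R]_n => M j 0) b0; rewrite !mxE => ->; rewrite !eqxx.
Qed.

End JostFrames.

Section EvansFactor.
Context {R : realType}.
Local Notation C := R[i].
Local Notation rc := (real_complex R).
Local Notation Re := complex.Re.
Local Notation Im := complex.Im.

(** A real square forces [cos t * sin t = 0], and [cos t = 0] would make it negative. So
    [sin t = 0], and in a window inside [(- pi, pi)] only [t = 0] remains, which rules out the
    negative root. *)
Lemma sqrt_arg_pos (a b z : R) (n : C) : - pi <= a -> b <= pi -> 0 < z ->
  sqrt_arg a b z%:C n -> exists2 r, 0 < r & n = r%:C.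
Proof.
move=> api bpi z0 [n2 [r [t [r0 /andP[at_ tb] nE]]]].
have [im re] : r ^+ 2 * (2 * (cos t * sin t)) = 0 /\
    r ^+ 2 * (cos t ^+ 2 - sin t ^+ 2) = z.
  have reE := congr1 (@complex.Re R) n2; have imE := congr1 (@complex.Im R) n2.
  move: reE imE; rewrite nE expr2 !(ReM, ImM) /= => reE imE.
  by split; [rewrite -[RHS]imE|rewrite -[RHS]reE]; ring.
have s0 : sin t = 0.
  move/eqP: im; rewrite mulf_eq0 sqrf_eq0 (gt_eqF r0) /= mulf_eq0 pnatr_eq0 /=.
  rewrite mulf_eq0 => /orP[/eqP c0|/eqP//]; move: z0; rewrite -re c0 expr0n sub0r.
  by rewrite pmulr_rgt0 ?exprn_gt0 // oppr_gt0 ltNge sqr_ge0.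
have t0 : t = 0.
  apply/eqP; rewrite eq_le; apply/andP; split; rewrite leNgt; apply/negP => tt.
    have := @sin_gt0_pi R t; rewrite tt (lt_le_trans tb bpi) s0 ltxx.
    by move=> /(_ isT).
  have := @sin_gt0_pi R (- t); rewrite oppr_gt0 tt sinN s0 oppr0 ltxx => H.
  suff : false by []; apply: H; rewrite /= ltrNl; exact: le_lt_trans api at_.
by exists r => //; rewrite nE t0 cos0 sin0; simpc.
Qed.

Lemma cexp_real (x : R) : cexp x%:C = (expR x)%:C.
Proof. by rewrite /cexp /= cos0 sin0; simpc. Qed.

Variables (F : R -> R -> R -> R) (omega s m : R) (U V : R -> R).

Lemma axis_system_parts t (Y : 'I_4 -> R -> 'cV[C]_8) :
  (forall j, solves_system F omega s m U V (0 +i* t) (Y j)) ->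
  solution (second_order (axis_mx F omega s m U V t))
    (fun x => \matrix_(i < 4 + 4, j < 4) Re (Y j x i 0)) /\
  solution (second_order (axis_mx F omega s m U V t))
    (fun x => \matrix_(i < 4 + 4, j < 4) Im (Y j x i 0)).
Proof.
move=> H; set A := second_order _.
have E (x : R) (j : 'I_4) (i : 'I_8) :
    (system_matrix F omega s m U V (0 +i* t) x *m Y j x) i 0 =
    \sum_(k < 8) (A x i k)%:C * Y j x k 0.
  by rewrite system_matrix_axis mxE; apply: eq_bigr => k _; rewrite mxE.
split=> x i j; have [h1 h2] := H j x i.
  under eq_fun do rewrite mxE.
  have -> : (A x *m \matrix_(i < 4 + 4, j < 4) Re (Y j x i 0)) i j =
      Re ((system_matrix F omega s m U V (0 +i* t) x *m Y j x) i 0).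
    rewrite E raddf_sum mxE; apply: eq_bigr => k _.
    by rewrite /= ReM /= mul0r subr0 mxE.
  exact: h1.
under eq_fun do rewrite mxE.
have -> : (A x *m \matrix_(i < 4 + 4, j < 4) Im (Y j x i 0)) i j =
    Im ((system_matrix F omega s m U V (0 +i* t) x *m Y j x) i 0).
  rewrite E raddf_sum mxE; apply: eq_bigr => k _.
  by rewrite /= ImM /= mul0r addr0 mxE.
exact: h2.
Qed.

Definition top_block (Y : 'I_4 -> C -> R -> 'cV[C]_8) (l : C) (x : R) : 'M[C]_4 :=
  \matrix_(k < 4, j < 4) Y j l x (lshift 4 k) 0.

Lemma top_blockE Y l x : top_block Y l x =
  complexify (usubmx (\matrix_(i < 4 + 4, j < 4) Re (Y j l x i 0)))
             (usubmx (\matrix_(i < 4 + 4, j < 4) Im (Y j l x i 0))).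
Proof. by apply/matrixP => k j; rewrite !mxE; case: (Y j l x _ _). Qed.

Lemma full_blockE (Y : 'I_4 -> C -> R -> 'cV[C]_8) l x : \matrix_(i < 8, j < 4) Y j l x i 0 =
  complexify (\matrix_(i < 4 + 4, j < 4) Re (Y j l x i 0))
             (\matrix_(i < 4 + 4, j < 4) Im (Y j l x i 0)).
Proof. by apply/matrixP => k j; rewrite !mxE; case: (Y j l x _ _). Qed.

Lemma gap_segmentE (l : C) : gap_segment omega s l ->
  l = 0 +i* (Im l) /\ `|Im l| < Num.min omega s.
Proof. by case: l => a b [/= ->]. Qed.

(** At [l = i t] the radicands are [omega] and [s], each plus or minus [t], hence positive in the
    gap. *)
Lemma Jost_exponents_pos (Omega : set C) nu t : Jost_exponents omega s Omega nu ->
  Omega (0 +i* t) -> `|t| < Num.min omega s ->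
  exists2 r : 'I_4 -> R, forall j, 0 < r j & forall j, nu j (0 +i* t) = (r j)%:C.
Proof.
move=> H Ot tm; have [h0 h1 h2 h3] := H _ Ot.
have [mo ms] : Num.min omega s <= omega /\ Num.min omega s <= s.
  by rewrite !ge_min !lexx orbT.
have [tl tr] : t < Num.min omega s /\ - t < Num.min omega s.
  by move: tm; rewrite ltr_norml => /andP[]; lra.
have pi0 := @pi_gt0 R.
have eP (z : R) : z%:C - 'i%C * (0 +i* t) = (z + t)%:C.
  by apply/eqP; rewrite eq_complex /=; apply/andP; split; apply/eqP; ring.
have eN (z : R) : z%:C + 'i%C * (0 +i* t) = (z - t)%:C.
  by apply/eqP; rewrite eq_complex /=; apply/andP; split; apply/eqP; ring.
rewrite !eP !eN in h0 h1 h2 h3.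
have pos j : exists r, 0 < r /\ nu j (0 +i* t) = r%:C.
  have [r0 p0 e0] : exists2 r, 0 < r & nu 0 (0 +i* t) = r%:C.
    by apply: sqrt_arg_pos h0; lra.
  have [r1 p1 e1] : exists2 r, 0 < r & nu 1 (0 +i* t) = r%:C.
    by apply: sqrt_arg_pos h1; lra.
  have [r2 p2 e2] : exists2 r, 0 < r & nu 2 (0 +i* t) = r%:C.
    by apply: sqrt_arg_pos h2; lra.
  have [r3 p3 e3] : exists2 r, 0 < r & nu 3 (0 +i* t) = r%:C.
    by apply: sqrt_arg_pos h3; lra.
  case: j => -[|[|[|[|//]]]] jlt.
  - by exists r0; rewrite -e0; split => //; congr nu; exact: val_inj.
  - by exists r1; rewrite -e1; split => //; congr nu; exact: val_inj.
  - by exists r2; rewrite -e2; split => //; congr nu; exact: val_inj.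
  - by exists r3; rewrite -e3; split => //; congr nu; exact: val_inj.
have /choice[r Hr] := pos.
by exists r => j; have [] := Hr j.
Qed.

Lemma cvec_top (j k : 'I_4) (c : C) : cvec j c (lshift 4 k) 0 = ((k == j)%:R : R)%:C.
Proof.
rewrite /cvec (@col_mxEu _ 4 4 1) mxE eqxx andbT.
by case: (k == j).
Qed.

(** At 0 each Jost matrix is a frame times its own first block at [- X] or [X], so the Evans matrix
    is the matching matrix times a block diagonal one. The diagonal blocks are invertible because
    the Jost columns are independent. *)
Lemma Evans_factor (Omega : set C) nu Ym Yp (X c K t : R) :
  0 <= X -> 0 <= c -> well_behaved (axis_mx F omega s m U V t) X c K ->
  Jost_exponents omega s Omega nu ->
  Jost_solutions F omega s m U V Omega nu Ym Yp ->
  Omega (0 +i* t) -> `|t| < Num.min omega s ->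
  Evans Ym Yp (0 +i* t) = (\det (matching_mx (axis_mx F omega s m U V t) X))%:C *
    (\det (top_block Ym (0 +i* t) (- X)) * \det (top_block Yp (0 +i* t) X)) /\
  \det (top_block Ym (0 +i* t) (- X)) * \det (top_block Yp (0 +i* t) X) != 0.
Proof.
move=> X0 c0 wq Hnu HJ Ot tm; set l := 0 +i* t.
have [r r0 rE] := Jost_exponents_pos Hnu Ot tm.
have rge0 j : 0 <= r j := ltW (r0 j).
have [sm sp] : (forall j, solves_system F omega s m U V l (Ym j l)) /\
    (forall j, solves_system F omega s m U V l (Yp j l)).
  by split=> j; have [h _ _ _] := HJ j; have [] := h l Ot.
have [hAp hBp] := axis_system_parts sp.
have [hAm hBm] := axis_system_parts sm.
have scale (a : R) (z : C) : Re (a%:C * z) = a * Re z /\ Im (a%:C * z) = a * Im z.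
  by rewrite ReM ImM /= !mul0r subr0 addr0.
have limp (k j : 'I_4) : cvgC (F := +oo) (fun x => (expR (r j * x))%:C * Yp j l x (lshift 4 k) 0)
    ((k == j)%:R : R)%:C.
  rewrite -(cvec_top j k (- nu j l)); apply: cvgC_of_cvg.
  have [_ _ h _] := HJ j; have := h l (lshift 4 k) Ot.
  apply: cvg_trans; apply: near_eq_cvg; apply: nearW => x.
  by rewrite rE -rmorphM /= cexp_real.
have limm (k j : 'I_4) : cvgC (F := +oo) (fun x => (expR (r j * x))%:C * Ym j l (- x) (lshift 4 k) 0)
    ((k == j)%:R : R)%:C.
  rewrite -(cvec_top j k (nu j l)).
  have [_ h _ _] := HJ j; have [hr hi] := cvgC_of_cvg (h l (lshift 4 k) Ot).
  have eqm : (fun x => (expR (r j * x))%:C * Ym j l (- x) (lshift 4 k) 0) =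
      (fun x => cexp (- nu j l * x%:C) * Ym j l x (lshift 4 k) 0) \o -%R.
    by apply/funext => x /=; rewrite rE -rmorphN -rmorphM /= cexp_real mulrNN.
  rewrite eqm; split; first exact: (cvgNy_compNP _ _).1 hr.
  exact: (cvgNy_compNP _ _).1 hi.
have [lAp lBp] : exp_limit (fun x => \matrix_(i < 4 + 4, j < 4) Re (Yp j l x i 0)) r 1 /\
    exp_limit (fun x => \matrix_(i < 4 + 4, j < 4) Im (Yp j l x i 0)) r 0.
  split=> k j; have [h1 h2] := limp k j; under eq_fun do rewrite !mxE.
    rewrite mul1r; move: h1; under eq_fun do rewrite (scale _ _).1; exact.
  rewrite mul0r; move: h2; under eq_fun do rewrite (scale _ _).2; exact.
have [lAm lBm] : exp_limit (fun x => \matrix_(i < 4 + 4, j < 4) Re (Ym j l (- x) i 0)) r 1 /\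
    exp_limit (fun x => \matrix_(i < 4 + 4, j < 4) Im (Ym j l (- x) i 0)) r 0.
  split=> k j; have [h1 h2] := limm k j; under eq_fun do rewrite !mxE.
    rewrite mul1r; move: h1; under eq_fun do rewrite (scale _ _).1; exact.
  rewrite mul0r; move: h2; under eq_fun do rewrite (scale _ _).2; exact.
have [p1 p2 /complexify_unit p3] := right_jost X0 c0 wq rge0 hAp hBp lAp lBp.
have [m1 m2 /complexify_unit m3] := left_jost X0 c0 wq rge0 hAm hBm lAm lBm.
rewrite -top_blockE in p3; rewrite -top_blockE in m3.
split; last first.
  by rewrite mulf_neq0 // -unitfE -unitmxE.
rewrite /Evans !full_blockE p1 p2 m1 m2 !complexify_mul -!top_blockE.
set L := left_frame _ _; set Q := right_frame _ _.
transitivity (\det (map_mx rc (row_mx L Q) *m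
   (block_mx (top_block Ym l (- X)) 0 0 (top_block Yp l X)))).
  by rewrite map_row_mx mul_row_block !mulmx0 addr0 add0r.
by rewrite det_mulmx det_map_mx det_ublock.
Qed.

End EvansFactor.

(** * From a simple zero to a sign change *)

Section SignChange.
Context {R : realType}.
Local Notation C := R[i].
Local Notation Re := complex.Re.
Local Notation Im := complex.Im.

Lemma axis_dnbhs (P : C -> Prop) (t0 : R) :
  (\forall h \near (0 : C^o)^', P h) -> \forall t \near t0^', P (0 +i* (t - t0)).
Proof.
move=> /nbhs_normP[e /= e0 He].
have [im0 r0] : Im e = 0 /\ 0 < Re e.
  by move: e0; rewrite ltcE /= => /andP[/eqP im re].
have ee : e = (Re e)%:C by case: e im0 {r0 e0 He} => a b /= ->.
have : \forall t \near t0, `|t0 - t| < Re e by exists (Re e).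
apply: filterS => t ht tt; apply: He => /=.
  suff : `|(0 : C) - (0 +i* (t - t0))| < (Re e)%:C by rewrite -ee.
  by rewrite sub0r normrN normc_def /= expr0n add0r sqrtr_sqr ltcR distrC.
by rewrite eq_complex /= eqxx /= subr_eq0.
Qed.

(* D / (t - t0) = i e / h is real, so its nonzero limit i w / h0 is real. *)
Lemma sign_change (D : R -> R) (h e : R -> C) (h0 w : C) (t0 : R) :
  cvgC (F := t0^') h h0 -> cvgC (F := t0^') e w -> h0 != 0 -> w != 0 ->
  (\forall t \near t0^', (D t)%:C * h t = (0 +i* (t - t0)) * e t) ->
  exists2 rho, rho != 0 & \forall t \near t0^', 0 < rho * (D t / (t - t0)).
Proof.
move=> [hr hi] [er ei] h0n wn Dh.
(* [sig] and [- rho] are the real and imaginary parts of [e] times the conjugate of [h]. By the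
   relation assumed this product is [- i D / (t - t0)] times the squared modulus of [h], so [sig]
   vanishes and [rho] carries the sign of the quotient. *)
pose rho t := Re (e t) * Im (h t) - Im (e t) * Re (h t).
pose sig t := Re (e t) * Re (h t) + Im (e t) * Im (h t).
pose rho0 := Re w * Im h0 - Im w * Re h0.
pose sig0 := Re w * Re h0 + Im w * Im h0.
have crho : rho @ t0^' --> rho0 by apply: cvgB; apply: cvgM.
have csig : sig @ t0^' --> sig0 by apply: cvgD; apply: cvgM.
have ne : \forall t \near t0^', t != t0 by exact: nbhs_dnbhs_neq.
have parts : \forall t \near t0^', sig t = 0 /\
    rho t = D t / (t - t0) * (Re (h t) ^+ 2 + Im (h t) ^+ 2).
  apply: filterS2 Dh ne => t Et tt.
  have u0 : t - t0 != 0 by rewrite subr_eq0.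
  have r1 := congr1 (@complex.Re R) Et; have i1 := congr1 (@complex.Im R) Et.
  move: r1 i1; rewrite !(ReM, ImM) /= !mul0r subr0 addr0 !add0r => r1 i1.
  have eR : Re (e t) = D t / (t - t0) * Im (h t).
    by apply: (mulfI u0); rewrite -i1; field.
  have eI : Im (e t) = - (D t / (t - t0) * Re (h t)).
    have e1 : (t - t0) * Im (e t) = - (D t * Re (h t)) by rewrite r1 opprK.
    by apply: (mulfI u0); rewrite e1; field.
  by rewrite /sig /rho eR eI; split; ring.
have s0 : sig0 = 0.
  have c0 : sig @ t0^' --> (0 : R).
    have cz : (fun=> 0 : R) @ t0^' --> (0 : R) by exact: cvg_cst.
    apply: cvg_trans cz; apply: near_eq_cvg.
    by apply: filterS parts => t [-> _].
  exact: (cvg_unique (@Rhausdorff R) csig c0).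
have sq (z : C) : z != 0 -> 0 < Re z ^+ 2 + Im z ^+ 2.
  move=> zn; rewrite lt_neqAle addr_ge0 ?sqr_ge0 // andbT eq_sym.
  by rewrite paddr_eq0 ?sqr_ge0 // !sqrf_eq0; move: zn; rewrite eq_complex.
(* Lagrange's identity: the squares of [rho0] and [sig0] add up to the product of the squared moduli
   of [w] and [h0]. *)
have rn : rho0 != 0.
  apply/eqP => r0.
  have : (Re w ^+ 2 + Im w ^+ 2) * (Re h0 ^+ 2 + Im h0 ^+ 2) = rho0 ^+ 2 + sig0 ^+ 2.
    by rewrite /rho0 /sig0; ring.
  rewrite r0 s0 expr0n addr0 => /eqP.
  by rewrite mulf_eq0 !gt_eqF ?sq.
exists rho0 => //.
have r20 : 0 < rho0 * rho0 by rewrite -expr2 lt_neqAle sqr_ge0 andbT eq_sym sqrf_eq0.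
have : \forall t \near t0^', 0 < rho0 * rho t.
  have cc : (fun t => rho0 * rho t) @ t0^' --> rho0 * rho0 by exact: cvgMr.
  exact: (cvgr_gt _ cc _ r20).
apply: filterS2 parts => t [_ ->]; rewrite mulrA => hpos.
rewrite ltNge; apply/negP => neg; move: hpos; rewrite ltNge => /negP; apply.
by rewrite mulr_le0_ge0 // addr_ge0 ?sqr_ge0.
Qed.

End SignChange.

Section EvansSign.
Context {R : realType}.
Local Notation C := R[i].

Lemma IVT_sign (f : R -> R) (a b : R) : a <= b ->
  {within `[a, b], continuous f} -> f a < 0 -> 0 < f b ->
  exists2 t, a <= t <= b & f t = 0.
Proof.
move=> ab cf fa fb; have [|t] := IVT (v := 0) ab cf.
  by rewrite ge_min le_max (ltW fa) (ltW fb) orbT.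
by rewrite in_itv /=; exists t.
Qed.

(* The Evans function is the real matching determinant times a nonvanishing
   factor that is continuous in t. *)
Lemma matching_sign (F : R -> R -> R -> R) (omega s m : R) (U V : R -> R)
    (Omega : set C) nu Ym Yp (X c K r t0 : R) :
  0 <= X -> 0 <= c -> `|t0| < r -> r < Num.min omega s ->
  (forall t, `|t| <= r -> well_behaved (axis_mx F omega s m U V t) X c K) ->
  gap_segment omega s `<=` Omega ->
  Jost_exponents omega s Omega nu ->
  Jost_solutions F omega s m U V Omega nu Ym Yp ->
  simple_zero (Evans Ym Yp) (0 +i* t0) ->
  exists2 rho, rho != 0 & \forall t \near t0^',
    0 < rho * (\det (matching_mx (axis_mx F omega s m U V t) X) / (t - t0)).
Proof.
move=> X0 c0 t0r rm wb sub Hnu HJ [E0 dE E1].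
have inr : \forall t \near t0, `|t| < r.
  exact: (cvgr_lt _ (@norm_continuous R R t0) _ t0r).
have seg t : `|t| < r -> Omega (0 +i* t) /\ `|t| < Num.min omega s.
  by move=> tr; have tm := lt_trans tr rm; split=> //; apply: sub.
have factor (t : R) (tr : `|t| < r) := Evans_factor X0 c0 (wb t (ltW tr)) Hnu HJ
  (seg t tr).1 (seg t tr).2.
pose h t := \det (top_block Ym (0 +i* t) (- X)) * \det (top_block Yp (0 +i* t) X).
(* As the Evans function vanishes at [i t0], this is its difference quotient along the imaginary
   axis, whose limit is the complex derivative. *)
pose e t := (0 +i* (t - t0))^-1 * Evans Ym Yp (0 +i* t).
have hn : h t0 != 0 by have [] := factor t0 t0r.
have ch : cvgC (F := t0^') h (h t0).
  have [Om0 _] := seg t0 t0r.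
  have ana (f : C -> C) : analytic_on Omega f ->
      cvgC (F := t0^') (fun t => f (0 +i* t)) (f (0 +i* t0)).
    move=> af; have df := af _ Om0.
    have cf : {for (0 +i* t0 : C^o), continuous (f : C^o -> C^o)}.
      by apply: differentiable_continuous; exact/derivable1_diffP.
    apply: cvgC_of_cvg => P /cf nP.
    have := axis_near nP; exact: nbhs_dnbhs.
  apply: cvgC_M; apply: cvgC_det => i j; rewrite /top_block !mxE;
    under [X in cvgC X _]eq_fun do rewrite mxE.
    by apply: (ana (fun l => Ym j l (- X) (lshift 4 i) 0)); have [_ _ _ /(_ (- X) (lshift 4 i))[]] := HJ j.
  by apply: (ana (fun l => Yp j l X (lshift 4 i) 0)); have [_ _ _ /(_ X (lshift 4 i))[]] := HJ j.
have ce : cvgC (F := t0^') e (derive1 (Evans Ym Yp : C^o -> C^o) (0 +i* t0)).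
  apply: cvgC_of_cvg; rewrite derive1E => P nP.
  apply: filterS (axis_dnbhs t0 (dE P nP)) => t /=.
  rewrite E0 subr0 /e /GRing.scale /= mulr1.
  by have -> : (0 +i* (t - t0)) + (0 +i* t0) = 0 +i* t by simpc; rewrite subrK.
apply: (sign_change ch ce hn); first exact/eqP.
have ne : \forall t \near t0^', t != t0 by exact: nbhs_dnbhs_neq.
apply: filterS2 ne (nbhs_dnbhs inr) => t tt tr.
have [Et _] := factor t tr.
rewrite /e [RHS]mulrA mulfV ?mul1r -?Et //.
by rewrite eq_complex /= eqxx /= subr_eq0.
Qed.

End EvansSign.

Theorem proposition2p7 (R : realType) (omega s : R) (F : R -> R -> R -> R)
  (Ufam : R -> R -> R) (U0 V1 phi11 phi12 : R -> R)
  (sgn : bool) (Ue Ve : R -> R -> R)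
  (Omega : set R[i]) (nu : 'I_4 -> R[i] -> R[i])
  (Ym Yp : 'I_4 -> R[i] -> R -> 'cV[R[i]]_8) (lambda0 : R[i])
  (omega_gt0 : 0 < omega) (s_gt0 : 0 < s)
  (HF : nonlinearity F)
  (HU0 : fundamental F omega U0)
  (HUfam : Ufam omega = U0 /\
           \forall w \near omega, fundamental F w (Ufam w))
  (HV1 : V_mode F s U0 V1)
  (Hphi11 : [/\ U_variation F omega U0 phi11,
                phi11 0 = 1 & derive1 phi11 0 = 0])
  (Hphi12 : [/\ U_variation F omega U0 phi12,
                phi12 0 = 0 & derive1 phi12 0 = 1]) :
  let U2 := U2_term F U0 V1 phi11 phi12 in
  let a2 := a2_bar F U0 V1 in
  let b2 := b2_bar F U0 V1 U2 in
  let mbar := - b2 / a2 in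
  a2 <> 0 -> b2 <> 0 ->
  bifurcated_waves F omega s mbar U0 U2 V1 sgn Ue Ve ->
  derivable (fun w => sqr_norm2 (Ufam w)) omega 1 ->
  0 < derive1 (fun w => sqr_norm2 (Ufam w)) omega ->
  open (Omega : set R[i]^o) ->
  gap_segment omega s `<=` Omega ->
  Jost_exponents omega s Omega nu ->
  Jost_solutions F omega s 0 U0 (fun=> 0) Omega nu Ym Yp ->
  gap_segment omega s lambda0 ->
  simple_zero (Evans Ym Yp) lambda0 ->
  forall delta : R, 0 < delta ->
  \forall e \near (0 : R)^'+,
    exists l : R[i],
      [/\ is_eigenvalue F omega s (mbar * e ^+ 2) (Ue e) (Ve e) l,
          complex.Re l = 0 & `|l - lambda0| < delta%:C].
Proof.
move=> U2 a2 b2 mbar _ _ HB _ _ _ sub Hnu HJ seg0 Ezero delta delta0.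
have [dU0 _ [vU0 _] _ _] := HU0.
have cU0 := derivable2_continuous dU0.
have [_ _ _ [M HM] _] := HV1.
have [lE tm] := gap_segmentE seg0; set t0 := complex.Im lambda0 in lE tm.
(* The midpoint leaves room around [t0] for the bracketing interval and keeps the gap [min - r],
   hence the ellipticity constant, positive. *)
pose r := (`|t0| + Num.min omega s) / 2.
have t0r : `|t0| < r by rewrite /r; lra.
have rm : r < Num.min omega s by rewrite /r; lra.
have close := bifurcated_close cU0 vU0 HM HB.
have cUV : \forall e \near (0 : R)^'+, continuous (Ue e) /\ continuous (Ve e).
  by case: HB => + _; apply: filterS => e [dU dV _ _ _];
    split; exact: derivable2_continuous.
have [X [K [c [X0 c0 wb0 wbe uc]]]] :=
  axis_uniform (me := fun e => mbar * e ^+ 2) HF cU0 vU0 cUV close rm.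
rewrite lE in Ezero.
have [rho rhon Hrho] := matching_sign X0 (ltW c0) t0r rm wb0 sub Hnu HJ Ezero.
pose D0 t := \det (matching_mx (axis_mx F omega s 0 U0 (fun=> 0) t) X).
pose D e t := \det (matching_mx (axis_mx F omega s (mbar * e ^+ 2) (Ue e) (Ve e) t) X).
have /nbhs_ballP[d /= d0 Hd] := Hrho.
(* Three demands: the sign of the quotient is known up to distance [d], the eigenvalue must be
   within [delta], and the interval must stay inside [|t| < r]. *)
pose h := Num.min (Num.min (d / 2) (delta / 2)) ((r - `|t0|) / 2).
have h0 : 0 < h by rewrite !lt_min !divr_gt0 //= subr_gt0.
have [hd hdel hr] : [/\ h < d, h < delta & `|t0| + h < r].
  have h1 : h <= d / 2 by rewrite !ge_min lexx.
  have h2 : h <= delta / 2 by rewrite !ge_min lexx orbT.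
  have h3 : h <= (r - `|t0|) / 2 by rewrite !ge_min lexx !orbT.
  by split; lra.
have tr t : t0 - h <= t <= t0 + h -> `|t| < r.
  move=> /andP[ta tb]; have := ler_norm t0; have := ler_norm (- t0); rewrite normrN.
  by rewrite ltr_norml; lra.
have dist t : t0 - h <= t <= t0 + h -> `|t - t0| <= h by rewrite ler_norml; lra.
have ab : t0 - h <= t0 + h by lra.
have [l1 l2] : `|t0 - h| < r /\ `|t0 + h| < r by split; apply: tr; lra.
have s1 : rho * D0 (t0 - h) < 0.
  have : 0 < rho * (D0 (t0 - h) / (t0 - h - t0)).
    apply: Hd; last by rewrite /= -subr_eq0 addrAC subrr add0r oppr_eq0 gt_eqF.
    by rewrite /ball /= opprB addrCA subrr addr0 gtr0_norm.
  rewrite addrAC subrr add0r invrN !mulrN mulrA oppr_gt0.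
  by rewrite pmulr_llt0 ?invr_gt0.
have s2 : 0 < rho * D0 (t0 + h).
  have : 0 < rho * (D0 (t0 + h) / (t0 + h - t0)).
    apply: Hd; last by rewrite /= -subr_eq0 addrAC subrr add0r gt_eqF.
    by rewrite /ball /= opprD addrA subrr add0r normrN gtr0_norm.
  by rewrite addrAC subrr add0r mulrA pmulr_lgt0 ?invr_gt0.
(* Convergence in [e] at the two end points alone preserves the opposite signs; in between, only
   continuity in [t] for fixed [e] enters. *)
have cD t : `|t| < r -> (fun e => rho * D e t) @ (0 : R)^'+ --> rho * D0 t.
  move=> tlt; apply: cvgMr.
  apply: (matching_cvg (K := K) X0 (ltW c0)); last exact: uc.
    by apply: filterS wbe => e; apply; exact: ltW.
  exact: (wb0 _ (ltW tlt)).
have n1 : \forall e \near (0 : R)^'+, rho * D e (t0 - h) < 0.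
  exact: (cvgr_lt _ (cD _ l1) _ s1).
have n2 : \forall e \near (0 : R)^'+, 0 < rho * D e (t0 + h).
  exact: (cvgr_gt _ (cD _ l2) _ s2).
near=> e.
have wb : forall t, `|t| <= r ->
    well_behaved (axis_mx F omega s (mbar * e ^+ 2) (Ue e) (Ve e) t) X c K by near: e.
have e1 : rho * D e (t0 - h) < 0 by near: e.
have e2 : 0 < rho * D e (t0 + h) by near: e.
have cDe : {within `[t0 - h, t0 + h], continuous (fun t => rho * D e t)}.
  apply: continuous_in_subspaceT => t; rewrite inE /= in_itv /= => tab.
  apply: cvgMr; apply: (matching_cvg (K := K) X0 (ltW c0)).
  - have : \forall t' \near t, `|t'| < r.
      exact: (cvgr_lt _ (@norm_continuous R R t) _ (tr t tab)).
    by apply: filterS => t' /ltW; exact: wb.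
  - exact: (wb _ (ltW (tr t tab))).
  - exact: axis_cvg.
have [t tab Dt0] := IVT_sign ab cDe e1 e2.
have {}Dt0 : D e t = 0 by move/eqP: Dt0; rewrite mulf_eq0 (negPf rhon) => /eqP.
exists (0 +i* t); split => //.
  exact: (axis_eigenvalue X0 c0 (wb t (ltW (tr t tab))) Dt0).
rewrite lE.
have -> : (0 +i* t) - (0 +i* t0) = 0 +i* (t - t0) :> R[i] by simpc.
rewrite normc_def /= expr0n add0r sqrtr_sqr ltcR.
exact: le_lt_trans (dist t tab) hdel.
Unshelve. all: by end_near. Qed.
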